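(* Let $d\in\mathbb{N}$, $\alpha\in(0,2\wedge d)$ and $\delta\in(0,d-\alpha)$. There is a Borel function $\tilde p\colon(0,\infty)\times\mathbb{R}^d_0\times\mathbb{R}^d_0\to(0,\infty)$ such that for every $s\in\mathbb{R}$, $x\in\mathbb{R}^d_0$ and $\phi\in C_c^\infty(\mathbb{R}\times\mathbb{R}^d)$ we have $$\int_s^\infty\int_{\mathbb{R}^d}\tilde p(u-s,x,z)\left[\partial_u-(-\Delta_z+1)^{\alpha/2}+V_\delta(z)\right]\phi(u,z)\,dz\,du=-\phi(s,x),$$ and the double integral is absolutely convergent.
   Context: $\mathbb{N}=\{1,2,\ldots\}$, $\mathbb{R}^d_0=\mathbb{R}^d\setminus\{0\}$, $a\wedge b=\min\{a,b\}$; $C_c^\infty$ denotes smooth compactly supported functions. The operator $-(-\Delta+1)^{\alpha/2}$ acts on $f\in C_c^\infty(\mathbb{R}^d)$ as the Fourier multiplier with symbol $-(|\xi|^2+1)^{\alpha/2}$; $(-\Delta_z+1)^{\alpha/2}\phi(u,z)$ means that the operator is applied to $\phi(u,\cdot)$ for each fixed $u$. The potential is $$V_\delta(x)=\frac{2^{\alpha/2}\,\Gamma\left(\frac{d-\delta}{2}\right)}{\Gamma\left(\frac{d-\delta-\alpha}{2}\right)}\,\frac{K_{\frac{\delta+\alpha}{2}}(|x|)}{K_{\frac{\delta}{2}}(|x|)}\,|x|^{-\alpha/2},\qquad x\in\mathbb{R}^d_0,$$ where $\Gamma$ is the Gamma function and $K_\nu$ is the modified Bessel function of the second kind, $K_\nu(r)=\frac12\left(\frac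 r2\right)^\nu\int_0^\infty u^{-\nu-1}e^{-u-r^2/(4u)}\,du$, $r>0$, $\nu\in\mathbb{R}$. *)

(* Defs.v *)
From HB Require Import structures.
From mathcomp Require Import all_boot all_order all_algebra.
From mathcomp Require Import all_classical all_reals all_analysis.
From mathcomp Require Import measurable_realfun complex.

Set Implicit Arguments.
Unset Strict Implicit.
Unset Printing Implicit Defensive.

Import Order.TTheory GRing.Theory Num.Theory.
Import numFieldNormedType.Exports.

Local Open Scope classical_set_scope.
Local Open Scope ring_scope.

(* The Borel sigma-algebra of R^n, whose topology is the one that the library
   puts on row vectors. *)
Definition borel_rV_display : measure_display.
Proof. exact: default_measure_display. Qed.

Section borel_rV.
Context {R : realType} {n : nat}.

HB.instance Definition _ := @isMeasurable.Build borel_rV_display 'rV[R]_n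
  <<s @open 'rV[R]_n >> (@sigma_algebra0 _ setT _) (@sigma_algebraC _ _)
  (@sigma_algebra_bigcup _ setT _).

Lemma measurable_coord (i : 'I_n) :
  measurable_fun setT (fun v : 'rV[R]_n => v 0 i).
Proof.
apply: (@measurability _ _ _ _ setT (fun v : 'rV[R]_n => v 0 i) _
  (RGenOInfty.measurableE R)) => _ [_ [a ->] <-].
rewrite setTI; apply: sub_sigma_algebra.
by apply: open_comp; [move=> v _; exact: coord_continuous|exact: interval_open].
Qed.

Lemma measurable_rVP d (T : measurableType d) (f : T -> 'rV[R]_n) :
  (forall i, measurable_fun setT (fun t => f t 0 i)) -> measurable_fun setT f.
Proof.
move=> mf; apply: (@measurability _ _ _ _ _ _ (@open 'rV[R]_n)) => //.
move=> _ [U oU <-]; rewrite setTI.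
pose Q (ck : 'rV[rat]_n * nat) : set 'rV[R]_n :=
  ball (\row_i ratr (ck.1 0 i) : 'rV[R]_n) (ck.2.+1%:R^-1).
pose P (m : nat) := if unpickle m is Some ck then
  if `[< Q ck `<=` U >] then Q ck else set0 else set0.
have -> : U = \bigcup_m P m.
  apply/seteqP; split=> [v Uv|v [m _]]; last first.
    rewrite /P; case: unpickle => // ck; case: asboolP => // + Qv.
    exact.
  have /nbhs_ballP[e /= e0 veU] : nbhs v U by exact: open_nbhs_nbhs.
  have [k ke] : exists k : nat, k.+1%:R^-1 < e / 2 :> R.
    exists (Num.trunc (e / 2)^-1); rewrite invf_plt ?posrE ?divr_gt0//.
    exact: truncnS_gt.
  have k0 : (0 : R) < k.+1%:R^-1 by rewrite invr_gt0.
  have cP i : exists q : rat, ball (v 0 i) k.+1%:R^-1 (ratr q).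
    have [x [/= vx [q _ qx]]] := @dense_rat R (ball (v 0 i) k.+1%:R^-1)
      (ex_intro _ _ (ballxx _ k0)) (ball_open _ _).
    by exists q; rewrite qx.
  pose c : 'rV[rat]_n := \row_i sval (cid (cP i)).
  exists (pickle (c, k)) => //; rewrite /P pickleK.
  have cv : Q (c, k) v.
    split=> // i j; rewrite !mxE !ord1; apply: ball_sym.
    by case: cid.
  case: asboolP => // -[] w cw; apply: veU.
  apply: (@ball_split _ _ (\row_i ratr (c 0 i) : 'rV[R]_n)).
    by apply: ball_sym; apply: le_ball cv; exact: ltW.
  by apply: le_ball cw; exact: ltW.
rewrite preimage_bigcup; apply: bigcupT_measurable => m.
rewrite /P; case: unpickle => [ck|]; last by rewrite preimage_set0.
case: asboolP => _; last by rewrite preimage_set0.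
rewrite (_ : _ @^-1` _ = \bigcap_(i in [set: 'I_n])
    ((fun t => f t 0 i) @^-1` ball (ratr (ck.1 0 i) : R) ck.2.+1%:R^-1)).
  apply: fin_bigcap_measurable => // i _; rewrite -[X in measurable X]setTI.
  by apply: mf => //; apply: open_measurable; exact: ball_open.
apply/seteqP; split=> [t [_ +] i _|t ft].
  by move=> /(_ 0 i); rewrite !mxE.
by split=> [|i j]; rewrite ?invr_gt0// !mxE !ord1; exact: ft.
Qed.

End borel_rV.

(* The product of Lebesgue measure on R and a measure on R^n, as a measure on
   R^(n+1). *)
Section cons_measure.
Context {R : realType} {n : nat}.

Definition cons_rV (w : measurableTypeR R * 'rV[R]_n) : 'rV[R]_n.+1 :=
  row_mx (const_mx w.1 : 'rV_1) w.2.

Lemma cons_rV0 w : cons_rV w 0 ord0 = w.1.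
Proof.
have -> : ord0 = lshift n (ord0 : 'I_1) :> 'I_(1 + n) by exact/val_inj.
by rewrite [LHS]row_mxEl mxE.
Qed.

Lemma cons_rVS w i : cons_rV w 0 (lift ord0 i) = w.2 0 i.
Proof.
have -> : lift ord0 i = rshift 1 i :> 'I_(1 + n) by exact/val_inj.
by rewrite [LHS]row_mxEr.
Qed.

Lemma measurable_cons_rV : measurable_fun setT cons_rV.
Proof.
apply: measurable_rVP => i; have [j ->|->] := unliftP ord0 i.
  rewrite (_ : (fun _ => _) = (fun v : 'rV[R]_n => v 0 j) \o snd).
    exact: measurableT_comp (measurable_coord j) measurable_snd.
  by apply/funext => w; rewrite cons_rVS.
rewrite (_ : (fun _ => _) = fst); first exact: measurable_fst.
by apply/funext => w; rewrite cons_rV0.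
Qed.

Variable mu : {sigma_finite_measure set 'rV[R]_n -> \bar R}.

Definition lebesgue_cons : set 'rV[R]_n.+1 -> \bar R :=
  pushforward (lebesgue_measure \x mu)%E cons_rV.

Let m_cons : {measure set _ -> \bar R} :=
  measure_function_pushforward__canonical__measure_function_Measure
    (lebesgue_measure \x mu)%E measurable_cons_rV.

Let lebesgue_cons0 : lebesgue_cons set0 = 0%E.
Proof. exact: (measure0 m_cons). Qed.

Let lebesgue_cons_ge0 A : (0 <= lebesgue_cons A)%E.
Proof. exact: (measure_ge0 m_cons). Qed.

Let lebesgue_cons_sigma_additive : semi_sigma_additive lebesgue_cons.
Proof. exact: (@measure_semi_sigma_additive _ _ _ m_cons). Qed.

HB.instance Definition _ := isMeasure.Build _ _ _ lebesgue_cons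
  lebesgue_cons0 lebesgue_cons_ge0 lebesgue_cons_sigma_additive.

Let lebesgue_cons_sigma_finite : sigma_finite setT lebesgue_cons.
Proof.
(* The library's instance for \x does not make the product of two sigma-finite
   measures canonically sigma-finite. *)
have [F FT Fmoo] : sigma_finite setT (lebesgue_measure \x mu)%E.
  have /sigma_finiteP[F [TF ndF Foo]] := sigma_finiteT (@lebesgue_measure R).
  have /sigma_finiteP[G [TG ndG Goo]] := sigma_finiteT mu.
  exists (fun k => F k `*` G k).
    rewrite -setXTT TF TG; apply/seteqP; split=> [[x y]|[x y] [k _ [/= ? ?]]].
      move=> [/= [k _ Fkx] [m _ Gmy]]; exists (maxn k m) => //; split.
        by move: x Fkx; exact/subsetPset/ndF/leq_maxl.
      by move: y Gmy; exact/subsetPset/ndG/leq_maxr.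
    by split; exists k.
  move=> k; have [? ?] := Foo k; have [? ?] := Goo k.
  split; first exact: measurableX.
  by rewrite product_measure1E// lte_mul_pinfty// ge0_fin_numE.
pose uncons (v : 'rV[R]_n.+1) : measurableTypeR R * 'rV[R]_n :=
  (v 0 ord0, rsubmx (v : 'rV_(1 + n))).
have m_uncons : measurable_fun setT uncons.
  apply: measurable_fun_pair; first exact: measurable_coord.
  apply: measurable_rVP => i.
  rewrite (_ : (fun _ => _) = fun v : 'rV[R]_n.+1 => v 0 (rshift 1 i)).
    exact: measurable_coord.
  by apply/funext => v; rewrite mxE.
have consK w : uncons (cons_rV w) = w.
  by case: w => t v; congr pair; [exact: cons_rV0|exact: row_mxKr].
exists (fun k => uncons @^-1` F k).
  by rewrite -preimage_bigcup -FT preimage_setT.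
move=> k; have [mF Foo] := Fmoo k; split.
  by rewrite -[X in measurable X]setTI; exact: m_uncons.
rewrite /lebesgue_cons /pushforward (_ : _ @^-1` _ = F k)//.
by apply/seteqP; split => w /=; rewrite consK.
Qed.

HB.instance Definition _ := @Measure_isSigmaFinite.Build _ _ _ lebesgue_cons
  lebesgue_cons_sigma_finite.

End cons_measure.

Fixpoint lebesgue_rV {R : realType} (n : nat) :
    {sigma_finite_measure set 'rV[R]_n -> \bar R} :=
  if n is n'.+1 then lebesgue_cons (lebesgue_rV n') else \d_(0 : 'rV[R]_0).

Lemma lebesgue_rV_setX {R : realType} (n : nat) (A : 'I_n -> set R) :
    (forall i, measurable (A i)) ->
  lebesgue_rV n [set v | forall i, A i (v 0 i)] =
    \big[*%E/1%E]_(i < n) lebesgue_measure (A i).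
Proof.
elim: n A => [|n IH] A mA.
  by rewrite big_ord0 /= diracE mem_set//= => -[].
rewrite big_ord_recl/= -IH; last by move=> i; exact: mA.
have mB : measurable [set v : 'rV[R]_n | forall i, A (lift ord0 i) (v 0 i)].
  rewrite (_ : [set _ | _] = \bigcap_(i in [set: 'I_n])
      ((fun v : 'rV[R]_n => v 0 i) @^-1` A (lift ord0 i))).
    apply: fin_bigcap_measurable => // i _; rewrite -[X in measurable X]setTI.
    by apply: measurable_coord => //; exact: mA.
  by apply/seteqP; split=> [v vA i _|v vA i]; exact: vA.
rewrite -[RHS]product_measure1E//; last exact: mA.
rewrite /lebesgue_cons /pushforward; congr product_measure1.
apply/seteqP; split=> w /=.
  by move=> wA; split=> [|i]; [rewrite -cons_rV0|rewrite -cons_rVS]; exact: wA.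
move=> [w0 wS] i; have [j ->|->] := unliftP ord0 i; first by rewrite cons_rVS.
by rewrite cons_rV0.
Qed.

Section special_functions.
Context {R : realType}.
Implicit Types nu r x : R.

(* The integral converges, and this is the Gamma function, for 0 < x. *)
Definition Gamma x : R :=
  \int[lebesgue_measure]_(t in `]0, +oo[) (t `^ (x - 1) * expR (- t)).

(* Modified Bessel function of the second kind, for 0 < r. *)
Definition besselK nu r : R := 2^-1 * (r / 2) `^ nu *
  \int[lebesgue_measure]_(u in `]0, +oo[)
    (u `^ (- nu - 1) * expR (- u - r ^+ 2 / (4 * u))).

End special_functions.

Section euclidean.
Context {R : realType} {n : nat}.
Implicit Types x y : 'rV[R]_n.

Definition dotp x y : R := \sum_(i < n) x 0 i * y 0 i.

(* The norm `|x| of the library is the sup norm. *)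
Definition enorm x : R := Num.sqrt (dotp x x).

End euclidean.

Definition potential {R : realType} {d : nat} (alpha delta : R)
    (x : 'rV[R]_d) : R :=
  2 `^ (alpha / 2) * Gamma ((d%:R - delta) / 2) /
    Gamma ((d%:R - delta - alpha) / 2) *
  (besselK ((delta + alpha) / 2) (enorm x) / besselK (delta / 2) (enorm x)) *
  enorm x `^ (- (alpha / 2)).

Section fourier.
Context {R : realType} {d : nat}.
Local Notation C := (R[i]%C).

Definition cexpi (t : R) : C := Complex (cos t) (sin t).

Definition cintegral (f : 'rV[R]_d -> C) : C :=
  Complex (\int[lebesgue_rV d]_x complex.Re (f x))
          (\int[lebesgue_rV d]_x complex.Im (f x)).

Definition fourier (f : 'rV[R]_d -> C) (xi : 'rV[R]_d) : C :=
  cintegral (fun x => f x * cexpi (- dotp xi x)).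

Definition inverse_fourier (g : 'rV[R]_d -> C) (x : 'rV[R]_d) : C :=
  real_complex R ((2 * pi) ^- d) *
  cintegral (fun xi => g xi * cexpi (dotp xi x)).

(* The Fourier multiplier (-Delta + 1)^(alpha/2). For a real f the inverse
   transform is real because the symbol is even, so taking the real part only
   changes the type. *)
Definition relativistic_op (alpha : R) (f : 'rV[R]_d -> R) (x : 'rV[R]_d) : R :=
  complex.Re (inverse_fourier (fun xi =>
    real_complex R ((enorm xi ^+ 2 + 1) `^ (alpha / 2)) *
    fourier (fun y => real_complex R (f y)) xi) x).

End fourier.

(* All iterated directional derivatives exist and are differentiable (hence
   continuous); in finite dimension this is C^oo. *)
Definition smooth {R : realType} {V : normedModType R} (f : V -> R) : Prop :=
  forall (vs : seq V) (x : V),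
    differentiable (foldr (fun v (g : V -> R) => 'D_v g) f vs) x.

Definition Cc_smooth {R : realType} {V : normedModType R} (f : V -> R) : Prop :=
  smooth f /\ compact (closure [set x | f x != 0]).

(* Main.v *)
From HB Require Import structures.
From mathcomp Require Import all_boot all_order all_algebra.
From mathcomp Require Import all_classical all_reals all_analysis.
From mathcomp Require Import measurable_realfun complex ring lra.
Require Import Defs.

(** Write [lam xi = 1 + |xi| ^ 2] and [a = alpha / 2], so that the operator
    [L = (1 - Laplacian) ^ a] has the symbol [psi = lam ^ a]. The kernel wanted
    is that of the Schrodinger semigroup of [L - V]. It is built as the
    perturbation series of the free kernel [p] of [L], and the point is that this
    series is finite although [V] is singular at the origin.

    The potential is a quotient. Let [b = (d - delta - alpha) / 2], and let [h']
    and [h] be the functions with transforms [lam ^ (- b)] and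
    [lam ^ (- b - a)] ([bes b 0] and [bes (b + a) 0]). They are mixtures of
    Gaussians, in closed form Bessel functions times powers of [|x|], and
    [V = h' / h] off the origin ([potential_bes]). Formally [L h = h' = V h]: the
    positive function [h] is a ground state of [L - V].

    The free kernel is positive. The Levy representation
    [lam ^ a = c * integral of (1 - exp (- r lam)) r ^ (- a - 1) dr] ([levyE])
    exhibits [exp (- t psi)] as a limit of mixtures of the multipliers
    [exp (- r lam)], whose transforms are Gaussians. Keeping one jump of size
    about 1 also bounds the kernel below by a multiple of
    [exp (- |x| ^ 2 / 4)], locally uniformly in time ([pker_ge]). Plane waves are
    eigenfunctions of the kernel ([Rint_pker_cos]), by Fourier inversion.

    The series is finite almost everywhere. A function [H] with [U (f + V H) <= H]
    for a resolvent [U] of the free semigroup bounds the series applied to [f]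
    ([kop_kpert_le]). The ground state gives [U (h' + kap h) <= h] ([rop_bes]),
    which is the case [H = h], [f = kap h]; but [h] vanishes at infinity, and the
    integrand of the theorem is only bounded by a multiple of [1 + V]. Since [V]
    is bounded off the unit ball, a combination of 1, [h] and [U h] is a
    supersolution with [f] at least a multiple of [1 + V] ([supersolution]).

    The equation. For a test function [phi] let [theta] be the free parabolic
    operator applied to [phi]. On the Fourier side the free kernel satisfies
    [p theta = - phi] by a scalar variation of constants ([pker_free_identity]).
    Duhamel's formula [q f = p f + q V p f] for the perturbed kernel [q] gives
    [q (theta + V phi) = p theta + q V p theta + q V phi = - phi]
    ([hker_balance]); to stay within nonnegative integrals, the positive and the
    negative parts of [theta] and [phi] are treated separately.

    The perturbed kernel is Borel, invariant under time shifts, and at least the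
    free kernel, hence strictly positive; replacing the value infinity, taken on
    a null set only, by 1 gives the function of the theorem. *)

Set Implicit Arguments.
Unset Strict Implicit.
Unset Printing Implicit Defensive.

Import Order.TTheory GRing.Theory Num.Theory.
Import numFieldNormedType.Exports.

Local Open Scope classical_set_scope.
Local Open Scope ring_scope.

(** * Real-valued integrals *)
Section integrals.
Context {R : realType}.

Section one_measure.
Context d (T : measurableType d) (m : {measure set T -> \bar R}) (D : set T).
Hypothesis mD : measurable D.
Implicit Types f g : T -> R.

Lemma integrable_measurable f : m.-integrable D (EFin \o f) -> measurable_fun D f.
Proof. by move=> fi; apply/measurable_EFinP; exact: measurable_int fi. Qed.

Lemma integrable_dom f g : measurable_fun D f ->
  m.-integrable D (EFin \o g) -> (forall x, D x -> `|f x| <= g x) ->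
  m.-integrable D (EFin \o f).
Proof.
move=> mf ig fg; apply: le_integrable ig => //; first exact/measurable_EFinP.
move=> x Dx /=; rewrite lee_fin (le_trans (fg _ Dx))// ler_norm//.
Qed.

Lemma integrable_normr f : m.-integrable D (EFin \o f) ->
  m.-integrable D (EFin \o (fun x => `|f x|)).
Proof.
move=> fi; apply: (le_integrable mD _ _ fi) => [|x _]; last by rewrite /= normr_id.
by apply/measurable_EFinP; apply: measurableT_comp => //; exact: integrable_measurable.
Qed.

Lemma integrable_scalel c f : m.-integrable D (EFin \o f) ->
  m.-integrable D (EFin \o (fun x => c * f x)).
Proof.
by move=> fi; under [X in _.-integrable _ X]eq_fun do rewrite /= EFinM;
  exact: integrableZl.
Qed.

Lemma integrable_add f g : m.-integrable D (EFin \o f) -> m.-integrable D (EFin \o g) ->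
  m.-integrable D (EFin \o (fun x => f x + g x)).
Proof.
by move=> fi gi; under [X in _.-integrable _ X]eq_fun do rewrite /= EFinD;
  exact: integrableD.
Qed.

Lemma integrable_sub f g : m.-integrable D (EFin \o f) -> m.-integrable D (EFin \o g) ->
  m.-integrable D (EFin \o (fun x => f x - g x)).
Proof.
by move=> fi gi; under [X in _.-integrable _ X]eq_fun do rewrite /= EFinB;
  exact: integrableB.
Qed.

Lemma normr_Rint_le f g : measurable_fun D f ->
  m.-integrable D (EFin \o g) -> (forall x, D x -> `|f x| <= g x) ->
  `|\int[m]_(x in D) f x| <= \int[m]_(x in D) g x.
Proof.
move=> mf ig fg; have fi := integrable_dom mf ig fg.
rewrite (le_trans (le_normr_Rintegral mD fi))//.
by apply: le_Rintegral => //; exact: integrable_normr.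
Qed.

Lemma Rint_EFin f : m.-integrable D (EFin \o f) ->
  (\int[m]_(x in D) (f x)%:E)%E = (\int[m]_(x in D) f x)%:E.
Proof. by move=> fi; rewrite /Rintegral fineK//; exact: integrable_fin_num. Qed.

Lemma Rint_dct (f_ : nat -> T -> R) f g :
  (forall n, measurable_fun D (f_ n)) ->
  (forall x, D x -> f_ n x @[n --> \oo] --> f x) ->
  m.-integrable D (EFin \o g) -> (forall n x, D x -> `|f_ n x| <= g x) ->
  \int[m]_(x in D) f_ n x @[n --> \oo] --> \int[m]_(x in D) f x.
Proof.
move=> mf ff ig fg.
have mf' n : measurable_fun D (fun x => (f_ n x)%:E) by exact/measurable_EFinP.
have ff' x : D x -> (f_ n x)%:E @[n --> \oo] --> (f x)%:E.
  by move=> Dx; apply: cvg_EFin; [exact: nearW|exact: ff].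
have mfl : measurable_fun D (fun x => (f x)%:E).
  exact: (emeasurable_fun_cvg _ _ mf' ff').
have [fi _ cv] := @dominated_convergence _ T R m D mD (fun n x => (f_ n x)%:E)
  (fun x => (f x)%:E) (EFin \o g) mf' mfl (aeW _ ff') ig
  (aeW _ (fun x n Dx => fg n x Dx)).
apply: fine_cvg; rewrite fineK//; exact: integrable_fin_num.
Qed.

End one_measure.

Lemma measurable_comp2 d1 d2 d3 d (T1 : measurableType d1) (T2 : measurableType d2)
    (T3 : measurableType d3) (T : measurableType d)
    (F : T1 -> T2 -> T3) (f : T -> T1) (g : T -> T2) :
  measurable_fun setT (fun w => F w.1 w.2) ->
  measurable_fun setT f -> measurable_fun setT g ->
  measurable_fun setT (fun t => F (f t) (g t)).
Proof.
move=> mF mf mg.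
rewrite (_ : (fun _ => _) = (fun w => F w.1 w.2) \o (fun t => (f t, g t)))//.
by apply: measurableT_comp => //; exact: measurable_fun_pair.
Qed.

Lemma measurable_Rint d1 d2 (T1 : measurableType d1) (T2 : measurableType d2)
    (m2 : {sigma_finite_measure set T2 -> \bar R}) (F : T1 -> T2 -> R) :
  measurable_fun setT (fun w => F w.1 w.2) ->
  measurable_fun setT (fun x => \int[m2]_y F x y).
Proof.
move=> mF; rewrite /Rintegral.
apply: measurableT_comp => //.
pose f (w : T1 * T2) := (F w.1 w.2)%:E.
have mf : measurable_fun setT f by exact/measurable_EFinP.
rewrite (_ : (fun x => _) =
  (fun x => fubini_F m2 f^\+ x - fubini_F m2 f^\- x)%E); last first.
  by apply/funext => x; rewrite integralE; congr (_ - _)%E;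
    apply: eq_integral => y _; rewrite ?funeposE ?funenegE.
apply: emeasurable_funB; apply: measurable_fun_fubini_tonelli_F => //.
- exact: measurable_funepos.
- exact: measurable_funeneg.
Qed.

Section swap.
Context d1 d2 (T1 : measurableType d1) (T2 : measurableType d2).
Variable m1 : {sigma_finite_measure set T1 -> \bar R}.
Variable m2 : {sigma_finite_measure set T2 -> \bar R}.
Variables (F : T1 -> T2 -> R) (f : T1 -> R) (g : T2 -> R).
Hypothesis mF : measurable_fun setT (fun w => F w.1 w.2).
Hypothesis fi : m1.-integrable setT (EFin \o f).
Hypothesis gi : m2.-integrable setT (EFin \o g).
Hypothesis Ffg : forall x y, `|F x y| <= f x * g y.

(** A kernel dominated by a product of integrable functions is integrable for
    the product measure; every exchange of integrals below rests on this. *)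
Lemma tensor_integrable : (m1 \x m2)%E.-integrable setT (fun w => (F w.1 w.2)%:E).
Proof.
have mE : measurable_fun setT (fun w : T1 * T2 => (F w.1 w.2)%:E).
  exact/measurable_EFinP.
apply/(integrable12ltyP m1 m2 mE) => /=.
have mg := integrable_measurable gi; have mf := integrable_measurable fi.
apply: (@le_lt_trans _ _
    (\int[m1]_x (`|(f x)%:E| * \int[m2]_y `|(g y)%:E|))%E).
  apply: ge0_le_integral => //.
  - by move=> x _; apply: integral_ge0.
  - apply: (@measurable_fun_fubini_tonelli_F _ _ T1 T2 R m2
      (fun w => `|F w.1 w.2|%:E)) => //.
    by do 2 apply: measurableT_comp => //.
  - by apply: emeasurable_funM => //; do 2 apply: measurableT_comp => //.
  move=> x _; rewrite -ge0_integralZl//=; last by do 2 apply: measurableT_comp => //.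
  apply: ge0_le_integral => //.
  - by do 2 apply: measurableT_comp => //; apply: measurableT_comp mF (measurable_pair1 x).
  - by apply: emeasurable_funM => //; do 2 apply: measurableT_comp => //.
  - move=> y _; rewrite -EFinM lee_fin -normrM (le_trans (Ffg x y))// ler_norm//.
have gfin : (\int[m2]_y `|(g y)%:E| < +oo)%E by case/integrableP : gi.
have ffin : (\int[m1]_y `|(f y)%:E| < +oo)%E by case/integrableP : fi.
rewrite ge0_integralZr//=; last 2 first.
- by do 2 apply: measurableT_comp => //.
- exact: integral_ge0.
by rewrite lte_mul_pinfty// ?integral_ge0// ge0_fin_numE ?integral_ge0.
Qed.

Lemma tensor_section x : m2.-integrable setT (EFin \o F x).
Proof.
apply: (integrable_dom measurableT (g := fun y => `|f x| * `|g y|)).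
- by apply: measurableT_comp mF (measurable_pair1 x).
- by apply: integrable_scalel => //; exact: integrable_normr.
- by move=> y _; rewrite -normrM (le_trans (Ffg x y))// ler_norm.
Qed.

Lemma tensor_Rint_integrable : m1.-integrable setT (EFin \o (fun x => \int[m2]_y F x y)).
Proof.
apply: (integrable_dom measurableT (g := fun x => (\int[m2]_y `|g y|) * `|f x|)).
- exact: measurable_Rint.
- by apply: integrable_scalel => //; exact: integrable_normr.
move=> x _; rewrite mulrC -RintegralZl//; last exact: integrable_normr.
apply: normr_Rint_le => //.
- by apply: measurableT_comp mF (measurable_pair1 x).
- by apply: integrable_scalel => //; exact: integrable_normr.
- by move=> y _; rewrite -normrM (le_trans (Ffg x y))// ler_norm.
Qed.

End swap.

Lemma swap_Rint d1 d2 (T1 : measurableType d1) (T2 : measurableType d2)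
    (m1 : {sigma_finite_measure set T1 -> \bar R})
    (m2 : {sigma_finite_measure set T2 -> \bar R})
    (F : T1 -> T2 -> R) (f : T1 -> R) (g : T2 -> R) :
  measurable_fun setT (fun w => F w.1 w.2) ->
  m1.-integrable setT (EFin \o f) -> m2.-integrable setT (EFin \o g) ->
  (forall x y, `|F x y| <= f x * g y) ->
  \int[m1]_x \int[m2]_y F x y = \int[m2]_y \int[m1]_x F x y.
Proof.
move=> mF fi gi Ffg.
have mF' : measurable_fun setT (fun w : T2 * T1 => F w.2 w.1).
  by apply: (measurable_comp2 mF) => //.
have Ffg' y x : `|F x y| <= g y * f x by rewrite mulrC.
apply: EFin_inj; rewrite -!Rint_EFin//; last 2 first.
- exact: (@tensor_Rint_integrable _ _ _ _ m2 m1 (fun y x => F x y) g f).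
- exact: (@tensor_Rint_integrable _ _ _ _ m1 m2 F f g).
under eq_integral do rewrite -Rint_EFin ?(tensor_section mF gi Ffg)//.
under [in RHS]eq_integral do rewrite -Rint_EFin ?(tensor_section mF' fi Ffg')//.
exact: (Fubini (tensor_integrable mF fi gi Ffg)).
Qed.

End integrals.

(** * Measurability and integration on Euclidean space *)
Section measurability.
Context {R : realType}.

Lemma measurable_fun_continuous_rV n (f : 'rV[R]_n -> R) :
  continuous f -> measurable_fun setT f.
Proof.
move=> cf; apply: (@measurability _ _ _ _ setT f _
  (RGenOInfty.measurableE R)) => _ [_ [a ->] <-].
rewrite setTI; apply: sub_sigma_algebra.
by apply: open_comp; [move=> v _; exact: cf|exact: interval_open].
Qed.

Context d (T : measurableType d).

Lemma measurable_coord_comp n (f : T -> 'rV[R]_n) i :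
  measurable_fun setT f -> measurable_fun setT (fun t => f t 0 i).
Proof. by move=> mf; exact: (measurableT_comp (measurable_coord i) mf). Qed.

Lemma measurable_dotp n (f g : T -> 'rV[R]_n) :
  measurable_fun setT f -> measurable_fun setT g ->
  measurable_fun setT (fun t => dotp (f t) (g t)).
Proof.
move=> mf mg; rewrite /dotp; apply: measurable_sum => i.
by apply: measurable_funM; exact: measurable_coord_comp.
Qed.

Lemma measurable_rVD n (f g : T -> 'rV[R]_n) :
  measurable_fun setT f -> measurable_fun setT g ->
  measurable_fun setT (fun t => f t + g t).
Proof.
move=> mf mg; apply: measurable_rVP => i.
under [X in measurable_fun _ X]eq_fun do rewrite mxE.
by apply: measurable_funD; exact: measurable_coord_comp.
Qed.

Lemma measurable_rVN n (f : T -> 'rV[R]_n) :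
  measurable_fun setT f -> measurable_fun setT (fun t => - f t).
Proof.
move=> mf; apply: measurable_rVP => i.
under [X in measurable_fun _ X]eq_fun do rewrite mxE.
exact: (measurableT_comp (@oppr_measurable R setT) (measurable_coord_comp _ mf)).
Qed.

Lemma measurable_rVZ n (c : T -> R) (f : T -> 'rV[R]_n) :
  measurable_fun setT c -> measurable_fun setT f ->
  measurable_fun setT (fun t => c t *: f t).
Proof.
move=> mc mf; apply: measurable_rVP => i.
under [X in measurable_fun _ X]eq_fun do rewrite mxE.
by apply: measurable_funM => //; exact: measurable_coord_comp.
Qed.

Lemma measurable_cosf (f : T -> R) :
  measurable_fun setT f -> measurable_fun setT (fun t => cos (f t)).
Proof.
by move=> mf; apply: (measurableT_comp _ mf);
  exact: continuous_measurable_fun (@continuous_cos R).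
Qed.

Lemma measurable_expRf (f : T -> R) :
  measurable_fun setT f -> measurable_fun setT (fun t => expR (f t)).
Proof. by move=> mf; exact: (measurableT_comp (@measurable_expR R) mf). Qed.

Lemma measurable_normf (f : T -> R) :
  measurable_fun setT f -> measurable_fun setT (fun t => `|f t|).
Proof. by move=> mf; exact: measurableT_comp. Qed.

Lemma measurable_powRf (f : T -> R) p :
  measurable_fun setT f -> measurable_fun setT (fun t => f t `^ p).
Proof. by move=> mf; exact: (measurableT_comp (measurable_powR p) mf). Qed.

Lemma measurable_oppf (f : T -> R) :
  measurable_fun setT f -> measurable_fun setT (fun t => - f t).
Proof. by move=> mf; exact: (measurableT_comp (@oppr_measurable R setT) mf). Qed.

Lemma measurable_invf (f : T -> R) : (forall t, 0 <= f t) ->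
  measurable_fun setT f -> measurable_fun setT (fun t => (f t)^-1).
Proof.
move=> f0 mf; under [X in measurable_fun _ X]eq_fun => t.
  rewrite -powR_inv1//; over.
exact: measurable_powRf.
Qed.

Lemma measurable_cons_rVf n (f : T -> R) (g : T -> 'rV[R]_n) :
  measurable_fun setT f -> measurable_fun setT g ->
  measurable_fun setT (fun t => cons_rV (f t, g t)).
Proof.
move=> mf mg; apply: (measurableT_comp (@measurable_cons_rV R n)).
exact: measurable_fun_pair.
Qed.

End measurability.

(** Solves measurability goals built from the operations above; the remaining
    goals are the subterms that it does not know. *)
Ltac meas := repeat first
  [ assumption | exact: measurable_cst | exact: measurable_id
  | exact: measurable_fst | exact: measurable_snd
  | apply: measurable_funM | apply: measurable_funB | apply: measurable_funD
  | apply: measurable_oppf | apply: measurable_normf | apply: measurable_funX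
  | apply: measurable_expRf | apply: measurable_powRf | apply: measurable_cosf
  | apply: measurable_dotp | apply: measurable_cons_rVf
  | apply: measurable_rVD | apply: measurable_rVN
  | apply: measurable_rVZ ].

Section dot_product.
Context {R : realType} {n : nat}.
Implicit Types x y z : 'rV[R]_n.

Lemma dotpC x y : dotp x y = dotp y x.
Proof. by apply: eq_bigr => i _; rewrite mulrC. Qed.

Lemma dotpDr x y z : dotp x (y + z) = dotp x y + dotp x z.
Proof. by rewrite -big_split; apply: eq_bigr => i _; rewrite mxE mulrDr. Qed.

Lemma dotpDl x y z : dotp (y + z) x = dotp y x + dotp z x.
Proof. by rewrite dotpC dotpDr !(dotpC x). Qed.

Lemma dotpZr c x y : dotp x (c *: y) = c * dotp x y.
Proof. by rewrite mulr_sumr; apply: eq_bigr => i _; rewrite mxE mulrCA. Qed.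

Lemma dotpZl c x y : dotp (c *: x) y = c * dotp x y.
Proof. by rewrite dotpC dotpZr dotpC. Qed.

Lemma dotpNr x y : dotp x (- y) = - dotp x y.
Proof. by rewrite -scaleN1r dotpZr mulN1r. Qed.

Lemma dotpNl x y : dotp (- x) y = - dotp x y.
Proof. by rewrite dotpC dotpNr dotpC. Qed.

Lemma dotpBr x y z : dotp x (y - z) = dotp x y - dotp x z.
Proof. by rewrite dotpDr dotpNr. Qed.

Lemma dotp0r x : dotp x 0 = 0.
Proof. by rewrite /dotp big1// => i _; rewrite mxE mulr0. Qed.

Lemma dotp_ge0 x : 0 <= dotp x x.
Proof. by apply: sumr_ge0 => i _; rewrite -expr2 sqr_ge0. Qed.

Lemma dotp_eq0 x : (dotp x x == 0) = (x == 0).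
Proof.
apply/idP/eqP => [|->]; last by rewrite dotp0r.
rewrite psumr_eq0; last by move=> i _; rewrite -expr2 sqr_ge0.
move=> /allP h; apply/rowP => i; rewrite mxE.
by have := h i (mem_index_enum _); rewrite -expr2 sqrf_eq0 => /eqP.
Qed.

Lemma dotp_gt0 x : x != 0 -> 0 < dotp x x.
Proof. by move=> x0; rewrite lt_neqAle dotp_ge0 eq_sym dotp_eq0 x0. Qed.

Lemma enormX x : enorm x ^+ 2 = dotp x x.
Proof. by rewrite sqr_sqrtr// dotp_ge0. Qed.

Lemma enorm_gt0 x : x != 0 -> 0 < enorm x.
Proof. by move=> x0; rewrite sqrtr_gt0 dotp_gt0. Qed.

Lemma dotp_cons (t s : R) x y :
  dotp (cons_rV (t, x)) (cons_rV (s, y)) = t * s + dotp x y.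
Proof.
rewrite /dotp big_ord_recl; congr (_ + _); first by rewrite !cons_rV0.
by apply: eq_bigr => i _; rewrite !cons_rVS.
Qed.

Lemma rV_consP (x : 'rV[R]_n.+1) : exists t y, x = cons_rV (t, y).
Proof.
exists (x 0 ord0), (rsubmx (x : 'rV_(1 + n))).
apply/rowP => i; have [j ->|->] := unliftP ord0 i.
  rewrite cons_rVS mxE; congr (x 0 _); exact/val_inj.
by rewrite cons_rV0.
Qed.

End dot_product.

Section cons_integral.
Context {R : realType} {n : nat}.
Local Notation mu := (@lebesgue_measure R).

(** Lebesgue measure is built by adding one coordinate at a time, so integrals
    over the space unfold by induction on the dimension. *)
Lemma ge0_integral_cons (f : 'rV[R]_n.+1 -> \bar R) :
  measurable_fun setT f -> (forall v, 0 <= f v)%E ->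
  (\int[lebesgue_rV n.+1]_v f v =
   \int[mu]_t \int[lebesgue_rV n]_v f (cons_rV (t, v)))%E.
Proof.
move=> mf f0.
rewrite (_ : integral _ _ _ =
  integral (pushforward (mu \x lebesgue_rV n)%E (@cons_rV R n)) setT f)//.
rewrite ge0_integral_pushforward//; last exact: measurable_cons_rV.
rewrite preimage_setT fubini_tonelli1//; last by move=> w; exact: f0.
by apply: measurableT_comp => //; exact: measurable_cons_rV.
Qed.

Section dominated.
Variables (f : 'rV[R]_n.+1 -> R) (a : R -> R) (b : 'rV[R]_n -> R).
Hypothesis mf : measurable_fun setT f.
Hypothesis ai : mu.-integrable setT (EFin \o a).
Hypothesis bi : (lebesgue_rV n).-integrable setT (EFin \o b).
Hypothesis fab : forall t v, `|f (cons_rV (t, v))| <= a t * b v.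

Let mfc : measurable_fun setT (fun w : measurableTypeR R * 'rV[R]_n => f (cons_rV (w.1, w.2))).
Proof. by apply: (measurableT_comp mf); meas. Qed.

Lemma integrable_cons : (lebesgue_rV n.+1).-integrable setT (EFin \o f).
Proof.
apply/integrableP; split; first exact/measurable_EFinP.
have [mE] := integrableP _ _ _ (tensor_integrable mfc ai bi fab).
rewrite fubini_tonelli1//=; last by do 2 apply: measurableT_comp => //.
rewrite ge0_integral_cons//; do 2 apply: measurableT_comp => //.
Qed.

Lemma Rint_cons : \int[lebesgue_rV n.+1]_v f v =
  \int[mu]_t \int[lebesgue_rV n]_v f (cons_rV (t, v)).
Proof.
have fi := tensor_integrable mfc ai bi fab.
rewrite /Rintegral; congr fine.
transitivity (\int[pushforward (mu \x lebesgue_rV n)%E (@cons_rV R n)]_v (f v)%:E)%E => //.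
rewrite integral_pushforward//=; last 2 first.
- exact: measurable_cons_rV.
- exact/measurable_EFinP.
rewrite preimage_setT.
have := integral12_prod_meas1 fi.
rewrite /fubini_F/= => <-.
apply: eq_integral => t _.
rewrite fineK//; apply: integrable_fin_num => //.
exact: (tensor_section mfc bi fab t).
Qed.

End dominated.
End cons_integral.

Section affine1.
Context {R : realType}.
Local Notation mu := (@lebesgue_measure R).

Lemma lebesgue_measure_affine (b c : R) (c0 : 0 < c) (A : set (measurableTypeR R)) :
  measurable A ->
  (mu A = c%:E * mu ((fun t : measurableTypeR R => b + c * t)%R @^-1` A))%E.
Proof.
move=> mA.
pose phi (t : measurableTypeR R) : measurableTypeR R := b + c * t.
have mphi : measurable_fun setT phi by rewrite /phi; meas.
pose m := mscale (NngNum (ltW c0))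
  (measure_function_pushforward__canonical__measure_function_Measure mu mphi).
rewrite (@lebesgue_measure_unique R m)// => _ [[x y] _ <-].
rewrite /m/= /mscale/= /pushforward.
rewrite (_ : phi @^-1` _ = `](x - b) / c, (y - b) / c]%classic); last first.
  apply/seteqP; split => t /=; rewrite /phi !in_itv/=.
    by rewrite ltr_pdivrMr// ler_pdivlMr// ltrBlDl lerBrDl mulrC.
  by rewrite ltr_pdivrMr// ler_pdivlMr// ltrBlDl lerBrDl mulrC.
rewrite !lebesgue_measure_itv/= !lte_fin ltr_pM2r ?invr_gt0// ltrD2r.
case: ifP => _; last by rewrite mule0.
rewrite -!EFinB -EFinM; congr EFin.
by rewrite -mulrBl opprB addrA subrK mulrCA divff ?gt_eqF// mulr1.
Qed.

Lemma ge0_integral_affine (b c : R) (f : R -> \bar R) : 0 < c ->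
  measurable_fun setT f -> (forall t, 0 <= f t)%E ->
  (\int[mu]_t f t = c%:E * \int[mu]_t f (b + c * t)%R)%E.
Proof.
move=> c0 mf f0.
pose phi (t : measurableTypeR R) : measurableTypeR R := b + c * t.
have mphi : measurable_fun setT phi by rewrite /phi; meas.
transitivity (c%:E * \int[pushforward mu phi]_t f t)%E; last first.
  by rewrite ge0_integral_pushforward.
rewrite (_ : c = (NngNum (ltW c0))%:num)//.
rewrite -ge0_integral_mscale//.
apply: eq_measure_integral => A mA _.
exact: lebesgue_measure_affine.
Qed.

End affine1.

Section affine.
Context {R : realType}.

Lemma cons_rV_affine n (t s c : R) (v w : 'rV[R]_n) :
  cons_rV (s + c * t, w + c *: v) = cons_rV (s, w) + c *: cons_rV (t, v).
Proof.
apply/rowP => i; have [j ->|->] := unliftP ord0 i.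
  rewrite [RHS]mxE [(c *: cons_rV _) _ _]mxE !cons_rVS /= [LHS]mxE.
  by rewrite [(c *: v) _ _]mxE.
by rewrite [RHS]mxE [(c *: cons_rV _) _ _]mxE !cons_rV0.
Qed.

Lemma ge0_integral_affine_rV n (b : 'rV[R]_n) (c : R) (f : 'rV[R]_n -> \bar R) :
  0 < c -> measurable_fun setT f -> (forall v, 0 <= f v)%E ->
  (\int[lebesgue_rV n]_v f v =
   (c ^+ n)%:E * \int[lebesgue_rV n]_v f (b + c *: v)%R)%E.
Proof.
move=> c0; elim: n b f => [|n IH] b f mf f0.
  rewrite expr0 mul1e; apply: eq_integral => v _; congr f.
  by apply/rowP => -[].
have [s [w ->]] := rV_consP b.
have mfa : measurable_fun setT (fun v : 'rV[R]_n.+1 => f (cons_rV (s, w) + c *: v)).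
  by apply: (measurableT_comp mf); meas.
rewrite !ge0_integral_cons//.
under [in RHS]eq_integral do under eq_integral do rewrite -cons_rV_affine.
have mG : measurable_fun setT (fun t : R => \int[lebesgue_rV n]_v f (cons_rV (t, v)))%E.
  apply: (@measurable_fun_fubini_tonelli_F _ _ (measurableTypeR R) _ R (lebesgue_rV n)
    (fun w => f (cons_rV (w.1, w.2)))) => //.
  by apply: (measurableT_comp mf); meas.
rewrite (ge0_integral_affine s c0 mG); last by move=> t; exact: integral_ge0.
rewrite exprS EFinM -muleA; congr (_ * _)%E.
rewrite -ge0_integralZl//=.
- apply: eq_integral => t _.
  rewrite (IH w)//.
  by apply: (measurableT_comp mf); meas.
- pose g (w' : measurableTypeR R * 'rV[R]_n) := f (cons_rV (s + c * w'.1, w + c *: w'.2)).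
  apply: (@measurable_fun_fubini_tonelli_F _ _ (measurableTypeR R) _ R (lebesgue_rV n)
    g) => //; last by move=> ?; exact: f0.
  by apply: (measurableT_comp mf); meas.
- by move=> t _; exact: integral_ge0.
- by rewrite lee_fin exprn_ge0// ltW.
Qed.

Lemma integrable_affine_rV n (b : 'rV[R]_n) (c : R) (f : 'rV[R]_n -> R) :
  0 < c -> (lebesgue_rV n).-integrable setT (EFin \o f) ->
  (lebesgue_rV n).-integrable setT (fun v => (f (b + c *: v))%:E).
Proof.
move=> c0 /integrableP[mf].
have mf' : measurable_fun setT f by exact/measurable_EFinP.
rewrite (ge0_integral_affine_rV b c0)//; last by do 2 apply: measurableT_comp => //.
move=> foo; apply/integrableP; split.
  by apply/measurable_EFinP; apply: (measurableT_comp mf'); meas.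
apply: contraTT foo; rewrite -!leNgt !leye_eq => /eqP ->.
by rewrite gt0_muley// lte_fin exprn_gt0.
Qed.

Lemma Rint_affine_rV n (b : 'rV[R]_n) (c : R) (f : 'rV[R]_n -> R) :
  0 < c -> (lebesgue_rV n).-integrable setT (EFin \o f) ->
  \int[lebesgue_rV n]_v f v = c ^+ n * \int[lebesgue_rV n]_v f (b + c *: v).
Proof.
move=> c0 fi.
have fi' := integrable_affine_rV b c0 fi.
have mf : measurable_fun setT (EFin \o f) by exact: measurable_int fi.
apply: EFin_inj; rewrite EFinM -!Rint_EFin// integralE.
rewrite (ge0_integral_affine_rV b c0 (measurable_funepos mf) (funepos_ge0 _)).
rewrite (ge0_integral_affine_rV b c0 (measurable_funeneg mf) (funeneg_ge0 _)).
have -> : (\int[lebesgue_rV n]_x (f (b + c *: x))%:E =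
    \int[lebesgue_rV n]_x (EFin \o f)^\+ (b + c *: x)%R -
    \int[lebesgue_rV n]_x (EFin \o f)^\- (b + c *: x)%R)%E.
  by rewrite integralE; congr (_ - _)%E; apply: eq_integral => v _;
    rewrite ?funeposE ?funenegE.
have Nfin : (\int[lebesgue_rV n]_x (EFin \o f)^\- (b + c *: x)%R)%E \is a fin_num.
  rewrite (_ : integral _ _ _ =
    (\int[lebesgue_rV n]_x (fun v => (f (b + c *: v))%:E)^\- x)%E).
    exact: integrable_neg_fin_num.
  by apply: eq_integral => v _; rewrite !funenegE.
by rewrite [RHS]muleBr// fin_num_adde_defl// fin_numN.
Qed.

Lemma Rint_shift_rV n (b : 'rV[R]_n) (f : 'rV[R]_n -> R) :
  (lebesgue_rV n).-integrable setT (EFin \o f) ->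
  \int[lebesgue_rV n]_v f v = \int[lebesgue_rV n]_v f (v + b).
Proof.
move=> fi; rewrite (Rint_affine_rV b ltr01 fi) expr1n mul1r.
by apply: eq_Rintegral => v _; rewrite scale1r addrC.
Qed.

End affine.

Section box.
Context {R : realType} {n : nat}.

Definition box (r : R) : set 'rV[R]_n := [set v | forall i, `|v 0 i| <= r].

Lemma measurable_box r : measurable (box r).
Proof.
have -> : box r = \bigcap_(i in [set: 'I_n])
   ((fun v : 'rV[R]_n => v 0 i) @^-1` `[-r, r]); last first.
  apply: fin_bigcap_measurable => // i _; rewrite -[X in measurable X]setTI.
  by apply: measurable_coord => //; exact: measurable_itv.
apply/seteqP; split => [v vr i _/=|v vr i]; first by rewrite in_itv/= -ler_norml.
by rewrite ler_norml; have := vr i Logic.I; rewrite /= in_itv.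
Qed.

Lemma box_finite r : (lebesgue_rV n (box r) < +oo)%E.
Proof.
rewrite (_ : box r = [set v | forall i, `[-r, r]%classic (v 0 i)]); last first.
  by apply/seteqP; split => v vr i; have := vr i; rewrite /= in_itv/= -ler_norml.
rewrite (@lebesgue_rV_setX R n (fun=> `[-r, r]%classic)); last by move=> i; exact: measurable_itv.
elim/big_rec : _ => [|i x _ xoo]; first by rewrite ltry.
apply: lte_mul_pinfty => //.
by rewrite ge0_fin_numE// lebesgue_measure_itv/=; case: ifP => // _; rewrite -EFinB ltry.
Qed.

Lemma integrable_box (f : 'rV[R]_n -> R) (M r : R) : measurable_fun setT f ->
  (forall v, `|f v| <= M) -> (forall v, ~ box r v -> f v = 0) ->
  (lebesgue_rV n).-integrable setT (EFin \o f).
Proof.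
move=> mf fM f0.
have M0 : 0 <= M by rewrite (le_trans _ (fM 0)).
apply: (@integrable_dom _ _ _ _ _ _ _ (fun v => M * \1_(box r) v)) => //.
  apply: integrable_scalel => //.
  have mb : measurable_fun setT (\1_(box r) : 'rV[R]_n -> R).
    by apply: measurable_indic; exact: measurable_box.
  apply/integrableP; split; first exact/measurable_EFinP.
  under eq_integral do rewrite gee0_abs ?lee_fin//.
  rewrite integral_indic ?setIT//; first exact: box_finite.
  exact: measurable_box.
move=> v _; rewrite indicE; have [vr|vr] := pselect (box r v).
  by rewrite mem_set// mulr1.
by rewrite f0// normr0 mulr_ge0.
Qed.

End box.

(** * Gaussian integrals *)
Section gauss1.
Context {R : realType}.
Local Notation mu := (@lebesgue_measure R).

Lemma is_derive_continuous (f g : R -> R) :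
  (forall x : R, is_derive x 1 f (g x)) -> continuous f.
Proof.
by move=> df x; apply: differentiable_continuous; apply/derivable1_diffP;
  by case: (df x).
Qed.

Lemma cvg_idn_pinfty : (n.+1%:R : R) @[n --> \oo] --> +oo%R.
Proof. by have := @cvgr_idn R; rewrite -cvg_shiftS. Qed.

Lemma Rint_FTC (f F : R -> R) (a b : R) : a < b ->
  (forall x : R, is_derive x 1 F (f x)) -> continuous f ->
  \int[mu]_(x in `[a, b]) f x = F b - F a.
Proof.
move=> ab dF cf; rewrite /Rintegral (@continuous_FTC2 _ f F)//.
- exact: continuous_subspaceT.
- have cF := is_derive_continuous dF.
  split; first by move=> x _; case: (dF x).
  + by apply: cvg_at_right_filter; exact: cF.
  + by apply: cvg_at_left_filter; exact: cF.
- by move=> x _; rewrite derive1E; have dFx := dF x; rewrite derive_val.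
Qed.

Lemma Rint_derive_eq0 (f F : R -> R) :
  (forall x : R, is_derive x 1 F (f x)) -> continuous f ->
  mu.-integrable setT (EFin \o f) ->
  F n.+1%:R @[n --> \oo] --> 0 -> F (- n.+1%:R) @[n --> \oo] --> 0 ->
  \int[mu]_x f x = 0.
Proof.
move=> dF cf fi Fp Fm.
have mf : measurable_fun setT f by exact: integrable_measurable fi.
have fi' := integrable_normr measurableT fi.
have E n : \int[mu]_x (f x * \1_(`[- n.+1%:R, n.+1%:R]) x) = F n.+1%:R - F (- n.+1%:R).
  rewrite -(@Rint_FTC f) ?gtrN ?ltr0n//.
  rewrite [RHS]Rintegral_mkcond; apply: eq_Rintegral => x _.
  rewrite patchE indicE; case: ifP => _; by rewrite ?mulr1 ?mulr0.
have h1 : (\int[mu]_x (f x * \1_(`[- n.+1%:R, n.+1%:R]) x)) @[n --> \oo] --> \int[mu]_x f x.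
  apply: (@Rint_dct R _ _ mu setT _ _ f (fun x => `|f x|)) => //.
  - move=> n; apply: measurable_funM => //; apply: measurable_indic; exact: measurable_itv.
  - move=> x _; apply: cvg_near_cst.
    have := @cvg_idn_pinfty.
    move=> /cvgryPge /(_ `|x|); apply: filterS => n xn.
    by rewrite indicE mem_set ?mulr1//= in_itv/= -ler_norml.
  - move=> n x _; rewrite normrM ler_piMr// indicE; case: (_ \in _); by rewrite ?normr1 ?normr0.
have h2 : (\int[mu]_x (f x * \1_(`[- n.+1%:R, n.+1%:R]) x)) @[n --> \oo] --> (0 : R).
  under eq_fun do rewrite E.
  by rewrite -[0 : R]subr0; apply: cvgB.
exact: (cvg_unique _ h1 h2).
Qed.

Lemma integrable_gauss_scale (c : R) : 0 < c ->
  mu.-integrable setT (fun x => (expR (- (c * x) ^+ 2))%:E).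
Proof.
move=> c0.
have [mf] := integrableP _ _ _ (@integrableT_gauss R).
have mg : measurable_fun setT (fun x : R => expR (- x ^+ 2)) by meas.
rewrite (@ge0_integral_affine R 0 c)//; last by do 2 apply: measurableT_comp => //.
move=> foo; apply/integrableP; split; first by apply/measurable_EFinP; meas.
have E : (\int[mu]_x `|(expR (- (c * x) ^+ 2))%:E| =
   \int[mu]_t `|(EFin \o gauss_fun (R:=R)) (0 + c * t)%R|)%E.
  by apply: eq_integral => x _; rewrite /gauss_fun/= add0r.
rewrite E; apply: contraTT foo; rewrite -!leNgt !leye_eq => /eqP ->.
by rewrite gt0_muley// lte_fin.
Qed.

Lemma integrable_xgauss :
  mu.-integrable setT (fun x => (`|x| * expR (- x ^+ 2))%:E).
Proof.
apply: (@integrable_dom _ _ _ mu setT _ (fun x : R => `|x| * expR (- x ^+ 2))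
    (fun x : R => expR (- (2^-1 * x) ^+ 2))) => //.
- by meas.
- exact: integrable_gauss_scale.
move=> x _; rewrite ger0_norm ?mulr_ge0 ?expR_ge0//.
apply: (@le_trans _ _ (expR (x ^+ 2 / 2) * expR (- x ^+ 2))).
  rewrite ler_pM2r ?expR_gt0// (le_trans _ (expR_ge1Dx _))//.
  have : 0 <= (`|x| - 1) ^+ 2 by exact: sqr_ge0.
  rewrite sqrrB1 real_normK ?num_real//; lra.
rewrite -expRD ler_expR; have := sqr_ge0 x; rewrite exprMn; lra.
Qed.

(** Differentiating under the integral sign and integrating by parts gives the
    equation [g' = - (x / 2) g], which determines this transform. *)
Definition gauss_cos (th x : R) := \int[mu]_y (expR (- y ^+ 2) * cos (y * x + th)).

Lemma cos_norm_le1 (x : R) : `|cos x| <= 1.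
Proof. by rewrite ler_norml cos_geN1 cos_le1. Qed.

Lemma sin_norm_le1 (x : R) : `|sin x| <= 1.
Proof. by rewrite ler_norml sin_geN1 sin_le1. Qed.

Lemma measurable_sinf d (T : measurableType d) (f : T -> R) :
  measurable_fun setT f -> measurable_fun setT (fun t => sin (f t)).
Proof.
by move=> mf; apply: (measurableT_comp _ mf);
  exact: continuous_measurable_fun (@continuous_sin R).
Qed.

Lemma integrable_gauss_cos th x :
  mu.-integrable setT (EFin \o (fun y => expR (- y ^+ 2) * cos (y * x + th))).
Proof.
apply: (@integrable_dom _ _ _ mu setT _ _ (@gauss_fun R)) => //.
- by meas.
- exact: integrableT_gauss.
move=> y _; rewrite normrM ger0_norm ?expR_ge0// ler_piMr ?expR_ge0//.
exact: cos_norm_le1.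
Qed.

Lemma integrable_xgauss_sin th x :
  mu.-integrable setT (EFin \o (fun y => y * expR (- y ^+ 2) * sin (y * x + th))).
Proof.
apply: (@integrable_dom _ _ _ mu setT _ _ (fun y : R => `|y| * expR (- y ^+ 2))) => //.
- by apply: measurable_funM; [by meas|apply: measurable_sinf; meas].
- exact: integrable_xgauss.
move=> y _; rewrite !normrM (ger0_norm (expR_ge0 _)) ler_piMr ?mulr_ge0 ?expR_ge0//.
exact: sin_norm_le1.
Qed.

Lemma cvg_gauss_sinN (s x th : R) : s ^+ 2 = 1 ->
  expR (- (s * n.+1%:R) ^+ 2) * sin (s * n.+1%:R * x + th) @[n --> \oo] --> 0.
Proof.
move=> s1.
have h : expR (- (n.+1%:R : R) ^+ 2) @[n --> \oo] --> 0.
  by apply: (cvg_comp _ _ cvg_idn_pinfty (@cvg_gauss_fun R)).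
apply: norm_cvg0; apply: (squeeze_cvgr _ (cvg_cst 0) h).
apply: nearW => n; rewrite normr_ge0/= normrM ger0_norm ?expR_ge0//.
by rewrite exprMn s1 mul1r ler_piMr ?expR_ge0// sin_norm_le1.
Qed.

Lemma Rint_xgauss_sin th x :
  \int[mu]_y (y * expR (- y ^+ 2) * sin (y * x + th)) = x / 2 * gauss_cos th x.
Proof.
pose F (y : R) := expR (- y ^+ 2) * sin (y * x + th).
pose f (y : R) := x * (expR (- y ^+ 2) * cos (y * x + th)) -
  2 * (y * expR (- y ^+ 2) * sin (y * x + th)).
have dF (y : R) : is_derive y 1 F (f y).
  by apply: is_derive_eq; rewrite /GRing.scale/= /f; ring.
have cf : continuous f.
  by apply: is_derive_continuous => y; apply: is_derive_eq.
have i1 : mu.-integrable setT (EFin \o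
    (fun y => x * (expR (- y ^+ 2) * cos (y * x + th)))).
  by apply: integrable_scalel => //; exact: integrable_gauss_cos.
have i2 : mu.-integrable setT (EFin \o
    (fun y => 2 * (y * expR (- y ^+ 2) * sin (y * x + th)))).
  by apply: integrable_scalel => //; exact: integrable_xgauss_sin.
have fi : mu.-integrable setT (EFin \o f).
  rewrite (_ : EFin \o f = (fun y => (x * (expR (- y ^+ 2) * cos (y * x + th)))%:E -
    (2 * (y * expR (- y ^+ 2) * sin (y * x + th)))%:E)%E)//.
  exact: integrableB.
have f0 : \int[mu]_y f y = 0.
  apply: (Rint_derive_eq0 dF cf fi); rewrite /F.
    have := @cvg_gauss_sinN 1 x th; rewrite expr1n => /(_ erefl).
    by under eq_fun do rewrite !mul1r.
  have := @cvg_gauss_sinN (-1) x th; rewrite sqrrN expr1n => /(_ erefl).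
  by under eq_fun do rewrite !mulN1r.
move: f0; rewrite /f RintegralB// !RintegralZl//; last 2 first.
- exact: integrable_xgauss_sin.
- exact: integrable_gauss_cos.
rewrite -/(gauss_cos th x); lra.
Qed.

Lemma is_derive_gauss_cos th (x : R) :
  is_derive x 1 (gauss_cos th) (- (x / 2 * gauss_cos th x)).
Proof.
pose f (x y : R) := expR (- y ^+ 2) * cos (y * x + th).
have df (x' y : R) : is_derive x' 1 (f^~ y) (- (y * expR (- y ^+ 2) * sin (y * x' + th))).
  by apply: is_derive_eq; rewrite /GRing.scale/= /f; ring.
have Ia : `]x - 1, x + 1[%classic x by rewrite /= in_itv/=; lra.
have p1 x' y : partial1of2 f x' y = - (y * expR (- y ^+ 2) * sin (y * x' + th)).
  by rewrite partial1of2E; have dFx := df x' y; rewrite derive_val.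
have h1 x' : `]x - 1, x + 1[%classic x' -> mu.-integrable setT (EFin \o f x').
  by move=> _; exact: integrable_gauss_cos.
have h2 (x' y : R) : `]x - 1, x + 1[%classic x' -> setT y -> derivable (f^~ y) x' 1.
  by move=> _ _; case: (df x' y).
have h3 (y : R) : 0 <= `|y| * expR (- y ^+ 2) by rewrite mulr_ge0 ?expR_ge0.
have h4 (x' y : R) : `]x - 1, x + 1[%classic x' -> setT y ->
    `|partial1of2 f x' y| <= `|y| * expR (- y ^+ 2).
  move=> _ _; rewrite p1 normrN !normrM (ger0_norm (expR_ge0 _)).
  by rewrite ler_piMr ?mulr_ge0 ?expR_ge0// sin_norm_le1.
have D := @derivable_under_integral _ _ _ mu f setT measurableT x (x - 1) (x + 1) Ia
  h1 h2 (fun y => `|y| * expR (- y ^+ 2)) h3 integrable_xgauss h4.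
have V := @differentiation_under_integral _ _ _ mu f setT measurableT x (x - 1) (x + 1) Ia
  h1 h2 (fun y => `|y| * expR (- y ^+ 2)) h3 integrable_xgauss h4.
apply: DeriveDef; first exact: D.
rewrite -derive1E V.
under eq_Rintegral do rewrite p1 -mulN1r.
by rewrite RintegralZl ?mulN1r ?Rint_xgauss_sin//; exact: integrable_xgauss_sin.
Qed.

Lemma gauss_cosE th x : gauss_cos th x = Num.sqrt pi * expR (- (x ^+ 2 / 4)) * cos th.
Proof.
pose E (x : R) := gauss_cos th x * expR (x ^+ 2 / 4).
have dE (y : R) : is_derive y 1 E 0.
  have d1 := is_derive_gauss_cos th y.
  by apply: is_derive_eq; rewrite /GRing.scale/=; field.
have := is_derive_0_is_cst x 0 dE.
rewrite /E expr0n/= mul0r expR0 mulr1 => e.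
have e0 : gauss_cos th 0 = Num.sqrt pi * cos th.
  rewrite /gauss_cos; under eq_Rintegral do rewrite mulr0 add0r.
  rewrite RintegralZr//; last exact: integrableT_gauss.
  by congr (_ * _); rewrite /Rintegral -[LHS]/(fine _) integralT_gauss.
rewrite -mulrA [_ * cos _]mulrC mulrA -e0 -e -mulrA -expRD subrr expR0 mulr1//.
Qed.

End gauss1.

Section gauss.
Context {R : realType}.
Local Notation mu := (@lebesgue_measure R).

Lemma integrable_gauss_rV n :
  (lebesgue_rV n).-integrable setT (EFin \o (fun v : 'rV[R]_n => expR (- dotp v v))).
Proof.
elim: n => [|n IH].
  apply: (@integrable_box _ _ _ 1 0) => [|v|v]; first by meas.
    by rewrite /dotp big_ord0 oppr0 expR0 normr1.
  by case; case.
apply: (integrable_cons (a := fun t => expR (- t ^+ 2))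
  (b := fun v : 'rV[R]_n => expR (- dotp v v))) => //; first by meas.
- exact: integrableT_gauss.
- by move=> t v; rewrite dotp_cons opprD expRD ger0_norm ?mulr_ge0 ?expR_ge0.
Qed.

Lemma Rint_gauss_cos_rV n (x : 'rV[R]_n) th :
  \int[lebesgue_rV n]_v (expR (- dotp v v) * cos (dotp v x + th)) =
  Num.sqrt pi ^+ n * expR (- (dotp x x / 4)) * cos th.
Proof.
elim: n x th => [|n IH] x th.
  rewrite expr0 mul1r /Rintegral integral_dirac//=; last by apply/measurable_EFinP; meas.
  by rewrite indicT mul1r /dotp !big_ord0 mul0r oppr0 add0r.
have [s [w ->]] := rV_consP x.
rewrite (Rint_cons (a := fun t => expR (- t ^+ 2))
  (b := fun v : 'rV[R]_n => expR (- dotp v v)))//; last 4 first.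
- by meas.
- exact: integrableT_gauss.
- exact: integrable_gauss_rV.
- move=> t v; rewrite normrM (ger0_norm (expR_ge0 _)).
  by rewrite dotp_cons opprD expRD ler_piMr ?mulr_ge0 ?expR_ge0// cos_norm_le1.
under eq_Rintegral => t _.
  under eq_Rintegral => v _.
    rewrite !dotp_cons opprD expRD -mulrA [t * s + _]addrC -addrA; over.
  rewrite RintegralZl//; last first.
    apply: (@integrable_dom _ _ _ _ _ _ _ (fun v : 'rV[R]_n => expR (- dotp v v))) => //.
    + by meas.
    + exact: integrable_gauss_rV.
    + move=> v _; rewrite normrM (ger0_norm (expR_ge0 _)).
      by rewrite ler_piMr ?expR_ge0// cos_norm_le1.
  rewrite IH mulrCA; over.
rewrite RintegralZl//; last exact: integrable_gauss_cos.
rewrite -/(gauss_cos th s) gauss_cosE dotp_cons -expr2 mulrDl opprD expRD [in RHS](exprS (Num.sqrt pi)).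
by ring.
Qed.

Lemma integrable_gauss_scaled n (r : R) (x : 'rV[R]_n) : 0 < r ->
  (lebesgue_rV n).-integrable setT
    (EFin \o (fun v : 'rV[R]_n => expR (- (r * dotp (v - x) (v - x))))).
Proof.
move=> r0; have c0 : 0 < Num.sqrt r by rewrite sqrtr_gt0.
have := integrable_affine_rV (- (Num.sqrt r *: x)) c0 (integrable_gauss_rV n).
apply: eq_integrable => // v _ /=; congr (expR (- _))%:E.
rewrite -[in RHS](sqr_sqrtr (ltW r0)) addrC -scalerBr dotpZr dotpZl.
by rewrite mulrA -expr2.
Qed.

Lemma integrable_gauss_scaled0 n (r : R) : 0 < r ->
  (lebesgue_rV n).-integrable setT
    (EFin \o (fun v : 'rV[R]_n => expR (- (r * dotp v v)))).
Proof.
move=> r0; have := @integrable_gauss_scaled n r 0 r0.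
by apply: eq_integrable => // v _ /=; rewrite subr0.
Qed.

Lemma integrable_gauss_scaled_cos n (r : R) (x : 'rV[R]_n) th : 0 < r ->
  (lebesgue_rV n).-integrable setT
    (EFin \o (fun v : 'rV[R]_n => expR (- (r * dotp v v)) * cos (dotp v x + th))).
Proof.
move=> r0; apply: (integrable_dom measurableT (g := fun v => expR (- (r * dotp v v)))) => //.
- by meas.
- exact: integrable_gauss_scaled0.
- move=> v _; rewrite normrM (ger0_norm (expR_ge0 _)).
  by rewrite ler_piMr ?expR_ge0// cos_norm_le1.
Qed.

Lemma Rint_gauss_scaled n (r : R) (x : 'rV[R]_n) th : 0 < r ->
  \int[lebesgue_rV n]_v (expR (- (r * dotp v v)) * cos (dotp v x + th)) =
  Num.sqrt (pi / r) ^+ n * expR (- (dotp x x / (4 * r))) * cos th.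
Proof.
move=> r0; have c0 : 0 < Num.sqrt r by rewrite sqrtr_gt0.
have c2 : Num.sqrt r ^+ 2 = r by rewrite sqr_sqrtr// ltW.
have h := Rint_gauss_cos_rV ((Num.sqrt r)^-1 *: x) th.
rewrite (Rint_affine_rV 0 c0) in h; last first.
  have := @integrable_gauss_scaled_cos n 1 ((Num.sqrt r)^-1 *: x) th ltr01.
  by apply: eq_integrable => // v _ /=; rewrite mul1r.
have -> : \int[lebesgue_rV n]_v (expR (- (r * dotp v v)) * cos (dotp v x + th)) =
  \int[lebesgue_rV n]_v (expR (- dotp (0 + Num.sqrt r *: v) (0 + Num.sqrt r *: v)) *
   cos (dotp (0 + Num.sqrt r *: v) ((Num.sqrt r)^-1 *: x) + th)).
  apply: eq_Rintegral => v _; rewrite add0r !dotpZl !dotpZr !mulrA -expr2 c2.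
  by rewrite divff ?gt_eqF// mul1r.
apply: (mulfI (lt0r_neq0 (exprn_gt0 n c0))).
rewrite h !mulrA; congr (_ * _).
rewrite sqrtrM ?pi_ge0// sqrtrV ?(ltW r0)// exprMn mulrCA exprVn divff ?mulr1.
  rewrite dotpZl dotpZr -[in RHS]c2; congr (_ * expR (- _)).
  by field; rewrite gt_eqF.
by rewrite gt_eqF// exprn_gt0.
Qed.

(** The Gaussians of width [1 / k.+1] form an approximate identity: rescaled to
    width 1 they average [f] at points tending to [x]. *)
Lemma gauss_approx n (f : 'rV[R]_n -> R) (M : R) (x : 'rV[R]_n) :
  measurable_fun setT f -> (forall v, `|f v| <= M) ->
  f y @[y --> x] --> f x ->
  k.+1%:R ^+ n * \int[lebesgue_rV n]_y
     (f y * expR (- (k.+1%:R ^+ 2 * dotp (y - x) (y - x)))) @[k --> \oo]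
   --> Num.sqrt pi ^+ n * f x.
Proof.
move=> mf fM fx.
have M0 : 0 <= M by rewrite (le_trans _ (fM 0)).
have E k : k.+1%:R ^+ n * \int[lebesgue_rV n]_y
     (f y * expR (- (k.+1%:R ^+ 2 * dotp (y - x) (y - x)))) =
   \int[lebesgue_rV n]_v (f (x + k.+1%:R^-1 *: v) * expR (- dotp v v)).
  have k0 : 0 < (k.+1%:R : R) by rewrite ltr0n.
  have ki : 0 < (k.+1%:R : R)^-1 by rewrite invr_gt0.
  rewrite (Rint_affine_rV x ki); last first.
    apply: (@integrable_dom _ _ _ (lebesgue_rV n) setT _ _
      (fun y => M * expR (- (k.+1%:R ^+ 2 * dotp (y - x) (y - x))))) => //.
    - by meas.
    - apply: integrable_scalel => //; apply: integrable_gauss_scaled.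
      by rewrite exprn_gt0.
    - by move=> y _; rewrite normrM (ger0_norm (expR_ge0 _)) ler_wpM2r ?expR_ge0.
  rewrite mulrA -exprMn divff ?gt_eqF// expr1n mul1r.
  apply: eq_Rintegral => v _; rewrite [x + _ - x]addrAC subrr add0r dotpZl dotpZr.
  congr (_ * expR (- _)).
  by field; rewrite addrC natr1 gt_eqF.
under eq_fun do rewrite E.
have -> : Num.sqrt pi ^+ n * f x =
    \int[lebesgue_rV n]_v (f x * expR (- dotp v v)).
  rewrite RintegralZl//; last exact: integrable_gauss_rV.
  rewrite mulrC; congr (_ * _).
  have := Rint_gauss_cos_rV (0 : 'rV[R]_n) 0.
  rewrite dotp0r mul0r oppr0 expR0 cos0 !mulr1 => <-.
  by apply: eq_Rintegral => v _; rewrite dotp0r addr0 cos0 mulr1.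
apply: (@Rint_dct _ _ _ (lebesgue_rV n) setT _ _ _ (fun v => M * expR (- dotp v v))) => //.
- move=> k; apply: measurable_funM; last by meas.
  by apply: (measurableT_comp mf); meas.
- move=> v _; apply: cvgM; last exact: cvg_cst.
  apply: (cvg_comp _ f _ fx).
  have h : x + k.+1%:R^-1 *: v @[k --> \oo] --> x + (0 : R) *: v.
    apply: cvgD; first exact: cvg_cst.
    apply: cvgZr_tmp; exact: (@cvg_harmonic R).
  by rewrite scale0r addr0 in h.
- by apply: integrable_scalel => //; exact: integrable_gauss_rV.
- by move=> k v _; rewrite normrM (ger0_norm (expR_ge0 _)) ler_wpM2r ?expR_ge0.
Qed.

End gauss.

(** * Powers and the Gamma integral *)
Lemma series_recr (R : realType) (u : R^nat) k :
  series u k.+1 = series u k + u k.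
Proof. by rewrite /series/= big_nat_recr. Qed.

(** One term of the exponential series is at most its sum. *)
Lemma expr_le_fact_expR (R : realType) (y : R) k : 0 <= y -> y ^+ k <= k`!%:R * expR y.
Proof.
move=> y0; have h0 (i : nat) : 0 <= exp_coeff y i by apply: exp_coeff_ge0.
have : exp_coeff y k <= expR y.
  apply: (@le_trans _ _ (series (exp_coeff y) k.+1)).
    by rewrite series_recr lerDr; apply: sumr_ge0.
  apply: nondecreasing_cvgn_le; last exact: is_cvg_series_exp_coeff.
  by apply: nondecreasing_series.
by rewrite exp_coeffE mulrC ler_pdivrMr ?ltr0n ?fact_gt0// mulrC.
Qed.

Section powers.
Context {R : realType}.
Local Notation mu := (@lebesgue_measure R).

Lemma Rint_powR (b x y : R) : 0 < x -> x < y -> b != 0 ->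
  (\int[mu]_(r in `[x, y]) (r `^ (b - 1))%:E = ((y `^ b - x `^ b) / b)%:E)%E.
Proof.
move=> x0 xy b0.
have dF (r : R) : 0 < r -> is_derive r 1 (fun r => r `^ b / b) (r `^ (b - 1)).
  move=> r0; have d1 := is_derive1_powR b r0.
  by apply: is_derive_eq; rewrite /GRing.scale/=; field.
have cf (c r : R) : 0 < r -> (fun r => r `^ c) @ r --> r `^ c.
  move=> r0; have h : differentiable ((@powR R)^~ c : R -> R) r.
    by apply/derivable1_diffP; case: (is_derive1_powR c r0).
  exact: (differentiable_continuous h).
rewrite (@continuous_FTC2 _ _ (fun r => r `^ b / b))//.
- by rewrite -EFinB mulrBl.
- apply: continuous_in_subspaceT => r; rewrite inE/= in_itv/= => /andP[xr _].
  by apply: cf; exact: lt_le_trans xr.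
- split.
  + move=> r; rewrite in_itv/= => /andP[xr _].
    by case: (dF r (lt_trans x0 xr)).
  + apply: cvg_at_right_filter; apply: cvgMl; exact: cf.
  + apply: cvg_at_left_filter; apply: cvgMl; apply: cf; exact: lt_trans xy.
- move=> r; rewrite in_itv/= => /andP[xr _]; rewrite derive1E.
  by have dFr := dF r (lt_trans x0 xr); rewrite derive_val.
Qed.

(** Integrability over an exhaustion, from a bound that is uniform along it. *)
Lemma integrable_bigcup (F : (set (measurableTypeR R))^nat) (f : R -> R) (C : R) :
  {homo F : n m / (n <= m)%N >-> (n <= m)%O} -> (forall i, measurable (F i)) ->
  measurable_fun setT f -> (forall x, 0 <= f x) ->
  (forall i, \int[mu]_(x in F i) (f x)%:E <= C%:E)%E ->
  mu.-integrable (\bigcup_i F i) (EFin \o f).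
Proof.
move=> ndF mF mf f0 fC; apply/integrableP; split.
  by apply/measurable_EFinP; apply: measurable_funTS.
have := @ge0_nondecreasing_set_cvg_integral _ _ R F (EFin \o f) mu ndF mF
  (fun i => measurable_funTS ((measurable_EFinP _ _).2 mf)) (fun i x _ => f0 x).
move=> cv; under eq_integral do rewrite /= ger0_norm//.
rewrite -(cvg_lim _ cv)//; apply: (@le_lt_trans _ _ C%:E); last by rewrite ltry.
apply: lime_le; last exact: nearW.
apply: ereal_nondecreasing_is_cvgn; apply: ge0_nondecreasing_set_nondecreasing_integral => //.
- by move=> i; apply: measurable_funTS; exact/measurable_EFinP.
- by move=> i x _; rewrite lee_fin.
Qed.

Lemma integrable_powR01 (b : R) : 0 < b ->
  mu.-integrable `]0, 1] (fun r => (r `^ (b - 1))%:E).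
Proof.
move=> b0.
have -> : `]0, 1]%classic = \bigcup_n `[n.+2%:R^-1, 1]%classic :> set (measurableTypeR R).
  apply/seteqP; split => r /=; rewrite in_itv/=.
    move=> /andP[r0 r1]; exists (Num.trunc r^-1) => //=.
    rewrite in_itv/= r1 andbT invf_ple ?posrE//.
    by rewrite (le_trans (ltW (truncnS_gt _)))// ler_nat.
  move=> [n _]; rewrite /= in_itv/= => /andP[nr ->]; rewrite andbT.
  by rewrite (lt_le_trans _ nr)// invr_gt0.
apply: (@integrable_bigcup _ _ (b^-1)).
- move=> n m nm; apply/subsetPset => r /=; rewrite !in_itv/= => /andP[nr ->].
  by rewrite andbT (le_trans _ nr)// lef_pV2 ?posrE// ler_nat.
- by move=> i; exact: measurable_itv.
- by meas.
- by move=> x; exact: powR_ge0.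
- move=> n; rewrite Rint_powR ?gt_eqF//; last by rewrite invf_lt1// ltr1n.
  rewrite lee_fin powR1 ler_pdivrMr// mulVf ?gt_eqF// lerBlDr lerDl.
Qed.

Lemma integrable_powR1y (b : R) : 0 < b ->
  mu.-integrable `]1, +oo[ (fun r => (r `^ (- b - 1))%:E).
Proof.
move=> b0.
suff h : mu.-integrable `[1, +oo[ (fun r => (r `^ (- b - 1))%:E).
  apply: integrableS h => //; apply/subset_itvr; rewrite bnd_simp//.
have -> : `[1, +oo[%classic = \bigcup_n `[1, n.+2%:R]%classic :> set (measurableTypeR R).
  apply/seteqP; split => r /=; rewrite in_itv/= andbT.
    move=> r1; exists (Num.trunc r) => //=.
    rewrite in_itv/= r1/=.
    by rewrite (le_trans (ltW (truncnS_gt _)))// ler_nat.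
  by move=> [n _]; rewrite /= in_itv/= => /andP[nr].
apply: (@integrable_bigcup _ _ (b^-1)).
- move=> n m nm; apply/subsetPset => r /=; rewrite !in_itv/= => /andP[-> rn].
  by rewrite (le_trans rn)// ler_nat.
- by move=> i; exact: measurable_itv.
- by meas.
- by move=> x; exact: powR_ge0.
- move=> n; rewrite Rint_powR ?oppr_eq0 ?gt_eqF// ?ltr1n//.
  by rewrite lee_fin powR1 invrN mulrN -mulNr opprB ler_pdivrMr// mulVf ?gt_eqF// lerBlDr lerDl.
Qed.

Lemma integrable_indicP (D : set (measurableTypeR R)) (f : R -> R) : measurable D ->
  mu.-integrable D (EFin \o f) <->
  mu.-integrable setT (fun r => (f r * \1_D r)%:E).
Proof.
move=> mD.
rewrite (integrable_mkcond _ mD) (_ : _ \_ _ = (fun r => (f r * \1_D r)%:E))//.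
apply/funext => r; rewrite patchE indicE.
by case: ifP => _; rewrite ?mulr1 ?mulr0.
Qed.

Lemma Rint_indic (D : set (measurableTypeR R)) (f : R -> R) :
  \int[mu]_(r in D) f r = \int[mu]_r (f r * \1_D r).
Proof.
rewrite Rintegral_mkcond; apply: eq_Rintegral => r _; rewrite patchE indicE.
by case: ifP => _; rewrite ?mulr1 ?mulr0.
Qed.

Lemma powR_expR_bound (b : R) : exists C : R, 0 < C /\
  forall r, 1 <= r -> r `^ b * expR (- r) <= C * r `^ (- 1 - 1).
Proof.
have [n bn] : exists n : nat, b + 2 <= n%:R.
  by exists (Num.trunc (b + 2)).+1; rewrite ltW// truncnS_gt.
exists (n`!%:R); split; first by rewrite ltr0n fact_gt0.
move=> r r1; have r0 : 0 < r by rewrite (lt_le_trans _ r1).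
have -> : r `^ b = r `^ (b + 2) * r `^ (- 1 - 1).
  by rewrite -powRD; [congr (_ `^ _); ring|rewrite (gt_eqF r0)/= implybT].
rewrite mulrAC ler_wpM2r ?powR_ge0//.
apply: (@le_trans _ _ (r ^+ n * expR (- r))).
  rewrite ler_wpM2r ?expR_ge0// -powR_mulrn ?(ltW r0)//.
  exact: ler_powR.
by rewrite expRN ler_pdivrMr ?expR_gt0// expr_le_fact_expR// ltW.
Qed.

(** The source of the strictly positive constants below: the interval has
    length 1. *)
Lemma Rint_ge_on12 (D : set (measurableTypeR R)) (f : R -> R) (c : R) :
  measurable D -> `]1, 2]%classic `<=` D -> mu.-integrable D (EFin \o f) ->
  (forall r, D r -> 0 <= f r) -> (forall r, 1 < r -> r <= 2 -> c <= f r) ->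
  c <= \int[mu]_(r in D) f r.
Proof.
move=> mD D12 fi f0 cf.
have m12 : measurable (`]1, 2]%classic : set (measurableTypeR R)) by exact: measurable_itv.
have -> : c = \int[mu]_(r in `]1, 2]) c.
  rewrite Rintegral_cst//= lebesgue_measure_itv/= lte_fin ltr1n/=.
  by rewrite (_ : 2 - 1 = 1) ?mulr1//; lra.
rewrite [leLHS]Rint_indic [leRHS]Rint_indic; apply: le_Rintegral => //.
- by apply: integrable_scalel => //; exact: integrable_indic_itv.
- exact: (integrable_indicP _ mD).1 fi.
move=> r _; rewrite !indicE; have [r12|r12] := boolP (r \in `]1%R, 2%R]%classic).
  rewrite mem_set; last by apply: D12; rewrite inE in r12.
  by move: r12; rewrite inE/= in_itv/= !mulr1 => /andP[]; exact: cf.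
by rewrite mulr0; case: (boolP (r \in D)) => [/set_mem/f0|] => h; rewrite ?mulr1 ?mulr0.
Qed.

Lemma integrable_Gamma (b : R) : 0 < b ->
  mu.-integrable `]0, +oo[ (fun r => (r `^ (b - 1) * expR (- r))%:E).
Proof.
move=> b0.
have mD : measurable (`]0, +oo[%classic : set (measurableTypeR R)) by [].
apply/(integrable_indicP _ mD).
have [C [C0 hC]] := powR_expR_bound (b - 1).
have i1 := (integrable_indicP _ (measurable_itv _)).1 (integrable_powR01 b0).
have i2 := (integrable_indicP _ (measurable_itv _)).1 (integrable_powR1y ltr01).
have i3 := integrableZl measurableT C i2.
have i4 := integrableD measurableT i1 i3.
have E : (fun r => ((r `^ (b - 1)) * \1_(`]0, 1]%classic) r)%:E +
    C%:E * (r `^ (- 1 - 1) * \1_(`]1, +oo[%classic) r)%:E)%E =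
  EFin \o (fun r : R => r `^ (b - 1) * \1_(`]0, 1]%classic) r +
    C * (r `^ (- 1 - 1) * \1_(`]1, +oo[%classic) r)) by [].
rewrite E in i4.
apply: (@integrable_dom R _ _ mu setT measurableT (fun r : R => r `^ (b - 1) * expR (- r) *
  \1_(`]0, +oo[%classic) r) _ _ i4).
  by apply: measurable_funM; [meas|apply: measurable_indic; exact: measurable_itv].
move=> r _; rewrite !indicE !mem_setE !in_itv/= !andbT.
have [r0|r0] := ltP 0 r; last first.
  by rewrite /= !mulr0n !mulr0 normr0 add0r ltNge (le_trans r0 ler01)/= mulr0n !mulr0.
rewrite mulr1 ger0_norm ?mulr_ge0 ?powR_ge0 ?expR_ge0//.
have [r1|r1] := leP r 1.
  by rewrite /= !mulr0 addr0 mulr1 ler_piMr ?powR_ge0// -expR0 ler_expR oppr_le0 ltW.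
by rewrite /= mulr0 add0r mulr1 hC// ltW.
Qed.

End powers.

(** * Multipliers with a positive inverse transform *)
Section positive_multipliers.
Context {R : realType} {n : nat}.
Local Notation mu := (@lebesgue_measure R).
Implicit Types (F : 'rV[R]_n -> R) (xi x : 'rV[R]_n).

Definition lam xi : R := 1 + dotp xi xi.

Lemma lam_ge1 xi : 1 <= lam xi.
Proof. by rewrite lerDl dotp_ge0. Qed.

Lemma lam_gt0 xi : 0 < lam xi.
Proof. by rewrite (lt_le_trans _ (lam_ge1 xi)). Qed.

Lemma measurable_lam d (T : measurableType d) (f : T -> 'rV[R]_n) :
  measurable_fun setT f -> measurable_fun setT (fun t => lam (f t)).
Proof. by move=> mf; rewrite /lam; meas. Qed.

Lemma integrable_exp_lam s : 0 < s ->
  (lebesgue_rV n).-integrable setT (EFin \o (fun xi => expR (- (s * lam xi)))).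
Proof.
move=> s0.
have := integrableZl measurableT (expR (- s)) (integrable_gauss_scaled0 n s0).
apply: eq_integrable => // xi _ /=.
by rewrite -EFinM -expRD /lam; congr (expR _)%:E; ring.
Qed.

(** For even [F] and up to a power of [2 pi], the inverse Fourier transform of
    [F] smoothed by the Gaussian multiplier [exp (- s lam)]. *)
Definition Phi F (s : R) x : R :=
  \int[lebesgue_rV n]_xi (F xi * expR (- (s * lam xi)) * cos (dotp xi x)).

Lemma Phi_dom F (M s : R) x : measurable_fun setT F -> (forall xi, `|F xi| <= M) ->
  forall xi, `|F xi * expR (- (s * lam xi)) * cos (dotp xi x)| <=
    M * expR (- (s * lam xi)).
Proof.
move=> mF FM xi; rewrite 2!normrM (ger0_norm (expR_ge0 _)) -[leRHS]mulr1.
by rewrite ler_pM ?mulr_ge0 ?expR_ge0// ?cos_norm_le1// ler_wpM2r// expR_ge0.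
Qed.

Lemma measurable_Phi F s x : measurable_fun setT F ->
  measurable_fun setT (fun xi => F xi * expR (- (s * lam xi)) * cos (dotp xi x)).
Proof. by move=> mF; rewrite /lam; meas. Qed.

Lemma integrable_Phi F M s x : measurable_fun setT F -> (forall xi, `|F xi| <= M) ->
  0 < s -> (lebesgue_rV n).-integrable setT
    (EFin \o (fun xi => F xi * expR (- (s * lam xi)) * cos (dotp xi x))).
Proof.
move=> mF FM s0.
apply: (integrable_dom measurableT (g := fun xi => M * expR (- (s * lam xi)))) => //.
- exact: measurable_Phi.
- by apply: integrable_scalel => //; exact: integrable_exp_lam.
- by move=> xi _; exact: Phi_dom.
Qed.

(** The smoothed inverse transform of [exp (- r lam)] is a centred Gaussian of
    variance proportional to [s + r], hence flatter than the Gaussian of variance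
    [s]. This comparison of the values at [x] and at 0 survives sums, products
    with mixtures of such exponentials, and limits. *)
Definition gpos F : Prop :=
  [/\ measurable_fun setT F, (exists M : R, forall xi, `|F xi| <= M) &
      forall s x, 0 < s -> 0 <= Phi F s 0 /\
        expR (- (dotp x x / (4 * s))) * Phi F s 0 <= Phi F s x].

Lemma gpos1 : gpos (fun=> 1).
Proof.
have E s x : 0 < s -> Phi (fun=> 1) s x =
    expR (- s) * (Num.sqrt (pi / s) ^+ n * expR (- (dotp x x / (4 * s)))).
  move=> s0; have := Rint_gauss_scaled x 0 s0; rewrite cos0 mulr1 => <-.
  rewrite /Phi -RintegralZl//; last exact: integrable_gauss_scaled_cos.
  by apply: eq_Rintegral => xi _; rewrite mul1r addr0 mulrA -expRD /lam;
    congr (expR _ * _); ring.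
split; [exact: measurable_cst|by exists 1 => xi; rewrite normr1|].
move=> s x s0; rewrite !E// dotp0r mul0r oppr0 expR0 mulr1; split.
  by rewrite mulr_ge0 ?expR_ge0// exprn_ge0// sqrtr_ge0.
by rewrite mulrC mulrA.
Qed.

Lemma PhiD F (G : 'rV[R]_n -> R) M N s x : measurable_fun setT F -> measurable_fun setT G ->
  (forall xi, `|F xi| <= M) -> (forall xi, `|G xi| <= N) -> 0 < s ->
  Phi (fun xi => F xi + G xi) s x = Phi F s x + Phi G s x.
Proof.
move=> mF mG FM GN s0; rewrite /Phi -RintegralD//; last 2 first.
- exact: integrable_Phi FM s0.
- exact: integrable_Phi GN s0.
by apply: eq_Rintegral => xi _; rewrite !mulrDl.
Qed.

Lemma PhiZ F M c s x : measurable_fun setT F -> (forall xi, `|F xi| <= M) -> 0 < s ->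
  Phi (fun xi => c * F xi) s x = c * Phi F s x.
Proof.
move=> mF FM s0; rewrite /Phi -RintegralZl//; last exact: integrable_Phi FM s0.
by apply: eq_Rintegral => xi _; rewrite !mulrA.
Qed.

Lemma gposD F G : gpos F -> gpos G -> gpos (fun xi => F xi + G xi).
Proof.
move=> [mF [M FM] hF] [mG [N GN] hG]; split; first exact: measurable_funD.
  by exists (M + N) => xi; rewrite (le_trans (ler_normD _ _))// lerD.
move=> s x s0; have [F0 Fx] := hF s x s0; have [G0 Gx] := hG s x s0.
by rewrite !(PhiD _ mF mG FM GN s0) mulrDr; split; [exact: addr_ge0|exact: lerD].
Qed.

Lemma gposZ c F : 0 <= c -> gpos F -> gpos (fun xi => c * F xi).
Proof.
move=> c0 [mF [M FM] hF]; split; first by apply: measurable_funM => //; exact: measurable_cst.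
  by exists (c * M) => xi; rewrite normrM ger0_norm// ler_wpM2l.
move=> s x s0; have [F0 Fx] := hF s x s0.
by rewrite !(PhiZ _ _ mF FM s0) mulrCA; split; [exact: mulr_ge0|exact: ler_wpM2l].
Qed.

(** Both sides of the inequality converge, by dominated convergence. *)
Lemma gpos_lim (F_ : nat -> 'rV[R]_n -> R) F M : (forall k, gpos (F_ k)) ->
  (forall k xi, `|F_ k xi| <= M) -> (forall xi, F_ k xi @[k --> \oo] --> F xi) ->
  gpos F.
Proof.
move=> hF FM cF.
have mF_ k : measurable_fun setT (F_ k) by case: (hF k).
have mF : measurable_fun setT F by apply: (measurable_fun_cvg mF_) => xi _; exact: cF.
have cPhi s x : 0 < s -> Phi (F_ k) s x @[k --> \oo] --> Phi F s x.
  move=> s0.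
  apply: (@Rint_dct R _ _ (lebesgue_rV n) setT _ _ _ (fun xi => M * expR (- (s * lam xi)))) => //.
  - by move=> k; exact: measurable_Phi.
  - move=> xi _; apply: cvgMl; apply: cvgMl; exact: cF.
  - by apply: integrable_scalel => //; exact: integrable_exp_lam.
  - by move=> k xi _; exact: Phi_dom.
split=> //.
  exists M => xi; have := cF xi => /cvg_norm.
  by move=> /(fun h => cvgr_to_le h (nearW _ (fun k => FM k xi))).
move=> s x s0; split.
  apply: (cvgr_to_ge (cPhi s 0 s0)); apply: nearW => k; by case: (hF k) => _ _ /(_ s x s0) [].
apply: (ler_cvg_to _ (cPhi s x s0)).
  apply: cvgMr; exact: (cPhi s 0 s0).
by apply: nearW => k; case: (hF k) => _ _ /(_ s x s0) [].
Qed.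

Section mixture.
Variable W : R -> R.
Hypothesis mW : measurable_fun setT W.
Hypothesis Wi : mu.-integrable setT (EFin \o W).
Hypothesis W_ge0 : forall r, 0 <= W r.
Hypothesis W_le0 : forall r, r <= 0 -> W r = 0.

Definition mix xi : R := \int[mu]_r (W r * expR (- (r * lam xi))).

Lemma mix_dom xi r : `|W r * expR (- (r * lam xi))| <= W r.
Proof.
have [r0|r0] := leP r 0; first by rewrite W_le0// mul0r normr0.
rewrite ger0_norm ?mulr_ge0 ?expR_ge0// ler_piMr// -expR0 ler_expR oppr_le0.
by rewrite mulr_ge0 ?ltW// lam_gt0.
Qed.

Lemma integrable_mix xi : mu.-integrable setT (EFin \o (fun r => W r * expR (- (r * lam xi)))).
Proof.
apply: (@integrable_dom R _ _ mu setT _ _ W) => //; first by meas.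
by move=> r _; exact: mix_dom.
Qed.

Lemma mix_ge0 xi : 0 <= mix xi.
Proof. by apply: Rintegral_ge0 => r _; rewrite mulr_ge0 ?expR_ge0. Qed.

Lemma mix_le xi : mix xi <= \int[mu]_r W r.
Proof.
apply: le_Rintegral => //; first exact: integrable_mix.
by move=> r _; exact: le_trans (ler_norm _) (mix_dom xi r).
Qed.

Lemma measurable_mix : measurable_fun setT mix.
Proof.
apply: (@measurable_Rint _ _ _ 'rV[R]_n (measurableTypeR R) mu
  (fun xi r => W r * expR (- (r * lam xi)))).
apply: measurable_funM; first exact: (measurableT_comp mW).
apply: measurable_expRf; apply: measurable_oppf; apply: measurable_funM => //.
by apply: measurable_lam.
Qed.

Section Phi_mix.
Variables (F : 'rV[R]_n -> R) (M s : R).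
Hypotheses (mF : measurable_fun setT F) (FM : forall xi, `|F xi| <= M) (s0 : 0 < s).

Let G x r xi := W r * (F xi * expR (- ((s + r) * lam xi)) * cos (dotp xi x)).

Let mG x : measurable_fun setT
  (fun w : measurableTypeR R * 'rV[R]_n => G x w.1 w.2).
Proof.
apply: measurable_funM; first exact: (measurableT_comp mW).
apply: measurable_funM; last by meas.
apply: measurable_funM; first exact: (measurableT_comp mF).
apply: measurable_expRf; apply: measurable_oppf; apply: measurable_funM; first by meas.
exact: measurable_lam.
Qed.

Let M0 : 0 <= M. Proof. by rewrite (le_trans _ (FM 0)). Qed.

Let Gdom x r xi : `|G x r xi| <= W r * (M * expR (- (s * lam xi))).
Proof.
rewrite /G normrM (ger0_norm (W_ge0 r)).
have [r0|r0] := leP r 0; first by rewrite W_le0// !mul0r.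
rewrite ler_wpM2l// (le_trans (Phi_dom (s + r) x mF FM xi))// ler_wpM2l//.
by rewrite ler_expR lerN2 ler_wpM2r ?(ltW (lam_gt0 _))// lerDl ltW.
Qed.

Let gi : (lebesgue_rV n).-integrable setT (EFin \o (fun xi => M * expR (- (s * lam xi)))).
Proof.
by apply: integrable_scalel => //; exact: integrable_exp_lam.
Qed.

Lemma PhiWE r x : \int[lebesgue_rV n]_xi G x r xi = W r * Phi F (s + r) x.
Proof.
have [r0|r0] := leP r 0.
  rewrite W_le0// mul0r; under eq_Rintegral do rewrite /G W_le0// mul0r.
  by rewrite Rintegral_cst// mul0r.
by rewrite RintegralZl//; apply: integrable_Phi FM _ => //; rewrite addr_gt0.
Qed.

Lemma integrable_PhiW x : mu.-integrable setT (EFin \o (fun r => W r * Phi F (s + r) x)).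
Proof.
have := tensor_Rint_integrable (@mG x) Wi gi (@Gdom x).
by apply: eq_integrable => // r _ /=; rewrite PhiWE.
Qed.

Lemma Phi_mix x : Phi (fun xi => F xi * mix xi) s x =
  \int[mu]_r (W r * Phi F (s + r) x).
Proof.
under [RHS]eq_Rintegral do rewrite -PhiWE.
rewrite (swap_Rint (@mG x) Wi gi (@Gdom x)).
apply: eq_Rintegral => xi _.
rewrite -[LHS]mulrA mulrAC -RintegralZl//; last exact: integrable_mix.
apply: eq_Rintegral => r _; rewrite /G mulrDl opprD expRD; ring.
Qed.

End Phi_mix.

(** Smoothing the product at time [s] averages the smoothings of [F] at the
    later times [s + r], whose Gaussian comparison is stronger. *)
Lemma gpos_mix F : gpos F -> gpos (fun xi => F xi * mix xi).
Proof.
move=> [mF [M FM] hF].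
have M0 : 0 <= M by rewrite (le_trans _ (FM 0)).
split.
- by apply: measurable_funM => //; exact: measurable_mix.
- exists (M * \int[mu]_r W r) => xi; rewrite normrM (ger0_norm (mix_ge0 xi)).
  by rewrite ler_pM ?mix_ge0// mix_le.
move=> s x s0; rewrite !(Phi_mix mF FM s0); split.
  apply: Rintegral_ge0 => r _; have [r0|r0] := leP r 0; first by rewrite W_le0// mul0r.
  by rewrite mulr_ge0//; case: (hF (s + r) x (addr_gt0 s0 r0)).
rewrite -RintegralZl//; last exact: (integrable_PhiW mF FM s0).
apply: le_Rintegral => //.
- have := integrableZl measurableT (expR (- (dotp x x / (4 * s)))) (integrable_PhiW mF FM s0 0).
  by apply: eq_integrable.
- exact: (integrable_PhiW mF FM s0).
move=> r _; have [r0|r0] := leP r 0; first by rewrite W_le0// !mul0r mulr0.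
rewrite mulrCA ler_wpM2l//.
have [h0 h] := hF (s + r) x (addr_gt0 s0 r0).
apply: le_trans h; rewrite ler_wpM2r// ler_expR lerN2 ler_wpM2l ?dotp_ge0//.
by rewrite lef_pV2 ?posrE ?mulr_gt0 ?addr_gt0// ler_pM2l// lerDl ltW.
Qed.

(** The exponential series of a mixture has nonnegative coefficients. Removing
    its linear term preserves the property: this isolates the contribution of a
    single jump, from which a quantitative lower bound will be read off. *)
Lemma gpos_expR_mix F t (b : bool) : gpos F -> 0 <= t ->
  gpos (fun xi => F xi * (expR (t * mix xi) - b%:R * (t * mix xi))).
Proof.
move=> gF t0; have [mF [M FM] hF] := gF.
have M0 : 0 <= M by rewrite (le_trans _ (FM 0)).
pose y xi := t * mix xi.
have y0 xi : 0 <= y xi by rewrite mulr_ge0// mix_ge0.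
have gX k : gpos (fun xi => F xi * (y xi) ^+ k).
  elim: k => [|k IH]; first by under eq_fun do rewrite expr0 mulr1.
  under eq_fun do rewrite exprSr mulrA /y mulrCA.
  by apply: gposZ => //; exact: gpos_mix.
have gE k : gpos (fun xi => F xi * exp_coeff (y xi) k).
  under eq_fun do rewrite exp_coeffE mulrCA.
  by apply: gposZ; rewrite ?invr_ge0.
pose S k xi := F xi * (series (exp_coeff (y xi)) k.+2 - b%:R * y xi).
apply: (@gpos_lim S _ (M * expR (t * \int[mu]_r W r))).
- elim => [|k IH].
    rewrite (_ : S 0%N = (fun xi => F xi + (1 - b%:R) * (F xi * (y xi) ^+ 1))); last first.
      apply/funext => xi; rewrite /S !series_recr [series _ 0%N]big_geq// add0r.
      rewrite exp_coeffE/= fact0 factS fact0 expr0 expr1 invr1; ring.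
    by apply: gposD => //; apply: gposZ => //; case: (b); rewrite ?subrr ?subr0.
  rewrite (_ : S k.+1 = (fun xi => S k xi + F xi * exp_coeff (y xi) k.+2)).
    exact: gposD.
  apply/funext => xi; rewrite /S -mulrDr; congr (_ * _).
  by rewrite [in LHS]series_recr addrAC.
- move=> k xi; rewrite /S normrM.
  have h1 : series (exp_coeff (y xi)) k.+2 <= expR (y xi).
    apply: nondecreasing_cvgn_le; last exact: is_cvg_series_exp_coeff.
    apply: nondecreasing_series => i _ _; exact: exp_coeff_ge0.
  have h0 : y xi <= series (exp_coeff (y xi)) k.+2.
    elim: (k) => [|j IH].
      rewrite !series_recr [series _ 0%N]big_geq// add0r exp_coeffE/= fact0 factS.
      by rewrite fact0 invr1 expr1 !mul1r expr0 lerDr.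
    by rewrite series_recr (le_trans IH)// lerDl exp_coeff_ge0.
  have h3 : 0 <= b%:R * y xi by rewrite mulr_ge0.
  have h4 : b%:R * y xi <= y xi by case: (b); rewrite ?mul1r ?mul0r.
  have h5 : 0 <= series (exp_coeff (y xi)) k.+2 - b%:R * y xi.
    by rewrite subr_ge0 (le_trans h4).
  rewrite (ger0_norm h5); apply: ler_pM => //.
  apply: (@le_trans _ _ (expR (y xi))); first lra.
  by rewrite ler_expR ler_wpM2l// mix_le.
- move=> xi; apply: cvgMr; apply: cvgB; last exact: cvg_cst.
  have := @is_cvg_series_exp_coeff R (y xi).
  by rewrite -/(expR (y xi)) -(cvg_shiftn 2); under eq_fun do rewrite addn2.
Qed.

End mixture.
End positive_multipliers.

(** * The Levy representation of a fractional power *)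
Section integrable_lam.
Context {R : realType}.
Local Notation mu := (@lebesgue_measure R).

(** Its primitive is [atan], which is bounded. *)
Lemma integrable_inv1Dsqr : mu.-integrable setT (EFin \o (fun x : R => (1 + x ^+ 2)^-1)).
Proof.
have pos (x : R) : 0 < 1 + x ^+ 2 by rewrite (lt_le_trans ltr01)// lerDl sqr_ge0.
have -> : setT = \bigcup_n `[- n.+1%:R, n.+1%:R]%classic :> set (measurableTypeR R).
  apply/seteqP; split => // r _; exists (Num.trunc `|r|) => //=.
  by rewrite in_itv/= -ler_norml ltW// truncnS_gt.
have dF (x : R) : is_derive x 1 atan ((1 + x ^+ 2)^-1) by exact: is_derive1_atan.
apply: (@integrable_bigcup _ _ _ pi).
- move=> n m nm; apply/subsetPset => r /=; rewrite !in_itv/= -!ler_norml => rn.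
  by rewrite (le_trans rn)// ler_nat.
- by move=> i; exact: measurable_itv.
- by apply: measurable_invf => [x|]; [exact: ltW|meas].
- by move=> x; rewrite invr_ge0 ltW.
- move=> n; rewrite (@continuous_FTC2 _ _ atan).
  + have := @atan_ltpi2 R n.+1%:R; have := @atan_gtNpi2 R (- n.+1%:R).
    rewrite -EFinB lee_fin; lra.
  + by rewrite gtrN ?ltr0n.
  + apply: continuous_subspaceT => x.
    apply: cvgV; first by rewrite gt_eqF.
    by apply: cvgD; [exact: cvg_cst|exact: exprn_continuous].
  + split.
    * by move=> x _; exact: derivable_atan.
    * by apply: cvg_at_right_filter; exact: continuous_atan.
    * by apply: cvg_at_left_filter; exact: continuous_atan.
  + by move=> x _; rewrite derive1E; have dFx := dF x; rewrite derive_val.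
Qed.

(** One power of [lam] pays for each coordinate. *)
Lemma integrable_lam_inv n :
  (lebesgue_rV n).-integrable setT (EFin \o (fun xi : 'rV[R]_n => lam xi ^- n)).
Proof.
elim: n => [|n IH].
  apply: (@integrable_box _ _ _ 1 0) => [|v|v]; first by under eq_fun do rewrite expr0 invr1; exact: measurable_cst.
    by rewrite expr0 invr1 normr1.
  by case; case.
have mX : measurable_fun setT (fun xi : 'rV[R]_n.+1 => lam xi ^- n.+1).
  apply: measurable_invf => [x|]; first by rewrite exprn_ge0// ltW// lam_gt0.
  by apply: measurable_funX; exact: measurable_lam.
apply: (integrable_cons (a := fun t : R => (1 + t ^+ 2)^-1)
  (b := fun v : 'rV[R]_n => lam v ^- n)) => //; first exact: integrable_inv1Dsqr.
move=> t v.
have h1 : 0 < 1 + t ^+ 2 by rewrite (lt_le_trans ltr01)// lerDl sqr_ge0.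
have h2 := lam_gt0 v; have h3 := lam_gt0 (cons_rV (t, v)).
rewrite ger0_norm ?invr_ge0 ?exprn_ge0 ?(ltW h3)//.
rewrite -invfM lef_pV2 ?posrE ?mulr_gt0 ?exprn_gt0//.
rewrite [leRHS]exprS /lam dotp_cons -expr2.
have := sqr_ge0 t; have := dotp_ge0 v => d0 t0.
apply: ler_pM; rewrite ?exprn_ge0 ?(ltW h1) ?(ltW h2)//; first by rewrite lerD2l lerDl.
by rewrite lerXn2r ?nnegrE ?(ltW h2)// ?(le_trans (ltW h2))//; rewrite /lam; lra.
Qed.

Lemma integrable_scale_lam_inv n C :
  (lebesgue_rV n).-integrable setT (EFin \o (fun xi : 'rV[R]_n => C * lam xi ^- n)).
Proof. by apply: integrable_scalel => //; exact: integrable_lam_inv. Qed.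

End integrable_lam.

Section subordination.
Context {R : realType} {n : nat}.
Local Notation mu := (@lebesgue_measure R).
Variable a : R.
Hypotheses (a_gt0 : 0 < a) (a_lt1 : a < 1).
Implicit Types (xi x : 'rV[R]_n).

(** The integral of this function over [r > 0] is [l `^ a] up to a constant, by
    scaling; hence [exp (- t (lam xi) `^ a)] is a limit of exponentials of
    mixtures of the [exp (- r lam xi)]. *)
Definition levy (l r : R) : R := (1 - expR (- (r * l))) * r `^ (- a - 1).

Lemma levy_ge0 l r : 0 <= l -> 0 <= r -> 0 <= levy l r.
Proof.
move=> l0 r0; rewrite mulr_ge0 ?powR_ge0// subr_ge0 -expR0 ler_expR.
by rewrite oppr_le0 mulr_ge0.
Qed.

Lemma levy_le l r : 0 <= l -> 0 <= r -> levy l r <= r `^ (- a - 1).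
Proof.
move=> l0 r0; rewrite -[leRHS]mul1r ler_wpM2r ?powR_ge0//.
Qed.

Lemma levy_le_lin l r : 0 <= l -> 0 < r -> levy l r <= l * r `^ ((1 - a) - 1).
Proof.
move=> l0 r0.
have -> : r `^ ((1 - a) - 1) = r * r `^ (- a - 1).
  rewrite -[X in X * _]powRr1 ?(ltW r0)// -powRD ?(gt_eqF r0) ?implybT//.
  by congr (_ `^ _); ring.
rewrite mulrA ler_wpM2r ?powR_ge0// lerBlDr.
by have := expR_ge1Dx (- (r * l)); rewrite [l * r]mulrC; lra.
Qed.

Lemma ge0_le_powRN (r r' : R) : 0 < r -> r <= r' -> r' `^ (- a - 1) <= r `^ (- a - 1).
Proof.
move=> r0 rr'; have r'0 := lt_le_trans r0 rr'.
rewrite -(opprD a 1) !powRN lef_pV2 ?posrE ?powR_gt0//.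
by rewrite ge0_ler_powR ?nnegrE ?addr_ge0 ?(ltW a_gt0) ?(ltW r0) ?(ltW r'0).
Qed.

Lemma measurable_levy l : measurable_fun setT (levy l : measurableTypeR R -> R).
Proof. by rewrite /levy; meas. Qed.

Lemma measurable_indicM (f : R -> R) (D : set (measurableTypeR R)) : measurable D ->
  measurable_fun setT f -> measurable_fun setT (fun r : measurableTypeR R => f r * \1_D r).
Proof. by move=> mD mf; apply: measurable_funM => //; exact: measurable_indic. Qed.

Lemma integrable_levy01 l : 0 <= l -> mu.-integrable `]0, 1] (EFin \o levy l).
Proof.
move=> l0.
have b0 : 0 < 1 - a by rewrite subr_gt0.
have i1 := integrableZl (measurable_itv _ : measurable (_ : set (measurableTypeR R))) l (integrable_powR01 b0).
apply: (@integrable_dom R _ _ mu _ _ (levy l) (fun r => l * r `^ ((1 - a) - 1))) => //.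
- by apply: measurable_funTS; exact: measurable_levy.
- move=> r /=; rewrite in_itv/= => /andP[r0 _].
  by rewrite ger0_norm ?levy_ge0 ?(ltW r0)// levy_le_lin.
Qed.

Lemma integrable_levy1y l : 0 <= l -> mu.-integrable `]1, +oo[ (EFin \o levy l).
Proof.
move=> l0.
apply: (@integrable_dom R _ _ mu _ _ (levy l) (fun r => r `^ (- a - 1))) => //.
- by apply: measurable_funTS; exact: measurable_levy.
- exact: integrable_powR1y.
- move=> r /=; rewrite in_itv/= andbT => r1.
  have r0 : 0 <= r by rewrite (le_trans ler01)// ltW.
  by rewrite ger0_norm ?levy_ge0// levy_le.
Qed.

Definition levy_small l := \int[mu]_(r in `]0, 1]) levy l r.
Definition levy_large l := \int[mu]_(r in `]1, +oo[) levy l r.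
Definition levy_cst : R := levy_small 1 + levy_large 1.

Let itv0y : `]0, +oo[%classic = `]0, 1]%classic `|` `]1, +oo[%classic :> set (measurableTypeR R).
Proof.
apply/seteqP; split => r /=; rewrite !in_itv/= !andbT.
  by move=> ->; have [|] := leP r 1; [left|right].
by case=> [/andP[]//|r1]; rewrite (lt_trans ltr01).
Qed.

Let disj : [disjoint `]0, 1]%classic & `]1, +oo[%classic : set (measurableTypeR R)].
Proof.
apply/disj_setPS => r [/=]; rewrite !in_itv/= andbT => /andP[_ r1] r1'.
by move: (lt_le_trans r1' r1); rewrite ltxx.
Qed.

Lemma levy_split l : 0 <= l -> (\int[mu]_(r in `]0%R, +oo[) (levy l r)%:E =
  (levy_small l + levy_large l)%:E)%E.
Proof.
move=> l0.
rewrite itv0y integral_setU_EFin//; last first.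
  by apply: measurable_funTS; exact: measurable_levy.
rewrite Rint_EFin//; last exact: integrable_levy01.
by rewrite Rint_EFin//; exact: integrable_levy1y.
Qed.

Lemma levy_small_ge0 l : 0 <= l -> 0 <= levy_small l.
Proof.
move=> l0; apply: Rintegral_ge0 => r /=; rewrite in_itv/= => /andP[r0 _].
by rewrite levy_ge0// ltW.
Qed.

Lemma levy_cst_gt0 : 0 < levy_cst.
Proof.
rewrite /levy_cst ltr_wpDl ?levy_small_ge0//.
pose c := (1 - expR (- 1)) * 2 `^ (- a - 1).
have c0 : 0 < c by rewrite mulr_gt0 ?powR_gt0// subr_gt0 -[ltRHS]expR0 ltr_expR oppr_lt0.
apply: (lt_le_trans c0); apply: Rint_ge_on12.
- exact: measurable_itv.
- by apply: subset_itvl; rewrite bnd_simp.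
- exact: integrable_levy1y.
- by move=> r /=; rewrite in_itv/= andbT => r1; rewrite levy_ge0// (le_trans ler01)// ltW.
move=> r r1 r2; have r0 : 0 < r by rewrite (lt_trans ltr01).
rewrite ler_pM ?powR_ge0//.
- by rewrite lerD2l lerN2 ler_expR lerN2 mulr1 ltW.
- by rewrite ge0_le_powRN.
Qed.

(** The substitution [r -> l r] in the integral for [l = 1]. *)
Lemma levyE l : 0 < l -> l `^ a * levy_cst = levy_small l + levy_large l.
Proof.
move=> l0; apply: EFin_inj; rewrite -levy_split ?ltW// EFinM /levy_cst -levy_split//.
have mD : measurable (`]0, +oo[%classic : set (measurableTypeR R)) by [].
rewrite [X in (_ * X)%E]integral_mkcond [RHS]integral_mkcond.
have mf k : measurable_fun setT ((fun r : measurableTypeR R => (levy k r)%:E) \_ `]0, +oo[).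
  apply: (measurable_restrictT _ mD).1; apply/measurable_EFinP.
  by apply: measurable_funTS; exact: measurable_levy.
have f0 k r : 0 <= k -> (0 <= ((fun r => (levy k r)%:E) \_ `]0%R, +oo[) r)%E.
  move=> k0; rewrite patchE; case: ifP => //; rewrite mem_setE in_itv/= andbT => r0.
  by rewrite lee_fin levy_ge0// ltW.
rewrite (@ge0_integral_affine R 0 l _ l0 (mf 1)); last by move=> r; exact: f0.
rewrite -[X in (X * _)%E]/(EFin _) muleA -EFinM.
rewrite -ge0_integralZl//; last 3 first.
- apply: (@measurableT_comp _ _ _ (measurableTypeR R) (measurableTypeR R) _ _ _
    (fun t : R => 0 + l * t) (mf 1)); by meas.
- by move=> r _; exact: f0.
- by rewrite lee_fin mulr_ge0 ?powR_ge0 ?ltW.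
apply: eq_integral => r _; rewrite !patchE !mem_setE !in_itv/= !andbT add0r.
rewrite pmulr_rgt0//; case: ifP => r0; last by rewrite mule0.
rewrite -EFinM; congr EFin; rewrite /levy mulr1 [l * r]mulrC.
rewrite powRM ?(ltW r0) ?(ltW l0)//.
have e : l `^ a * l * l `^ (- a - 1) = 1.
  rewrite -[X in _ * X * _]powRr1 ?(ltW l0)// -!powRD ?(gt_eqF l0) ?implybT//.
  by rewrite (_ : _ + _ = 0) ?powRr0//; ring.
transitivity (l `^ a * l * l `^ (- a - 1) * ((1 - expR (- (r * l))) * r `^ (- a - 1))).
  by ring.
by rewrite e mul1r.
Qed.

End subordination.

(** * The heat multiplier *)
Section heat_multiplier.
Context {R : realType} {n : nat}.
Local Notation mu := (@lebesgue_measure R).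
Variable a : R.
Hypotheses (a_gt0 : 0 < a) (a_lt1 : a < 1).
Implicit Types (xi x : 'rV[R]_n) (D : set (measurableTypeR R)).

Definition psi xi : R := lam xi `^ a.

Definition heat (t : R) xi : R := expR (- (t * psi xi)).

Lemma psi_ge1 xi : 1 <= psi xi.
Proof.
rewrite /psi -[leLHS](_ : 1 `^ a = 1); last by rewrite powR1.
apply: ge0_ler_powR; rewrite ?nnegrE ?(ltW a_gt0)//.
- exact: ltW (lam_gt0 xi).
- exact: lam_ge1.
Qed.

Lemma psi_gt0 xi : 0 < psi xi.
Proof. exact: lt_le_trans (psi_ge1 xi). Qed.

Lemma measurable_psi d (T : measurableType d) (f : T -> 'rV[R]_n) :
  measurable_fun setT f -> measurable_fun setT (fun t => psi (f t)).
Proof. by move=> mf; apply: measurable_powRf; exact: measurable_lam. Qed.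

Lemma measurable_heat d (T : measurableType d) (u : T -> R) (f : T -> 'rV[R]_n) :
  measurable_fun setT u -> measurable_fun setT f ->
  measurable_fun setT (fun t => heat (u t) (f t)).
Proof.
move=> mu_ mf; apply: measurable_expRf; apply: measurable_oppf.
by apply: measurable_funM => //; exact: measurable_psi.
Qed.

Lemma heat_gt0 t xi : 0 < heat t xi. Proof. exact: expR_gt0. Qed.

Lemma heat_le1 t xi : 0 <= t -> heat t xi <= 1.
Proof. by move=> t0; rewrite -expR0 ler_expR oppr_le0 mulr_ge0// ltW// psi_gt0. Qed.

(** From [exp (- y) <= k! y ^- k], with [k] so large that [k a >= n]. *)
Lemma heat_dom t : 0 < t -> exists C : R, forall xi, heat t xi <= C * lam xi ^- n.
Proof.
move=> t0.
pose k := (Num.trunc (n%:R / a)).+1.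
have kn : n%:R <= a * k%:R.
  by rewrite mulrC -ler_pdivrMr// ltW// truncnS_gt.
exists (k`!%:R / t ^+ k) => xi.
have y0 : 0 < t * psi xi by rewrite mulr_gt0// psi_gt0.
have h := expr_le_fact_expR k (ltW y0).
have kf : 0 < (k`!%:R : R) by rewrite ltr0n fact_gt0.
have yk : 0 < (t * psi xi) ^+ k by rewrite exprn_gt0.
have h1 : heat t xi <= k`!%:R / (t * psi xi) ^+ k.
  by rewrite /heat expRN ler_pdivlMr// mulrC ler_pdivrMr ?expR_gt0.
apply: (le_trans h1); rewrite exprMn invfM mulrA ler_wpM2l ?divr_ge0 ?exprn_ge0 ?(ltW kf) ?(ltW t0)//.
rewrite lef_pV2 ?posrE ?exprn_gt0 ?psi_gt0 ?lam_gt0//.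
rewrite /psi -!powR_mulrn ?powR_ge0 ?(ltW (lam_gt0 _))// -powRrM.
by apply: ler_powR => //; exact: lam_ge1.
Qed.

Lemma integrable_heat t : 0 < t ->
  (lebesgue_rV n).-integrable setT (EFin \o heat t).
Proof.
move=> t0; have [C hC] := heat_dom t0.
apply: (integrable_dom measurableT (g := fun xi => C * lam xi ^- n)) => //.
- by apply: measurable_heat.
- exact: integrable_scale_lam_inv.
- by move=> xi _; rewrite ger0_norm ?(ltW (heat_gt0 _ _)).
Qed.

Lemma integrable_heat_cos t x th : 0 < t ->
  (lebesgue_rV n).-integrable setT (EFin \o (fun xi => heat t xi * cos (dotp xi x + th))).
Proof.
move=> t0; apply: (integrable_dom measurableT (g := heat t)) => //.
- by apply: measurable_funM; [exact: measurable_heat|meas].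
- exact: integrable_heat.
- move=> xi _; rewrite normrM (ger0_norm (ltW (heat_gt0 _ _))).
  by rewrite ler_piMr ?cos_norm_le1// ltW// heat_gt0.
Qed.

(** The Levy density restricted to a set of jump sizes. Away from 0 it is
    integrable, so that its exponential functionals are mixtures; the small
    jumps are reached by a limit. *)
Let W D (r : R) : R := r `^ (- a - 1) * \1_D r.

Let W_ge0 D r : 0 <= W D r.
Proof. by rewrite mulr_ge0 ?powR_ge0. Qed.

Let mW D : measurable D -> measurable_fun setT (W D).
Proof.
move=> mD; apply: (@measurable_indicM R (fun r => r `^ (- a - 1)) D mD).
by meas.
Qed.

Let large : set (measurableTypeR R) := `]1, +oo[%classic.
Let small k : set (measurableTypeR R) := `]k.+2%:R^-1, 1]%classic.

Let mlarge : measurable large. Proof. exact: measurable_itv. Qed.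
Let msmall k : measurable (small k). Proof. exact: measurable_itv. Qed.

Let Wlarge_int : mu.-integrable setT (EFin \o W large).
Proof. exact: (integrable_indicP _ mlarge).1 (integrable_powR1y a_gt0). Qed.

Let Wlarge_le0 r : r <= 0 -> W large r = 0.
Proof.
move=> r0; rewrite /W indicE memNset ?mulr0// /large/= in_itv/= andbT => r1.
by move: (lt_le_trans r1 r0); rewrite ltNge ler01.
Qed.

Let Wsmall_le0 k r : r <= 0 -> W (small k) r = 0.
Proof.
move=> r0; rewrite /W indicE memNset ?mulr0// /small/= in_itv/= => /andP[r1 _].
by move: (lt_le_trans r1 r0); rewrite ltNge invr_ge0 ler0n.
Qed.

Let Wsmall_int k : mu.-integrable setT (EFin \o W (small k)).
Proof.
pose C : R := (k.+2%:R^-1) `^ (- a - 1).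
apply: (@integrable_dom R _ _ mu setT _ (W (small k)) (fun r => C * \1_(small k) r)) => //.
- exact: mW.
- apply: integrable_scalel => //; exact: integrable_indic_itv.
- move=> r _; rewrite ger0_norm// /W indicE; have [rk|rk] := boolP (r \in small k); last by rewrite !mulr0.
  move: rk; rewrite !mulr1 mem_setE in_itv/= => /andP[kr _].
  by rewrite ge0_le_powRN ?invr_gt0// ltW.
Qed.

Let mix_levy D l : measurable D -> mu.-integrable setT (EFin \o W D) ->
  (forall r, r <= 0 -> W D r = 0) ->
  \int[mu]_(r in D) levy a (lam l) r = \int[mu]_r W D r - @mix R n (W D) l.
Proof.
move=> mD iW W0.
rewrite Rint_indic /mix -RintegralB//; last exact: (integrable_mix (mW mD) iW (W_ge0 D) W0).
by apply: eq_Rintegral => r _; rewrite /levy /W; ring.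
Qed.

Let levy_large_mix xi :
  levy_large a (lam xi) = \int[mu]_r W large r - mix (W large) xi.
Proof. exact: (mix_levy xi mlarge Wlarge_int Wlarge_le0). Qed.

Let levy_small_lim xi :
  \int[mu]_(r in small k) levy a (lam xi) r @[k --> \oo] --> levy_small a (lam xi).
Proof.
have l0 := ltW (lam_gt0 xi).
under eq_fun do rewrite Rint_indic.
rewrite /levy_small Rint_indic.
have mI (i : interval R) : measurable_fun setT (\1_[set` i] : measurableTypeR R -> R).
  by apply: measurable_indic; exact: measurable_itv.
apply: (@Rint_dct R _ _ mu setT _ _ _ (fun r => levy a (lam xi) r * \1_(`]0%R, 1%R]%classic) r)) => //.
- by move=> k; apply: measurable_funM; [exact: measurable_levy|exact: mI].
- move=> r _; apply: cvgMr; apply: cvg_near_cst.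
  rewrite !indicE; have [r01|r01] := boolP (r \in `]0%R, 1%R]%classic).
    move: r01; rewrite mem_setE in_itv/= => /andP[r0 r1].
    have := @cvg_idn_pinfty R => /cvgryPgt /(_ r^-1); apply: filterS => k kr.
    rewrite indicE mem_set// /small/= in_itv/= r1 andbT invf_plt ?posrE// (lt_trans kr)//.
    by rewrite ltr_nat.
  near=> k; rewrite indicE memNset// /small/= in_itv/= => /andP[kr r1].
  move: r01; rewrite mem_setE in_itv/= r1 andbT -leNgt => r0.
  by move: (lt_le_trans kr r0); rewrite ltNge invr_ge0 ler0n.
- apply: (integrable_indicP _ (measurable_itv _ : measurable (_ : set (measurableTypeR R)))).1.
  exact: integrable_levy01.
- move=> k r _; rewrite !indicE; have [rk|rk] := boolP (r \in small k).
    move: rk; rewrite mem_setE in_itv/= => /andP[kr r1].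
    have r0 : 0 < r by rewrite (lt_trans _ kr)// invr_gt0.
    by rewrite mem_set ?mulr1/= ?in_itv/= ?r0// ger0_norm// levy_ge0// ltW.
  rewrite mulr0 normr0; have [r01|r01] := boolP (r \in `]0%R, 1%R]%classic); last by rewrite mulr0.
  by move: r01; rewrite mem_setE in_itv/= mulr1 => /andP[r0 _]; rewrite levy_ge0// ltW.
Unshelve. all: by end_near. Qed.

Definition heat_small s xi := expR (- (s * levy_small a (lam xi))).

Lemma gpos_heat_small s : 0 <= s -> gpos (heat_small s).
Proof.
move=> s0.
pose m k := \int[mu]_r W (small k) r.
pose F k xi := expR (- (s * \int[mu]_(r in small k) levy a (lam xi) r)).
apply: (@gpos_lim _ _ F _ 1).
- move=> k.
  have -> : F k = fun xi => expR (- (s * m k)) *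
      (1 * (expR (s * mix (W (small k)) xi) - 0%:R * (s * mix (W (small k)) xi))).
    apply/funext => xi; rewrite /F (mix_levy xi (msmall k) (Wsmall_int k) (@Wsmall_le0 k)).
    rewrite mul1r mul0r subr0 -expRD; congr expR; rewrite /m; ring.
  apply: gposZ; first exact: expR_ge0.
  exact: (gpos_expR_mix (mW (msmall k)) (Wsmall_int k) (W_ge0 _) (@Wsmall_le0 k) false gpos1 s0).
- move=> k xi; rewrite /F ger0_norm ?expR_ge0// -expR0 ler_expR oppr_le0 mulr_ge0//.
  apply: Rintegral_ge0 => r; rewrite /small/= in_itv/= => /andP[kr _].
  by rewrite levy_ge0// ?(ltW (lam_gt0 _))// ltW// (lt_trans _ kr)// invr_gt0.
- move=> xi; rewrite /F /heat_small.
  apply: (continuous_cvg _ (@continuous_expR R _)).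
  by apply: cvgN; apply: cvgMr; exact: levy_small_lim.
Qed.

Lemma measurable_heat_small s : 0 <= s -> measurable_fun setT (heat_small s).
Proof. by move=> /gpos_heat_small[]. Qed.

Lemma heat_small_le1 s xi : 0 <= s -> heat_small s xi <= 1.
Proof.
move=> s0; rewrite -expR0 ler_expR oppr_le0 mulr_ge0// levy_small_ge0//.
exact: ltW (lam_gt0 xi).
Qed.

Let K := @levy_cst R a.
Let K_gt0 : 0 < K. Proof. exact: levy_cst_gt0. Qed.
Let m1 := \int[mu]_r W large r.

(** The large jumps form a compound Poisson factor, the exponential of a
    mixture; the small jumps are kept as a multiplier of their own. *)
Lemma heat_factor t xi : heat t xi = heat_small (t / K) xi *
  (expR (- (t / K * m1)) * expR (t / K * mix (W large) xi)).
Proof.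
have e := levyE a_gt0 a_lt1 (lam_gt0 xi).
rewrite levy_large_mix in e.
rewrite /heat /heat_small -!expRD; congr expR.
have -> : t * psi xi = t / K * (lam xi `^ a * K).
  by rewrite /psi; field; rewrite gt_eqF.
by rewrite [X in _ / _ * X]e -/m1; ring.
Qed.

Lemma heat_le_small t xi : 0 <= t -> heat t xi <= heat_small (t / K) xi.
Proof.
move=> t0; rewrite heat_factor -[leRHS]mulr1 ler_wpM2l ?expR_ge0//.
rewrite -expRD -expR0 ler_expR addrC subr_le0 ler_wpM2l ?divr_ge0 ?(ltW K_gt0)//.
exact: (mix_le (mW mlarge) Wlarge_int (W_ge0 _) Wlarge_le0).
Qed.

Lemma gpos_heat t : 0 <= t -> gpos (heat t).
Proof.
move=> t0; have tK : 0 <= t / K by rewrite divr_ge0// ltW.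
have -> : heat t = fun xi => expR (- (t / K * m1)) * (heat_small (t / K) xi *
    (expR (t / K * mix (W large) xi) - 0%:R * (t / K * mix (W large) xi))).
  by apply/funext => xi; rewrite heat_factor mul0r subr0 mulrCA.
apply: gposZ; first exact: expR_ge0.
exact: (gpos_expR_mix (mW mlarge) Wlarge_int (W_ge0 _) Wlarge_le0 false (gpos_heat_small tK) tK).
Qed.

Let w1 := \int[mu]_r W `]1, 2]%classic r.

Let W12_int : mu.-integrable setT (EFin \o W `]1, 2]%classic).
Proof.
apply: (@integrable_dom R _ _ mu setT measurableT _ (W large)) => //.
  by apply: mW; exact: measurable_itv.
move=> r _; rewrite ger0_norm// /W ler_wpM2l ?powR_ge0//.
rewrite !indicE /large !mem_setE !in_itv/= andbT.
by have [r1|r1] := ltP 1 r; rewrite //= lern1 leq_b1.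
Qed.

Lemma heat_jump_cst_gt0 : 0 < w1.
Proof.
apply: (@lt_le_trans _ _ (2 `^ (- a - 1))); first by rewrite powR_gt0.
apply: Rint_ge_on12 => // r r1 r2; rewrite /W indicE mem_set/= ?in_itv/= ?r1// mulr1.
by rewrite ge0_le_powRN// (lt_trans ltr01).
Qed.

(** Keeping from the exponential series of the large jumps only one jump, of
    size in [(1, 2]], leaves a mixture of Gaussians of variance bounded below:
    the resulting bound on the smoothed kernel is uniform in the smoothing. *)
Definition heat_lb t : R :=
  expR (- (t / K * m1)) * (t / K) * (w1 * Phi (heat t) 3 0).

Lemma Phi_heat_small_mono t s : 0 <= t -> 0 < s -> s <= 3 ->
  Phi (heat t) 3 0 <= Phi (heat_small (t / K)) s 0.
Proof.
move=> t0 s0 s3; have tK : 0 <= t / K by rewrite divr_ge0// ltW.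
apply: le_Rintegral => //.
- apply: (@integrable_Phi _ _ _ 1) => //; first by apply: measurable_heat.
  by move=> xi; rewrite ger0_norm ?heat_le1// ltW// heat_gt0.
- apply: (@integrable_Phi _ _ _ 1) => //; first exact: measurable_heat_small.
  by move=> xi; rewrite ger0_norm ?heat_small_le1// expR_ge0.
- move=> xi _; rewrite dotp0r cos0 !mulr1; apply: ler_pM; rewrite ?expR_ge0//.
    exact: heat_le_small.
  by rewrite ler_expR lerN2 ler_wpM2r// ltW// lam_gt0.
Qed.

Lemma Phi_heat_lb t s x : 0 <= t -> 0 < s -> s <= 1 ->
  heat_lb t * expR (- (dotp x x / 4)) <= Phi (heat t) s x.
Proof.
move=> t0 s0 s1; have tK : 0 <= t / K by rewrite divr_ge0// ltW.
pose Q := heat_small (t / K).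
have gQ : gpos Q by exact: gpos_heat_small.
have [mQ [M QM] hQ] := gQ.
pose P1 xi := expR (- (t / K * m1)) * (t / K) * (Q xi * mix (W large) xi).
pose P2 xi := expR (- (t / K * m1)) * (Q xi *
    (expR (t / K * mix (W large) xi) - 1%:R * (t / K * mix (W large) xi))).
have gP1 : gpos P1.
  apply: gposZ; first by rewrite mulr_ge0// expR_ge0.
  exact: (gpos_mix (mW mlarge) Wlarge_int (W_ge0 _) Wlarge_le0).
have gP2 : gpos P2.
  apply: gposZ; first exact: expR_ge0.
  exact: (gpos_expR_mix (mW mlarge) Wlarge_int (W_ge0 _) Wlarge_le0 true gQ tK).
have E : heat t = fun xi => P1 xi + P2 xi.
  by apply/funext => xi; rewrite heat_factor /P1 /P2 /Q; ring.
have [mP1 [M1 hM1] _] := gP1; have [mP2 [M2 hM2] hP2] := gP2.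
rewrite E (PhiD _ mP1 mP2 hM1 hM2 s0) -[leLHS]addr0; apply: lerD; last first.
  have [h0 h] := hP2 s x s0; apply: le_trans h; rewrite mulr_ge0 ?expR_ge0//.
have gQW := gpos_mix (mW mlarge) Wlarge_int (W_ge0 _) Wlarge_le0 gQ.
have [mQW [MW hMW] _] := gQW.
have c0 : 0 <= expR (- (t / K * m1)) * (t / K).
  by apply: mulr_ge0 => //; exact: expR_ge0.
rewrite /P1 (PhiZ _ _ mQW hMW s0) /heat_lb -[leLHS]mulrA (ler_wpM2l c0)//.
rewrite (Phi_mix (mW mlarge) Wlarge_int (W_ge0 _) Wlarge_le0 mQ QM s0).
rewrite -mulrA mulrC -RintegralZl//.
apply: le_Rintegral => //.
- exact: integrable_scalel.
- exact: (integrable_PhiW (mW mlarge) Wlarge_int (W_ge0 _) Wlarge_le0 mQ QM s0).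
move=> r _; rewrite mulrC.
have [r12|r12] := boolP (r \in `]1%R, 2%R]%classic); last first.
  rewrite {1}/W indicE (negbTE r12) mulr0 mul0r.
  have [r0|r0] := leP r 0; first by rewrite Wlarge_le0// mul0r.
  have [h0 h] := hQ (s + r) x (addr_gt0 s0 r0).
  by rewrite mulr_ge0// (le_trans _ h)// mulr_ge0 ?expR_ge0.
move: (r12); rewrite mem_setE in_itv/= => /andP[r1 r2].
have r0 : 0 < r by rewrite (lt_trans ltr01).
have -> : W `]1%R, 2%R]%classic r = W large r.
  by rewrite /W !indicE r12 mem_set// /large/= in_itv/= r1.
rewrite ler_wpM2l//.
have [h0 h] := hQ (s + r) x (addr_gt0 s0 r0).
apply: le_trans h; rewrite mulrC; apply: ler_pM.
- exact: expR_ge0.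
- by have [_ _ /(_ 3 0)[]] := gpos_heat t0.
- rewrite ler_expR lerN2 ler_wpM2l ?dotp_ge0// lef_pV2 ?posrE ?mulr_gt0 ?addr_gt0//; lra.
- apply: Phi_heat_small_mono => //; lra.
Qed.

Lemma Phi1E s : 0 < s -> Phi (fun=> 1 : R) s (0 : 'rV[R]_n) = expR (- s) * Num.sqrt (pi / s) ^+ n.
Proof.
move=> s0; have := Rint_gauss_scaled (0 : 'rV[R]_n) 0 s0.
rewrite cos0 mulr1 dotp0r mul0r oppr0 expR0 mulr1 => <-.
rewrite /Phi -RintegralZl//; last exact: integrable_gauss_scaled_cos.
by apply: eq_Rintegral => xi _; rewrite mul1r addr0 mulrA -expRD /lam;
    congr (expR _ * _); ring.
Qed.

(** For [a < 1] the symbol [psi] is at most [lam], so that [heat t] dominates a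
    Gaussian multiplier. *)
Lemma Phi_heat_ge t T : 0 <= t -> t <= T ->
  expR (- (T + 3)) * Num.sqrt (pi / (T + 3)) ^+ n <= Phi (heat t) 3 0.
Proof.
move=> t0 tT; have T0 : 0 <= T by exact: le_trans tT.
have T3 : 0 < T + 3 by rewrite ltr_wpDl.
rewrite -Phi1E//; apply: le_Rintegral => //.
- by apply: (@integrable_Phi _ _ _ 1) => // xi; rewrite normr1.
- apply: (@integrable_Phi _ _ _ 1) => //; first by apply: measurable_heat.
  by move=> xi; rewrite ger0_norm ?heat_le1// ltW// heat_gt0.
move=> xi _; rewrite dotp0r cos0 !mulr1 mul1r /heat -expRD ler_expR -opprD lerN2.
rewrite [leRHS]mulrDl; apply: lerD => //; apply: ler_pM => //; first by rewrite ltW// psi_gt0.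
by rewrite /psi ler1_powR//; [exact: lam_ge1|exact: ltW].
Qed.

Lemma heat_lb_ge t0 T : 0 < t0 -> exists2 c : R, 0 < c &
  forall t, t0 <= t -> t <= T -> c <= heat_lb t.
Proof.
move=> t00; have [Tt|tT] := ltP T t0.
  by exists 1 => // t h1 h2; move: (le_lt_trans (le_trans h1 h2) Tt); rewrite ltxx.
have T0 : 0 < T by exact: lt_le_trans tT.
have T3 : 0 < T + 3 by rewrite addr_gt0.
have m10 : 0 <= m1 by apply: Rintegral_ge0 => r _; exact: W_ge0.
pose c1 := expR (- (T / K * m1)) * (t0 / K).
pose c2 := w1 * (expR (- (T + 3)) * Num.sqrt (pi / (T + 3)) ^+ n).
have c10 : 0 < c1 by rewrite mulr_gt0 ?expR_gt0// divr_gt0.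
have c20 : 0 < c2.
  rewrite mulr_gt0 ?heat_jump_cst_gt0// mulr_gt0 ?expR_gt0// exprn_gt0// sqrtr_gt0.
  by rewrite divr_gt0// pi_gt0.
exists (c1 * c2); first exact: mulr_gt0.
move=> t t0t tT'; rewrite /heat_lb; apply: ler_pM; rewrite ?(ltW c10) ?(ltW c20)//.
- apply: ler_pM; rewrite ?expR_ge0 ?divr_ge0 ?(ltW t00) ?(ltW K_gt0)//.
    by rewrite ler_expR lerN2 ler_wpM2r// ler_wpM2r// invr_ge0 ltW.
  by rewrite ler_wpM2r// invr_ge0 ltW.
- rewrite ler_wpM2l ?(ltW heat_jump_cst_gt0)//; apply: Phi_heat_ge => //.
  by rewrite (le_trans (ltW t00)).
Qed.

End heat_multiplier.

(** * Fourier inversion and the free kernel *)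

Lemma fatou_le (R : realType) d (T : measurableType d) (m : {measure set T -> \bar R})
    (f_ : nat -> T -> \bar R) (f : T -> \bar R) (C_ : nat -> R) (C : R) :
  (forall k, measurable_fun setT (f_ k)) -> (forall k x, 0 <= f_ k x)%E ->
  (forall x, f_ k x @[k --> \oo] --> f x) ->
  (forall k, \int[m]_x f_ k x <= (C_ k)%:E)%E -> C_ k @[k --> \oo] --> C ->
  (\int[m]_x f x <= C%:E)%E.
Proof.
move=> mf f0 ff fC CC.
have := fatou m measurableT mf (fun k x _ => f0 k x).
rewrite (_ : (\int[m]_x limn_einf (f_^~ x) = \int[m]_x f x)%E); last first.
  apply: eq_integral => x _; rewrite is_cvg_limn_einfE; last by apply/cvg_ex; exists (f x).
  exact/cvg_lim.
move=> /le_trans; apply.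
have CC' : (C_ k)%:E @[k --> \oo] --> C%:E by apply: cvg_EFin => //; exact: nearW.
rewrite limn_einf_lim -(cvg_lim _ CC')//; apply: lee_lim.
- exact: is_cvg_einfs.
- by apply/cvg_ex; exists C%:E.
- apply: nearW => k; apply: le_trans (fC k).
  by apply: ereal_inf_lbound; exists k => /=.
Qed.

Section inversion.
Context {R : realType} {n : nat}.
Implicit Types (x y z xi : 'rV[R]_n).

(** The width is chosen so that the transform is, up to a constant, the Gaussian
    [exp (- k.+1 ^ 2 |x| ^ 2)] of the approximate identity. *)
Definition gauss_cut (k : nat) xi : R := expR (- ((4 * k.+1%:R ^+ 2)^-1 * dotp xi xi)).

Let cut_gt0 k : 0 < (4 * k.+1%:R ^+ 2 : R)^-1.
Proof. by rewrite invr_gt0 mulr_gt0// exprn_gt0// ltr0n. Qed.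

Lemma gauss_cut_ge0 k xi : 0 <= gauss_cut k xi. Proof. exact: expR_ge0. Qed.

Lemma gauss_cut_le1 k xi : gauss_cut k xi <= 1.
Proof. by rewrite -expR0 ler_expR oppr_le0 mulr_ge0 ?dotp_ge0// ltW. Qed.

Lemma integrable_gauss_cut k : (lebesgue_rV n).-integrable setT (EFin \o gauss_cut k).
Proof. exact: integrable_gauss_scaled0. Qed.

Lemma measurable_gauss_cut k : measurable_fun setT (gauss_cut k).
Proof. by rewrite /gauss_cut; meas. Qed.

Lemma gauss_cut_cvg xi : gauss_cut k xi @[k --> \oo] --> (1 : R).
Proof.
rewrite -expR0 /gauss_cut; apply: (continuous_cvg _ (@continuous_expR R _)).
rewrite -oppr0; apply: cvgN; rewrite -[X in _ --> X](mul0r (dotp xi xi)).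
apply: cvgMl.
have h : (k.+1%:R : R)^-1 @[k --> \oo] --> 0 by exact: (@cvg_harmonic R).
have h2 : 4^-1 * (k.+1%:R^-1 * k.+1%:R^-1) @[k --> \oo] --> (4^-1 * (0 * 0) : R).
  by apply: cvgMr; apply: cvgM.
rewrite !mulr0 in h2; apply: cvg_trans h2; apply: near_eq_cvg.
by apply: nearW => k; rewrite invfM expr2 invfM.
Qed.

Lemma Rint_gauss_cut k x th :
  \int[lebesgue_rV n]_xi (gauss_cut k xi * cos (dotp xi x + th)) =
  (2 * k.+1%:R * Num.sqrt pi) ^+ n * expR (- (k.+1%:R ^+ 2 * dotp x x)) * cos th.
Proof.
have k0 : (k.+1%:R : R) != 0 by rewrite pnatr_eq0.
rewrite (Rint_gauss_scaled x th (cut_gt0 k)); congr (_ ^+ _ * expR (- _) * _).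
  rewrite invrK (_ : pi * (4 * k.+1%:R ^+ 2) = pi * (2 * k.+1%:R) ^+ 2); last by ring.
  by rewrite sqrtrM ?pi_ge0// sqrtr_sqr ger0_norm ?mulr_ge0// mulrC.
have k0' : (k.+1%:R : R) ^+ 2 != 0 by rewrite expf_neq0.
by field.
Qed.

(** Inserting the cut-off makes the double integral absolutely convergent;
    exchanging the integrals turns it into a Gaussian average around [x]. *)
Lemma inversion_cut (f : 'rV[R]_n -> R) M x th :
  measurable_fun setT f -> (forall y, `|f y| <= M) ->
  (lebesgue_rV n).-integrable setT (EFin \o f) -> f y @[y --> x] --> f x ->
  \int[lebesgue_rV n]_xi (gauss_cut k xi *
     \int[lebesgue_rV n]_y (f y * cos (dotp xi (x - y) + th))) @[k --> \oo] -->
  (2 * pi) ^+ n * (f x * cos th).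
Proof.
move=> mf fM fi fx.
have fi' := integrable_normr measurableT fi.
have fc xi : (lebesgue_rV n).-integrable setT
    (EFin \o (fun y => f y * cos (dotp xi (x - y) + th))).
  apply: (integrable_dom measurableT (g := fun y => `|f y|)) => //; first by meas.
  by move=> y _; rewrite normrM ler_piMr// cos_norm_le1.
have E k : \int[lebesgue_rV n]_xi (gauss_cut k xi *
     \int[lebesgue_rV n]_y (f y * cos (dotp xi (x - y) + th))) =
    (2 * Num.sqrt pi) ^+ n * cos th * (k.+1%:R ^+ n * \int[lebesgue_rV n]_y
      (f y * expR (- (k.+1%:R ^+ 2 * dotp (y - x) (y - x))))).
  transitivity (\int[lebesgue_rV n]_xi \int[lebesgue_rV n]_y
      (gauss_cut k xi * (f y * cos (dotp xi (x - y) + th)))).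
    by apply: eq_Rintegral => xi _; rewrite RintegralZl.
  rewrite (swap_Rint (f := gauss_cut k) (g := fun y => `|f y|))//; last 3 first.
  - apply: measurable_funM; first by rewrite /gauss_cut; meas.
    by apply: measurable_funM; [exact: (measurableT_comp mf)|meas].
  - exact: integrable_gauss_cut.
  - move=> xi y; rewrite !normrM (ger0_norm (gauss_cut_ge0 _ _)) ler_wpM2l ?gauss_cut_ge0//.
    by rewrite ler_piMr// cos_norm_le1.
  rewrite mulrA -RintegralZl//; last first.
    have h : 0 < (k.+1%:R : R) ^+ 2 by rewrite exprn_gt0.
    apply: (integrable_dom measurableT (g := fun y => M * expR (- (k.+1%:R ^+ 2 * dotp (y - x) (y - x))))) => //.
    + by meas.
    + by apply: integrable_scalel => //; exact: integrable_gauss_scaled.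
    + by move=> y _; rewrite normrM (ger0_norm (expR_ge0 _)) ler_wpM2r ?expR_ge0.
  apply: eq_Rintegral => y _.
  transitivity (f y * \int[lebesgue_rV n]_xi (gauss_cut k xi * cos (dotp xi (x - y) + th))).
    rewrite -RintegralZl//; last exact: integrable_gauss_scaled_cos.
    by apply: eq_Rintegral => xi _; rewrite mulrCA.
  rewrite Rint_gauss_cut -(opprB y x) dotpNl dotpNr opprK 2!exprMn exprMn; ring.
under eq_fun do rewrite E.
rewrite (_ : (2 * pi) ^+ n * (f x * cos th) =
   (2 * Num.sqrt pi) ^+ n * cos th * (Num.sqrt pi ^+ n * f x)); last first.
  rewrite mulrACA -exprMn -mulrA -expr2 sqr_sqrtr ?pi_ge0//; ring.
by apply: cvgMr; exact: gauss_approx.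
Qed.

End inversion.

Section kernel.
Context {R : realType} {n : nat}.
Local Notation mu := (@lebesgue_measure R).
Variable a : R.
Hypotheses (a_gt0 : 0 < a) (a_lt1 : a < 1).
Implicit Types (x y z xi : 'rV[R]_n) (t : R).
Local Notation heat := (@heat R n a).

(** The kernel of the semigroup generated by [- (1 - Laplacian) ^ a]. *)
Definition pker t x : R := (2 * pi) ^- n * \int[lebesgue_rV n]_xi (heat t xi * cos (dotp xi x)).

Lemma twopi_gt0 : 0 < (2 * pi : R) ^+ n.
Proof. by rewrite exprn_gt0// mulr_gt0// pi_gt0. Qed.

Lemma measurable_pker d (T : measurableType d) (u : T -> R) (f : T -> 'rV[R]_n) :
  measurable_fun setT u -> measurable_fun setT f ->
  measurable_fun setT (fun w => pker (u w) (f w)).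
Proof.
move=> mu_ mf; apply: measurable_funM; first exact: measurable_cst.
apply: (@measurable_Rint _ _ _ _ _ (lebesgue_rV n)
  (fun w xi => heat (u w) xi * cos (dotp xi (f w)))).
apply: measurable_funM.
  apply: measurable_heat; last by meas.
  exact: (measurableT_comp mu_).
by apply: measurable_cosf; apply: measurable_dotp; [meas|exact: (measurableT_comp mf)].
Qed.

Lemma pker_lb t x : 0 < t ->
  (2 * pi) ^- n * (@heat_lb R n a t * expR (- (dotp x x / 4))) <= pker t x.
Proof.
move=> t0; rewrite ler_wpM2l ?invr_ge0 ?(ltW twopi_gt0)//.
have cv : Phi (heat t) k.+1%:R^-1 x @[k --> \oo] -->
    \int[lebesgue_rV n]_xi (heat t xi * cos (dotp xi x)).
  apply: (@Rint_dct R _ _ (lebesgue_rV n) setT _ _ _ (heat t)) => //.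
  - by move=> k; apply: measurable_Phi; exact: measurable_heat.
  - move=> xi _; apply: cvgMl; rewrite -[X in _ --> X]mulr1; apply: cvgMr.
    rewrite -[X in _ --> X]expR0; apply: (continuous_cvg _ (@continuous_expR R _)).
    rewrite -[X in _ --> X]oppr0 -[X in _ --> - X](mul0r (lam xi)); apply: cvgN; apply: cvgMl.
    exact: (@cvg_harmonic R).
  - exact: integrable_heat.
  - move=> k xi _; rewrite !normrM (ger0_norm (ltW (heat_gt0 _ _ _))) (ger0_norm (expR_ge0 _)).
    rewrite -mulrA ler_piMr ?(ltW (heat_gt0 _ _ _))// mulr_ile1 ?expR_ge0 ?cos_norm_le1//.
    by rewrite -expR0 ler_expR oppr_le0 mulr_ge0// ltW// lam_gt0.
apply: (cvgr_to_ge cv); apply: nearW => k; apply: Phi_heat_lb; rewrite ?(ltW t0)//.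
by rewrite invf_le1// ler1n.
Qed.

(** The bound on the smoothed kernels is uniform, hence survives when the
    smoothing tends to 0; as the only quantitative lower bound on the kernel, it
    is stated uniformly for times in a compact interval. *)
Lemma pker_ge t0 T : 0 < t0 -> exists2 c : R, 0 < c &
  forall t x, t0 <= t -> t <= T -> c * expR (- (dotp x x / 4)) <= pker t x.
Proof.
move=> t00; have [c c0 hc] := @heat_lb_ge R n a a_gt0 a_lt1 t0 T t00.
exists ((2 * pi) ^- n * c); first by rewrite mulr_gt0// invr_gt0 twopi_gt0.
move=> t x t0t tT; apply: le_trans (pker_lb x (lt_le_trans t00 t0t)).
rewrite -mulrA ler_wpM2l ?invr_ge0 ?(ltW twopi_gt0)// ler_wpM2r ?expR_ge0//.
exact: hc.
Qed.

Lemma pker_gt0 t x : 0 < t -> 0 < pker t x.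
Proof.
move=> t0; have [c c0 /(_ t x (lexx t) (lexx t))] := pker_ge t t0.
by apply: lt_le_trans; rewrite mulr_gt0 ?expR_gt0.
Qed.

Lemma continuous_lam : continuous (@lam R n).
Proof.
have h (s : seq 'I_n) : continuous (fun y : 'rV[R]_n => \sum_(i <- s) y 0 i * y 0 i).
  elim: s => [|i s IH] y.
    have -> : (fun y : 'rV[R]_n => \sum_(i <- [::]) y 0 i * y 0 i) = cst 0.
      by apply/funext => z; rewrite big_nil.
    exact: cst_continuous.
  have -> : (fun y : 'rV[R]_n => \sum_(j <- i :: s) y 0 j * y 0 j) =
      (fun y : 'rV[R]_n => y 0 i * y 0 i) \+ (fun y : 'rV[R]_n => \sum_(j <- s) y 0 j * y 0 j).
    by apply/funext => z; rewrite big_cons.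
  apply: continuousD; last exact: IH.
  by apply: (@continuousM _ _ (fun y : 'rV[R]_n => y 0 i)); exact: coord_continuous.
suff : continuous ((cst 1 : 'rV[R]_n -> R) \+ (fun y : 'rV[R]_n => dotp y y)) by [].
by move=> xi; apply: continuousD; [exact: cst_continuous|exact: h].
Qed.

Lemma continuous_heat t : continuous (heat t).
Proof.
move=> xi.
apply: (@continuous_comp _ _ _ (@lam R n) (fun l : R => expR (- (t * l `^ a))) xi).
  exact: continuous_lam.
have h : differentiable (fun l : R => expR (- (t * l `^ a))) (lam xi).
  apply/derivable1_diffP; have d1 := is_derive1_powR a (lam_gt0 xi).
  exact: ex_derive.
exact: (differentiable_continuous h).
Qed.

Let hk t x := \int[lebesgue_rV n]_xi (heat t xi * cos (dotp xi x)).

Let hkE t x : hk t x = (2 * pi) ^+ n * pker t x.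
Proof. by rewrite /pker mulrA divff ?mul1r// gt_eqF// twopi_gt0. Qed.

Let mhk t : measurable_fun setT (hk t).
Proof.
have -> : hk t = fun x => (2 * pi) ^+ n * pker t x by apply/funext => x; exact: hkE.
by apply: measurable_funM => //; apply: measurable_pker.
Qed.

Let hk_ge0 t x : 0 < t -> 0 <= hk t x.
Proof. by move=> t0; rewrite hkE mulr_ge0// ltW ?twopi_gt0// pker_gt0. Qed.

Let hk_bound t x : 0 < t -> `|hk t x| <= \int[lebesgue_rV n]_xi heat t xi.
Proof.
move=> t0; apply: normr_Rint_le => //.
- by apply: measurable_funM; [exact: measurable_heat|meas].
- exact: integrable_heat.
- move=> xi _; rewrite normrM (ger0_norm (ltW (heat_gt0 _ _ _))).
  by rewrite ler_piMr ?cos_norm_le1// ltW// heat_gt0.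
Qed.

(* The product [hk t z * cos (dotp z xi + th)] is the half-sum of two cosine
   transforms of [heat t], one at [xi] and one at [- xi], to which the inversion
   theorem applies. *)
Let hk_split k t xi th : 0 < t ->
  2^-1 * (\int[lebesgue_rV n]_z (gauss_cut k z *
      \int[lebesgue_rV n]_y (heat t y * cos (dotp z (xi - y) + th))) +
    \int[lebesgue_rV n]_z (gauss_cut k z *
      \int[lebesgue_rV n]_y (heat t y * cos (dotp z (- xi - y) + - th)))) =
  \int[lebesgue_rV n]_z (gauss_cut k z * (hk t z * cos (dotp z xi + th))).
Proof.
move=> t0.
have mh : measurable_fun setT (heat t) by apply: measurable_heat.
pose A x' s z := \int[lebesgue_rV n]_y (heat t y * cos (dotp z (x' - y) + s)).
have iA x' s z : (lebesgue_rV n).-integrable setT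
    (EFin \o (fun y => heat t y * cos (dotp z (x' - y) + s))).
  apply: (integrable_dom measurableT _ (integrable_heat a_gt0 t0)).
  - by meas.
  - move=> y _; rewrite normrM (ger0_norm (ltW (heat_gt0 _ _ _))).
    by rewrite ler_piMr ?cos_norm_le1// ltW// heat_gt0.
have mA x' s : measurable_fun setT (A x' s).
  apply: (@measurable_Rint _ _ _ _ _ (lebesgue_rV n)
    (fun z y => heat t y * cos (dotp z (x' - y) + s))).
  by apply: measurable_funM; [exact: (measurableT_comp mh)|meas].
have Ab x' s z : `|A x' s z| <= \int[lebesgue_rV n]_y heat t y.
  apply: normr_Rint_le => //.
  - exact: integrable_measurable (iA x' s z).
  - exact: integrable_heat.
  - move=> y _; rewrite normrM (ger0_norm (ltW (heat_gt0 _ _ _))).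
    by rewrite ler_piMr ?cos_norm_le1// ltW// heat_gt0.
have icA x' s : (lebesgue_rV n).-integrable setT (EFin \o (fun z => gauss_cut k z * A x' s z)).
  apply: (integrable_dom measurableT (g := fun z => (\int[lebesgue_rV n]_y heat t y) * gauss_cut k z)).
  - by apply: measurable_funM; [exact: measurable_gauss_cut|exact: mA].
  - by apply: integrable_scalel => //; exact: integrable_gauss_cut.
  - move=> z _; rewrite normrM (ger0_norm (gauss_cut_ge0 _ _)) mulrC.
    by apply: ler_wpM2r; [exact: gauss_cut_ge0|exact: Ab].
rewrite -(RintegralD measurableT (icA xi th) (icA (- xi) (- th))).
rewrite -RintegralZl; [|exact: measurableT|]; last first.
  by apply: (integrable_add measurableT); exact: icA.
apply: eq_Rintegral => z _; rewrite -mulrDr mulrCA; congr (_ * _).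
rewrite -(RintegralD measurableT (iA xi th z) (iA (- xi) (- th) z)).
rewrite -RintegralZl; [|exact: measurableT|]; last first.
  by apply: (integrable_add measurableT); exact: iA.
rewrite /hk -RintegralZr; [|exact: measurableT|]; last first.
  apply: eq_integrable (integrable_heat_cos a_gt0 z 0 t0); first exact: measurableT.
  by move=> y _ /=; rewrite addr0.
apply: eq_Rintegral => y _; rewrite -mulrDr mulrCA -[RHS]mulrA; congr (_ * _).
rewrite (_ : dotp z (- xi - y) - th = - (dotp z xi + th + dotp y z)); last first.
  by rewrite dotpBr dotpNr (dotpC z y); ring.
rewrite (_ : dotp z (xi - y) + th = dotp z xi + th - dotp y z); last first.
  by rewrite dotpBr (dotpC z y); ring.
move: (dotp z xi + th) (dotp y z) => c e.
by rewrite cosN cosB cosD; field.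
Qed.

Let hk_cut t xi th : 0 < t ->
  \int[lebesgue_rV n]_z (gauss_cut k z * (hk t z * cos (dotp z xi + th))) @[k --> \oo] -->
  (2 * pi) ^+ n * (heat t xi * cos th).
Proof.
move=> t0; under eq_fun do rewrite -hk_split//.
have heat1 y : `|heat t y| <= 1.
  by rewrite ger0_norm ?heat_le1 ?(ltW t0)// ltW// heat_gt0.
have mh : measurable_fun setT (heat t) by apply: measurable_heat.
have -> : (2 * pi) ^+ n * (heat t xi * cos th) =
  2^-1 * ((2 * pi) ^+ n * (heat t xi * cos th) + (2 * pi) ^+ n * (heat t (- xi) * cos (- th))).
  rewrite cosN (_ : heat t (- xi) = heat t xi); first by field.
  by rewrite /heat /psi /lam dotpNl dotpNr opprK.
apply: cvgM; first exact: cvg_cst.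
apply: cvgD.
- exact: inversion_cut mh heat1 (integrable_heat a_gt0 t0) (@continuous_heat t xi).
- exact: inversion_cut mh heat1 (integrable_heat a_gt0 t0) (@continuous_heat t (- xi)).
Qed.

(* The kernel is nonnegative, so Fatou's lemma bounds its integral by the limit
   of the cut-off integrals: this is how it is seen to be integrable. *)
Let hk_integral_le t : 0 < t -> (\int[lebesgue_rV n]_z (hk t z)%:E <= ((2 * pi) ^+ n * heat t 0)%:E)%E.
Proof.
move=> t0; have h := hk_cut (xi := 0) (th := 0) t0; rewrite cos0 mulr1 in h.
apply: (@fatou_le R _ _ (lebesgue_rV n) (fun k z => (gauss_cut k z * hk t z)%:E) _ _ _ _ _ _ _ h).
- move=> k; apply/measurable_EFinP; apply: measurable_funM => //.
  exact: measurable_gauss_cut.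
- by move=> k z; rewrite lee_fin mulr_ge0 ?gauss_cut_ge0 ?hk_ge0.
- move=> z; apply: cvg_EFin; first exact: nearW.
  rewrite -[X in _ --> X]mul1r; apply: cvgMl; exact: gauss_cut_cvg.
- move=> k; rewrite Rint_EFin//.
    by rewrite lee_fin; under [leRHS]eq_Rintegral do rewrite dotp0r add0r cos0 mulr1.
  apply: (integrable_dom measurableT (g := fun z => (\int[lebesgue_rV n]_y heat t y) * gauss_cut k z)) => //.
  + by apply: measurable_funM => //; exact: measurable_gauss_cut.
  + by apply: integrable_scalel => //; exact: integrable_gauss_cut.
  + move=> z _; rewrite normrM (ger0_norm (gauss_cut_ge0 _ _)) mulrC.
    by rewrite ler_wpM2r ?gauss_cut_ge0// hk_bound.
Qed.

Let integrable_hk t : 0 < t -> (lebesgue_rV n).-integrable setT (EFin \o hk t).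
Proof.
move=> t0; apply/integrableP; split; first exact/measurable_EFinP.
apply: (@le_lt_trans _ _ ((2 * pi) ^+ n * heat t 0)%:E); last by rewrite ltry.
apply: le_trans (hk_integral_le t0); rewrite le_eqVlt; apply/orP; left; apply/eqP.
by apply: eq_integral => z _ /=; rewrite ger0_norm ?hk_ge0.
Qed.

Lemma integrable_pker t x : 0 < t ->
  (lebesgue_rV n).-integrable setT (EFin \o (fun z => pker t (z - x))).
Proof.
move=> t0; have h : (lebesgue_rV n).-integrable setT (EFin \o pker t).
  have := integrableZl measurableT ((2 * pi) ^- n) (integrable_hk t0).
  by apply: eq_integrable.
have := integrable_affine_rV (- x) ltr01 h.
by apply: eq_integrable => // z _ /=; rewrite scale1r addrC.
Qed.

Lemma Rint_pker_cos0 t xi th : 0 < t ->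
  \int[lebesgue_rV n]_z (pker t z * cos (dotp z xi + th)) = heat t xi * cos th.
Proof.
move=> t0.
have ih := integrable_hk t0.
have ihc : (lebesgue_rV n).-integrable setT
    (EFin \o (fun z => hk t z * cos (dotp z xi + th))).
  apply: (integrable_dom measurableT (g := hk t)) => //; first by meas.
  move=> z _; rewrite normrM (ger0_norm (hk_ge0 _ t0)).
  by rewrite ler_piMr ?cos_norm_le1// hk_ge0.
have h1 := hk_cut (xi := xi) (th := th) t0.
have h2 : \int[lebesgue_rV n]_z (gauss_cut k z * (hk t z * cos (dotp z xi + th))) @[k --> \oo] -->
    \int[lebesgue_rV n]_z (hk t z * cos (dotp z xi + th)).
  apply: (@Rint_dct R _ _ (lebesgue_rV n) setT _ _ _ (hk t)) => //.
  - by move=> k; apply: measurable_funM; [exact: measurable_gauss_cut|meas].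
  - move=> z _; rewrite -[X in _ --> X]mul1r; apply: cvgMl; exact: gauss_cut_cvg.
  - move=> k z _; rewrite !normrM (ger0_norm (gauss_cut_ge0 _ _)) (ger0_norm (hk_ge0 _ t0)).
    rewrite mulrCA ler_piMr ?hk_ge0// mulr_ile1 ?gauss_cut_ge0 ?gauss_cut_le1//.
    exact: cos_norm_le1.
have E : \int[lebesgue_rV n]_z (hk t z * cos (dotp z xi + th)) =
    (2 * pi) ^+ n * (heat t xi * cos th) by exact: (cvg_unique _ h2 h1).
rewrite -[RHS]mul1r -(mulVf (lt0r_neq0 twopi_gt0)) -mulrA -E -RintegralZl//.
by apply: eq_Rintegral => z _; rewrite mulrA.
Qed.

(** Plane waves are eigenfunctions of the semigroup. *)
Lemma Rint_pker_cos t x xi th : 0 < t ->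
  \int[lebesgue_rV n]_z (pker t (z - x) * cos (dotp z xi + th)) =
  heat t xi * cos (dotp x xi + th).
Proof.
move=> t0.
rewrite (Rint_shift_rV x).
  rewrite -Rint_pker_cos0//; apply: eq_Rintegral => z _.
  by rewrite addrK dotpDl addrA.
apply: (integrable_dom measurableT (g := fun z => pker t (z - x))) => //.
- apply: measurable_funM; last by meas.
  by apply: measurable_pker; meas.
- exact: integrable_pker.
- move=> z _; rewrite normrM ger0_norm ?(ltW (pker_gt0 _ t0))//.
  by rewrite ler_piMr ?cos_norm_le1// ltW// pker_gt0.
Qed.

Lemma Rint_pker t x : 0 < t -> \int[lebesgue_rV n]_z pker t (z - x) = expR (- t).
Proof.
move=> t0; have := Rint_pker_cos x 0 0 t0.
rewrite dotp0r add0r cos0 mulr1 /heat /psi /lam dotp0r addr0 powR1 mulr1 => <-.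
by apply: eq_Rintegral => z _; rewrite dotp0r addr0 cos0 mulr1.
Qed.

(** The semigroup acts on a superposition of eigenfunctions term by term. *)
Lemma Rint_pker_superposition d (T : measurableType d)
    (m : {sigma_finite_measure set T -> \bar R}) (F : T -> 'rV[R]_n -> R)
    (e g : T -> R) t x : 0 < t ->
  measurable_fun setT (fun w => F w.1 w.2) -> m.-integrable setT (EFin \o g) ->
  (forall w z, `|F w z| <= g w) ->
  (forall w, \int[lebesgue_rV n]_z (pker t (z - x) * F w z) = e w * F w x) ->
  \int[lebesgue_rV n]_z (pker t (z - x) * \int[m]_w F w z) = \int[m]_w (e w * F w x).
Proof.
move=> t0 mF gi Fg eF.
have mFz z : measurable_fun setT (F^~ z) by apply: measurableT_comp mF (measurable_pair2 z).
transitivity (\int[lebesgue_rV n]_z \int[m]_w (pker t (z - x) * F w z)).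
  apply: eq_Rintegral => z _; rewrite RintegralZl//.
  by apply: (integrable_dom measurableT (g := g)).
rewrite (swap_Rint (f := fun z => pker t (z - x)) (g := g))//.
- by apply: eq_Rintegral => w _; exact: eF.
- apply: measurable_funM; first by apply: measurable_pker; meas.
  exact: (measurable_comp2 mF).
- exact: integrable_pker.
- move=> z w; rewrite normrM ger0_norm ?(ltW (pker_gt0 _ t0))//.
  by rewrite ler_wpM2l// ltW// pker_gt0.
Qed.

End kernel.

(** * Schrodinger perturbation of a nonnegative kernel *)
Lemma nneseries_recl0 (R : realType) (f : nat -> \bar R) : (forall i, 0 <= f i)%E ->
  (\sum_(i <oo) f i = f 0%N + \sum_(i <oo) f i.+1)%E.
Proof.
move=> f0; rewrite nneseries_recl//; congr (_ + _)%E.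
rewrite -(nneseries_addn 1)//; apply: eq_eseriesr => i _; by rewrite addn1.
Qed.

Lemma nneseriesZr_ereal (R : realType) (f : nat -> \bar R) (c : \bar R) :
  (forall i, 0 <= f i)%E -> (0 <= c)%E ->
  (\sum_(i <oo) (f i * c) = (\sum_(i <oo) f i) * c)%E.
Proof.
move=> f0 c0; rewrite -!ge0_integral_count//; last by move=> i; exact: mule_ge0.
by rewrite ge0_integralZr.
Qed.

Section perturbation.
Local Open Scope ereal_scope.
Context {R : realType} d (E : measurableType d).
Variable mu : {sigma_finite_measure set E -> \bar R}.
Variables (k : E -> E -> \bar R) (q : E -> \bar R).
Hypothesis mk : measurable_fun setT (fun w => k w.1 w.2).
Hypothesis k_ge0 : forall x y, 0 <= k x y.
Hypothesis mq : measurable_fun setT q.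
Hypothesis q_ge0 : forall x, 0 <= q x.

Lemma measurable_ecomp2 d' (T : measurableType d') (F : E -> E -> \bar R) (f g : T -> E) :
  measurable_fun setT (fun w => F w.1 w.2) ->
  measurable_fun setT f -> measurable_fun setT g ->
  measurable_fun setT (fun t => F (f t) (g t)).
Proof. by move=> mF mf mg; exact: (measurable_comp2 mF mf mg). Qed.

Lemma measurable_section (F : E -> E -> \bar R) x :
  measurable_fun setT (fun w => F w.1 w.2) -> measurable_fun setT (F x).
Proof. by move=> mF; apply: measurable_ecomp2. Qed.

Lemma measurable_section2 (F : E -> E -> \bar R) y :
  measurable_fun setT (fun w => F w.1 w.2) -> measurable_fun setT (fun x => F x y).
Proof. by move=> mF; apply: (measurable_ecomp2 mF). Qed.

Definition kop (F : E -> E -> \bar R) (f : E -> \bar R) x := \int[mu]_y (F x y * f y).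

Lemma kop_ge0 F f x : (forall x y, 0 <= F x y) -> (forall y, 0 <= f y) -> 0 <= kop F f x.
Proof. by move=> F0 f0; apply: integral_ge0 => y _; exact: mule_ge0. Qed.

Lemma measurable_kop F f : measurable_fun setT (fun w => F w.1 w.2) ->
  (forall x y, 0 <= F x y) -> measurable_fun setT f -> (forall y, 0 <= f y) ->
  measurable_fun setT (kop F f).
Proof.
move=> mF F0 mf f0.
apply: (@measurable_fun_fubini_tonelli_F _ _ E E R mu (fun w => F w.1 w.2 * f w.2)).
- by apply: emeasurable_funM => //; exact: (measurableT_comp mf).
- by move=> w; exact: mule_ge0.
Qed.

Lemma kopD F f g x : measurable_fun setT (fun w => F w.1 w.2) ->
  (forall x y, 0 <= F x y) -> measurable_fun setT f -> (forall y, 0 <= f y) ->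
  measurable_fun setT g -> (forall y, 0 <= g y) ->
  kop F (fun y => f y + g y) x = kop F f x + kop F g x.
Proof.
move=> mF F0 mf f0 mg g0.
have mFx := measurable_section x mF.
rewrite /kop -ge0_integralD//; last 4 first.
- by move=> y _; exact: mule_ge0.
- exact: emeasurable_funM.
- by move=> y _; exact: mule_ge0.
- exact: emeasurable_funM.
by apply: eq_integral => y _; rewrite ge0_muleDr.
Qed.

Lemma le_kop F f g x : measurable_fun setT (fun w => F w.1 w.2) ->
  (forall x y, 0 <= F x y) -> measurable_fun setT f -> (forall y, 0 <= f y) ->
  measurable_fun setT g -> (forall y, F x y != 0 -> f y <= g y) ->
  kop F f x <= kop F g x.
Proof.
move=> mF F0 mf f0 mg fg; have mFx := measurable_section x mF.
apply: ge0_le_integral => //.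
- by move=> y _; exact: mule_ge0.
- exact: emeasurable_funM.
- exact: emeasurable_funM.
move=> y _; have [->|Fy] := eqVneq (F x y) 0; first by rewrite !mul0e.
by apply: lee_wpmul2l => //; exact: fg.
Qed.

(** The terms of the perturbation series: [n] potential factors [q] between
    [n + 1] kernels. *)
Fixpoint kiter n : E -> E -> \bar R :=
  if n is m.+1 then fun x y => \int[mu]_z (k x z * (q z * kiter m z y)) else k.

Lemma kiter_ge0 n x y : 0 <= kiter n x y.
Proof.
elim: n x y => [//|n IH] x y /=; apply: integral_ge0 => z _.
by rewrite !mule_ge0.
Qed.

Lemma measurable_kiter_arg n : measurable_fun setT (fun w => kiter n w.1 w.2) ->
  measurable_fun setT (fun w : (E * E) * E => k w.1.1 w.2 * (q w.2 * kiter n w.2 w.1.2)).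
Proof.
move=> mn.
have m11 : measurable_fun setT (fun w : (E * E) * E => w.1.1).
  exact: measurableT_comp measurable_fst measurable_fst.
have m12 : measurable_fun setT (fun w : (E * E) * E => w.1.2).
  exact: measurableT_comp measurable_snd measurable_fst.
apply: emeasurable_funM; first exact: (measurable_ecomp2 mk m11 measurable_snd).
apply: emeasurable_funM; first exact: (measurableT_comp mq).
exact: (measurable_ecomp2 mn measurable_snd m12).
Qed.

Lemma measurable_kiter n : measurable_fun setT (fun w => kiter n w.1 w.2).
Proof.
elim: n => [//|n IH].
apply: (@measurable_fun_fubini_tonelli_F _ _ (E * E)%type E R mu
  (fun w => k w.1.1 w.2 * (q w.2 * kiter n w.2 w.1.2))).
- exact: measurable_kiter_arg.
- by move=> w; rewrite !mule_ge0// kiter_ge0.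
Qed.

Section nonneg.
Variable f : E -> \bar R.
Hypotheses (mf : measurable_fun setT f) (f_ge0 : forall y, 0 <= f y).

Lemma kop_kiterS n x : kop (kiter n.+1) f x = kop k (fun z => q z * kop (kiter n) f z) x.
Proof.
have mn := measurable_kiter n; have n0 := kiter_ge0 n.
transitivity (\int[mu]_y \int[mu]_z (k x z * (q z * kiter n z y) * f y)).
  apply: eq_integral => y _ /=; rewrite ge0_integralZr//.
  - apply: emeasurable_funM; first exact: measurable_section.
    by apply: emeasurable_funM => //; exact: measurable_section2.
  - by move=> z _; rewrite !mule_ge0.
rewrite (@fubini_tonelli _ _ E E R mu mu (fun w => k x w.2 * (q w.2 * kiter n w.2 w.1) * f w.1))//.
- apply: eq_integral => z _.
  rewrite /kop -ge0_integralZl//; last 2 first.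
  + by apply: emeasurable_funM => //; exact: measurable_section.
  + by move=> y _; exact: mule_ge0.
  rewrite -ge0_integralZl//; last 2 first.
  + apply: emeasurable_funM => //; apply: emeasurable_funM => //; exact: measurable_section.
  + by move=> y _; rewrite !mule_ge0.
  by apply: eq_integral => y _; rewrite !muleA.
- apply: emeasurable_funM; last exact: (measurableT_comp mf).
  apply: emeasurable_funM; first exact: (measurable_ecomp2 mk).
  apply: emeasurable_funM; first exact: (measurableT_comp mq).
  exact: (measurable_ecomp2 mn).
- by move=> w; rewrite !mule_ge0.
Qed.

End nonneg.

(** The recursion peels off the first kernel; peeling off the last one gives
    the same iterate. *)
Lemma kop_kiterSr n f x : measurable_fun setT f -> (forall y, 0 <= f y) ->
  kop (kiter n.+1) f x = kop (kiter n) (fun z => q z * kop k f z) x.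
Proof.
move=> mf f0.
have mg : measurable_fun setT (fun z => q z * kop k f z).
  by apply: emeasurable_funM => //; exact: measurable_kop.
have g0 z : 0 <= q z * kop k f z by apply: mule_ge0 => //; exact: kop_ge0.
elim: n x => [|n IH] x; first by rewrite kop_kiterS.
rewrite (kop_kiterS mf f0) [RHS](kop_kiterS mg g0); apply: eq_integral => z _.
by rewrite IH.
Qed.

Definition kpert x y := \sum_(n <oo) kiter n x y.

Lemma kpert_ge0 x y : 0 <= kpert x y.
Proof. by apply: nneseries_ge0 => n _ _; exact: kiter_ge0. Qed.

Lemma measurable_kpert : measurable_fun setT (fun w => kpert w.1 w.2).
Proof.
apply: (ge0_emeasurable_sum (h := fun n w => kiter n w.1 w.2) (P := xpredT)).
- by move=> n w _ _; exact: kiter_ge0.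
- by move=> n _; exact: measurable_kiter.
Qed.

Lemma kpert_ge x y : k x y <= kpert x y.
Proof.
rewrite /kpert (nneseries_recl0 (fun n => kiter_ge0 n x y)) leeDl//.
by apply: nneseries_ge0 => n _ _; exact: kiter_ge0.
Qed.

Lemma kop_kpert f x : measurable_fun setT f -> (forall y, 0 <= f y) ->
  kop kpert f x = \sum_(n <oo) kop (kiter n) f x.
Proof.
move=> mf f0; rewrite /kop -integral_nneseries//; last 2 first.
- move=> n; apply: emeasurable_funM => //; apply: measurable_section; exact: measurable_kiter.
- by move=> n y _; apply: mule_ge0 => //; exact: kiter_ge0.
apply: eq_integral => y _; rewrite /kpert -nneseriesZr_ereal// => n.
exact: kiter_ge0.
Qed.

(** Duhamel's formula, by summing the recursion that peels off the last kernel.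
    All terms are nonnegative, so it holds even when both sides are infinite. *)
Lemma kop_kpert_duhamel f x : measurable_fun setT f -> (forall y, 0 <= f y) ->
  kop kpert f x = kop k f x + kop kpert (fun z => q z * kop k f z) x.
Proof.
move=> mf f0.
have mg : measurable_fun setT (fun z => q z * kop k f z).
  by apply: emeasurable_funM => //; exact: measurable_kop.
have g0 z : 0 <= q z * kop k f z by apply: mule_ge0 => //; exact: kop_ge0.
rewrite !kop_kpert// nneseries_recl0; last first.
  by move=> n; apply: kop_ge0 => //; exact: kiter_ge0.
congr (_ + _).
by apply: eq_eseriesr => n _; rewrite kop_kiterSr.
Qed.

(** A supersolution [H] of [H = k (f + q H)] dominates every partial sum of the
    series, by induction on the number of terms. The set [D] lets the inequality
    fail where the kernel does not charge. *)
Lemma kop_kpert_le (D : set E) f H x : measurable_fun setT f -> (forall y, 0 <= f y) ->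
  measurable_fun setT H -> (forall y, 0 <= H y) ->
  (forall x y, ~ D y -> k x y = 0) ->
  (forall x, D x -> kop k (fun y => f y + q y * H y) x <= H x) ->
  D x -> kop kpert f x <= H x.
Proof.
move=> mf f0 mH H0 kD kH Dx.
have m0 n := @measurable_kop _ _ (measurable_kiter n) (kiter_ge0 n) mf f0.
have p0 n y : 0 <= kop (kiter n) f y by apply: kop_ge0 => //; exact: kiter_ge0.
have S N : forall y, D y -> \sum_(0 <= n < N) kop (kiter n) f y <= H y.
  elim: N => [|N IH] y Dy; first by rewrite big_geq.
  rewrite big_nat_recl//=; apply: le_trans (kH y Dy).
  have mS : measurable_fun setT (fun z => \sum_(0 <= n < N) kop (kiter n) f z).
    exact: emeasurable_sum.
  have S0 z : 0 <= \sum_(0 <= n < N) kop (kiter n) f z by apply: sume_ge0.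
  have -> : \sum_(0 <= n < N) kop (kiter n.+1) f y =
      kop k (fun z => q z * \sum_(0 <= n < N) kop (kiter n) f z) y.
    under eq_bigr do rewrite kop_kiterS//.
    rewrite -[LHS]ge0_integral_sum//; last 2 first.
    - move=> n; apply: emeasurable_funM; first exact: measurable_section.
      exact: emeasurable_funM.
    - by move=> n z _; rewrite !mule_ge0.
    apply: eq_integral => z _; rewrite ge0_sume_distrr// ge0_sume_distrr//.
    by move=> n _; rewrite mule_ge0.
  have mqS : measurable_fun setT (fun z => q z * \sum_(0 <= n < N) kop (kiter n) f z).
    exact: emeasurable_funM.
  rewrite [leLHS](_ : _ = kop k (fun y => f y + q y * \sum_(0 <= n < N) kop (kiter n) f y) y).
    apply: le_kop => //.
    - exact: emeasurable_funD.
    - by move=> z; rewrite adde_ge0// mule_ge0.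
    - apply: emeasurable_funD => //; exact: emeasurable_funM.
    move=> z kz; apply: leeD2l; apply: lee_wpmul2l => //; apply: IH.
    by apply: contrapT => Dz; rewrite kD// eqxx in kz.
  by rewrite kopD// => z; rewrite mule_ge0.
rewrite kop_kpert//; apply: lime_le; last by apply: nearW => N; exact: S.
by apply: is_cvg_nneseries => n _ _; exact: p0.
Qed.

Lemma kpert_invariant (tau : E -> E) :
  (forall g : E -> \bar R, measurable_fun setT g -> (forall x, 0 <= g x) ->
    \int[mu]_x g x = \int[mu]_x g (tau x)) ->
  (forall x y, k (tau x) (tau y) = k x y) -> (forall x, q (tau x) = q x) ->
  forall x y, kpert (tau x) (tau y) = kpert x y.
Proof.
move=> mtau ktau qtau x y; apply: eq_eseriesr => n _.
elim: n x y => [|n IH] x y /=; first exact: ktau.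
rewrite mtau.
- by apply: eq_integral => z _; rewrite ktau qtau IH.
- apply: emeasurable_funM; first exact: measurable_section.
  by apply: emeasurable_funM => //; apply: measurable_section2; exact: measurable_kiter.
- by move=> z; rewrite !mule_ge0// kiter_ge0.
Qed.

End perturbation.

(** * Gaussian mixtures and Bessel kernels *)
Lemma ge0_Rint_affine (R : realType) (b c : R) (f : R -> R) : 0 < c ->
  measurable_fun setT f -> (forall t, 0 <= f t) ->
  \int[lebesgue_measure]_t f t = c * \int[lebesgue_measure]_t f (b + c * t).
Proof.
move=> c0 mf f0; rewrite /Rintegral (@ge0_integral_affine R b c)//; last first.
  by apply: measurableT_comp.
case: (integral _ _ _) => [r| |] //=; first by rewrite mulr0 mulry gtr0_sg// mul1e.
by rewrite mulr0 mulrNy gtr0_sg// mul1e.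
Qed.

Lemma ge0_RintZl (R : realType) d (T : measurableType d) (m : {measure set T -> \bar R})
    (c : R) (f : T -> R) : 0 < c -> measurable_fun setT f -> (forall t, 0 <= f t) ->
  \int[m]_t (c * f t) = c * \int[m]_t f t.
Proof.
move=> c0 mf f0; rewrite /Rintegral.
under eq_integral do rewrite EFinM.
rewrite ge0_integralZl//=; last 3 first.
- exact/measurable_EFinP.
- by move=> t _; rewrite lee_fin.
- by rewrite lee_fin ltW.
case: (integral _ _ _) => [r| |] //=; first by rewrite mulr0 mulry gtr0_sg// mul1e.
by rewrite mulr0 mulrNy gtr0_sg// mul1e.
Qed.

Lemma integrable_expR (R : realType) (c : R) : 0 < c ->
  (@lebesgue_measure R).-integrable `]0, +oo[ (EFin \o (fun t => expR (- (c * t)))).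
Proof.
move=> c0; pose D : set (measurableTypeR R) := `]0, +oo[%classic.
have i1 : (@lebesgue_measure R).-integrable D (fun t => (c^-1)%:E * (exponential_pdf c t)%:E)%E.
  apply: integrableS (integrableZl measurableT c^-1 (integrable_exponential_pdf c0)).
  - exact: measurableT.
  - exact: measurable_itv.
  - exact: subsetT.
apply: eq_integrable i1; first exact: measurable_itv.
move=> t; rewrite inE /D/= in_itv/= andbT => t0.
rewrite /exponential_pdf patchE mem_setE in_itv/= (ltW t0)/= -EFinM mulrA mulVf ?mul1r ?mulNr//.
by rewrite gt_eqF.
Qed.

Lemma Rint_expR (R : realType) (c : R) : 0 < c ->
  \int[lebesgue_measure]_(t in `]0, +oo[) expR (- (c * t)) = c^-1.
Proof.
move=> c0; have i0 := integrable_expR c0.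
have mD : measurable (`]0, +oo[%classic : set (measurableTypeR R)) by exact: measurable_itv.
rewrite -[LHS]mul1r -[X in X * _ = _](mulVf (lt0r_neq0 c0)) -mulrA -RintegralZl//.
rewrite (_ : \int[_]_(t in _) _ = 1) ?mulr1//.
have -> : 1 = \int[lebesgue_measure]_t exponential_pdf c t :> R.
  by rewrite /Rintegral integral_exponential_pdf.
have i1 : (@lebesgue_measure R).-integrable (`]0, +oo[%classic : set (measurableTypeR R))
    (EFin \o (fun t => c * expR (- (c * t)))).
  exact: integrable_scalel.
rewrite (Rintegral_itv_obnd_cbnd i1) Rintegral_mkcond; apply: eq_Rintegral => t _.
by rewrite /exponential_pdf !patchE; case: ifP => //; rewrite mulNr.
Qed.

Section bessel.
Context {R : realType} {n : nat}.
Local Notation mu := (@lebesgue_measure R).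
Implicit Types (x z xi : 'rV[R]_n) (b r s u : R).
Local Notation pos := (`]0, +oo[%classic : set (measurableTypeR R)).

(** The transform of [exp (- r lam)]: the Gauss kernel at time [r], with the
    damping [exp (- r)]. *)
Definition gs r x : R :=
  Num.sqrt (pi / r) ^+ n * expR (- r) * expR (- (dotp x x / (4 * r))).

Lemma gs_ge0 r x : 0 <= gs r x.
Proof. by rewrite !mulr_ge0 ?expR_ge0// exprn_ge0 ?sqrtr_ge0. Qed.

Lemma Rint_gs r x : 0 < r ->
  \int[lebesgue_rV n]_xi (expR (- (r * lam xi)) * cos (dotp xi x)) = gs r x.
Proof.
move=> r0; have := Rint_gauss_scaled x 0 r0; rewrite cos0 mulr1 => h.
rewrite /gs mulrAC -h mulrC -RintegralZl//; last exact: integrable_gauss_scaled_cos.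
by apply: eq_Rintegral => xi _; rewrite addr0 mulrA -expRD /lam;
  congr (expR _ * _); ring.
Qed.

(** The power of [1 / r] is absorbed by the exponential. *)
Lemma gauss_kernel_bound c : 0 < c -> exists C : R, 0 <= C /\
  forall r, 0 < r -> Num.sqrt (pi / r) ^+ n * expR (- (c / r)) <= C.
Proof.
move=> c0; exists (1 + (pi / c) ^+ n * n`!%:R); split.
  by rewrite addr_ge0// mulr_ge0 ?exprn_ge0 ?divr_ge0 ?pi_ge0 ?ltW.
move=> r r0; pose w := pi / r.
have w0 : 0 < w by rewrite divr_gt0// pi_gt0.
have e1 : expR (- (c / r)) <= 1 by rewrite -expR0 ler_expR oppr_le0 divr_ge0 ?ltW.
have -> : Num.sqrt (pi / r) = Num.sqrt w by [].
have [w1|w1] := leP w 1.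
  have s1 : Num.sqrt w <= 1 by rewrite -sqrtr1 ler_sqrt// ltW.
  rewrite (@le_trans _ _ 1)// ?lerDl ?mulr_ge0 ?exprn_ge0 ?divr_ge0 ?pi_ge0 ?(ltW c0)//.
  by rewrite mulr_ile1 ?expR_ge0 ?exprn_ge0 ?sqrtr_ge0// exprn_ile1 ?sqrtr_ge0.
have sw : Num.sqrt w <= w.
  rewrite -[leRHS]ger0_norm ?(ltW w0)// -sqrtr_sqr ler_sqrt ?sqr_ge0//.
  by rewrite expr2 ler_peMr// ltW.
apply: (@le_trans _ _ ((pi / c) ^+ n * n`!%:R)); last by rewrite lerDr.
apply: (@le_trans _ _ (w ^+ n * expR (- (c / r)))).
  by rewrite ler_wpM2r ?expR_ge0// lerXn2r ?nnegrE ?sqrtr_ge0// ltW.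
have -> : w = pi / c * (c / r) by rewrite /w; field; rewrite !gt_eqF.
rewrite exprMn -mulrA ler_wpM2l ?exprn_ge0 ?divr_ge0 ?pi_ge0 ?(ltW c0)//.
rewrite expRN ler_pdivrMr ?expR_gt0//; apply: expr_le_fact_expR.
by rewrite divr_ge0 ?ltW.
Qed.

Lemma measurable_gs d (T : measurableType d) (f : T -> R) (g : T -> 'rV[R]_n) :
  (forall t, 0 <= f t) ->
  measurable_fun setT f -> measurable_fun setT g -> measurable_fun setT (fun t => gs (f t) (g t)).
Proof.
move=> f0 mf mg; rewrite /gs.
have mif : measurable_fun setT (fun t => (f t)^-1) by exact: measurable_invf.
have mi4 : measurable_fun setT (fun t => (4 * f t)^-1).
  apply: measurable_invf; first by move=> t; rewrite mulr_ge0.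
  by meas.
apply: measurable_funM; last by meas.
apply: measurable_funM; last by meas.
apply: measurable_funX; apply: (measurableT_comp (continuous_measurable_fun (@sqrt_continuous R))).
by meas.
Qed.

(** The transform of [exp (- s lam) lam ^ (- b)]. At [s = 0] it is, up to a
    constant and a power of [|x|], a modified Bessel function; a positive [s]
    smooths its singularity at the origin. *)
Definition bes b s x : R :=
  (Gamma b)^-1 * \int[mu]_(u in `]0, +oo[) (u `^ (b - 1) * gs (u + s) x).

Let mpos : measurable pos. Proof. exact: measurable_itv. Qed.

Let posP u : pos u -> 0 < u. Proof. by rewrite /= in_itv/= andbT. Qed.

Lemma subset12_pos : `]1, 2]%classic `<=` pos.
Proof. by move=> r /=; rewrite !in_itv/= andbT => /andP[r1 _]; rewrite (lt_trans ltr01). Qed.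

Lemma half_le_powR b r : 0 < b -> 1 < r -> r <= 2 -> 2^-1 <= r `^ (b - 1).
Proof.
move=> b0 r1 r2; have r0 : 0 < r by rewrite (lt_trans ltr01).
rewrite powRD ?(gt_eqF r0) ?implybT// powRN powRr1 ?(ltW r0)//.
have e1 : (1 : R) `^ b = 1 by rewrite powR1.
apply: (@le_trans _ _ (1 * r^-1)); first by rewrite mul1r lef_pV2 ?posrE.
by rewrite ler_wpM2r ?invr_ge0 ?(ltW r0)// -[leLHS]e1 ge0_ler_powR ?nnegrE ?ltW.
Qed.

Lemma Gamma_gt0 b : 0 < b -> 0 < Gamma b.
Proof.
move=> b0; apply: (@lt_le_trans _ _ (expR (- 2) / 2)); first by rewrite divr_gt0 ?expR_gt0.
apply: Rint_ge_on12 => //; first exact: subset12_pos.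
- exact: integrable_Gamma.
- by move=> r _; rewrite mulr_ge0 ?powR_ge0 ?expR_ge0.
move=> r r1 r2; rewrite mulrC ler_pM ?invr_ge0 ?expR_ge0 ?half_le_powR//.
by rewrite ler_expR lerN2.
Qed.

Lemma bes_ge0 b s x : 0 < b -> 0 <= bes b s x.
Proof.
move=> b0; rewrite mulr_ge0 ?invr_ge0 ?(ltW (Gamma_gt0 b0))//.
by apply: Rintegral_ge0 => u _; rewrite mulr_ge0 ?powR_ge0 ?gs_ge0.
Qed.

Lemma measurable_bes_arg b s : measurable_fun setT
  (fun w : 'rV[R]_n * measurableTypeR R => w.2 `^ (b - 1) * gs (`|w.2 + s|) w.1).
Proof.
apply: measurable_funM; first by meas.
by apply: measurable_gs => //; meas.
Qed.

Lemma besE_abs b s x : 0 <= s -> bes b s x = (Gamma b)^-1 *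
  \int[mu]_u (u `^ (b - 1) * gs (`|u + s|) x * \1_pos u).
Proof.
move=> s0; rewrite /bes Rint_indic; congr (_ * _); apply: eq_Rintegral => u _.
rewrite indicE mem_setE in_itv/= andbT; have [u0|u0] := ltP 0 u; last by rewrite !mulr0.
by rewrite ger0_norm// addr_ge0// ltW.
Qed.

Lemma measurable_bes b s : 0 <= s -> measurable_fun setT (bes b s).
Proof.
move=> s0; have -> : bes b s = fun x => (Gamma b)^-1 *
    \int[mu]_u (u `^ (b - 1) * gs (`|u + s|) x * \1_pos u).
  by apply/funext => x; exact: besE_abs.
apply: measurable_funM; first exact: measurable_cst.
apply: (@measurable_Rint R _ _ 'rV[R]_n (measurableTypeR R) mu
  (fun x u => u `^ (b - 1) * gs (`|u + s|) x * \1_pos u)).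
apply: measurable_funM; first exact: measurable_bes_arg.
by apply: (@measurableT_comp _ _ _ _ _ _ (\1_pos : measurableTypeR R -> R)).
Qed.

Lemma bes_integrand_le x : x != 0 -> exists C : R, 0 <= C /\
  forall b s u, 0 <= s -> 0 < u ->
    `|u `^ (b - 1) * gs (u + s) x| <= C * (u `^ (b - 1) * expR (- u)).
Proof.
move=> x0; have c0 : 0 < dotp x x / 4 by rewrite divr_gt0// dotp_gt0.
have [C [C0 hC]] := gauss_kernel_bound c0; exists C; split=> // b s u s0 u0.
have us0 : 0 < u + s by rewrite ltr_wpDr.
rewrite ger0_norm ?mulr_ge0 ?powR_ge0 ?gs_ge0// [leRHS]mulrCA ler_wpM2l ?powR_ge0//.
rewrite /gs mulrAC ler_pM ?mulr_ge0 ?exprn_ge0 ?sqrtr_ge0 ?expR_ge0//.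
  by rewrite invfM mulrA; exact: hC.
by rewrite ler_expR lerN2 lerDl.
Qed.

Lemma measurable_bes_section b s x : 0 <= s ->
  measurable_fun pos (fun u : measurableTypeR R => u `^ (b - 1) * gs (u + s) x).
Proof.
move=> s0.
apply: (eq_measurable_fun (fun u : measurableTypeR R => u `^ (b - 1) * gs `|u + s| x)).
  by move=> u; rewrite inE => /posP u0; rewrite ger0_norm// addr_ge0// ltW.
apply: measurable_funTS; apply: measurable_funM; first by meas.
by apply: measurable_gs => //; meas.
Qed.

Lemma integrable_bes b s x : 0 < b -> 0 <= s -> x != 0 ->
  mu.-integrable pos (EFin \o (fun u => u `^ (b - 1) * gs (u + s) x)).
Proof.
move=> b0 s0 x0; have [C [C0 hC]] := bes_integrand_le x0.
apply: (@integrable_dom R _ _ mu pos _ _ (fun u => C * (u `^ (b - 1) * expR (- u)))) => //.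
- exact: measurable_bes_section.
- by apply: integrable_scalel => //; exact: integrable_Gamma.
- by move=> u /posP u0; exact: hC.
Qed.

Lemma Rint_bes b s x : 0 < b ->
  \int[mu]_(u in `]0, +oo[) (u `^ (b - 1) * gs (u + s) x) = Gamma b * bes b s x.
Proof.
rewrite /bes => /Gamma_gt0; move: (Gamma b) (\int[_]_(_ in _) _) => g I g0.
by rewrite mulVKf// gt_eqF.
Qed.

(** Off the origin the Gaussian factor dominates the integrand uniformly in
    the smoothing. *)
Lemma bes_cvg b x : 0 < b -> x != 0 ->
  bes b k.+1%:R^-1 x @[k --> \oo] --> bes b 0 x.
Proof.
move=> b0 x0; apply: cvgMr; have [C [C0 hC]] := bes_integrand_le x0.
have s0 (k : nat) : 0 <= (k.+1%:R : R)^-1 by rewrite invr_ge0.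
apply: (@Rint_dct R _ _ mu pos _ _ _ (fun u => C * (u `^ (b - 1) * expR (- u)))) => //.
- by move=> k; exact: measurable_bes_section.
- move=> u /posP u0; apply: cvgMr; rewrite addr0.
  have h : (u + (k.+1%:R : R)^-1) @[k --> \oo] --> u.
    rewrite -[X in _ --> X]addr0; apply: cvgD; first exact: cvg_cst.
    exact: (@cvg_harmonic R).
  suff cg : {for u, continuous (fun r : R => gs r x)} by exact: (cvg_comp _ _ h cg).
  have cs : {for u, continuous (fun r : R => pi / r)}.
    by apply: cvgMr; apply: cvgV => //; rewrite gt_eqF.
  rewrite /gs; apply: cvgM; first apply: cvgM.
  + apply: (@continuous_comp _ _ _ (fun r : R => Num.sqrt (pi / r)) (fun y : R => y ^+ n) u).
      apply: (@continuous_comp _ _ _ (fun r : R => pi / r) Num.sqrt u) => //.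
      exact: sqrt_continuous.
    exact: exprn_continuous.
  + apply: (@continuous_comp _ _ _ (fun r : R => - r) expR u); last exact: continuous_expR.
    exact: opp_continuous.
  + apply: (@continuous_comp _ _ _ (fun r : R => - (dotp x x / (4 * r))) expR u); last exact: continuous_expR.
    apply: cvgN; apply: cvgMr; apply: cvgV; first by rewrite mulf_neq0// gt_eqF.
    by apply: cvgMr.
- by apply: integrable_scalel => //; exact: integrable_Gamma.
- by move=> k u /posP u0; exact: hC.
Qed.

Lemma Rint_Gamma_scale (b l : R) : 0 < b -> 0 < l ->
  \int[mu]_(u in `]0, +oo[) (u `^ (b - 1) * expR (- (u * l))) = l `^ (- b) * Gamma b.
Proof.
move=> b0 l0; rewrite /Gamma [LHS]Rint_indic [X in _ = _ * X]Rint_indic.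
rewrite (@ge0_Rint_affine R 0 l (fun t => t `^ (b - 1) * expR (- t) * \1_pos t))//; last 2 first.
- by apply: measurable_funM; [meas|exact: measurable_indic].
- by move=> t; rewrite !mulr_ge0 ?powR_ge0 ?expR_ge0.
have e : l `^ (- b) * (l * l `^ (b - 1)) = 1.
  rewrite -[X in _ * (X * _)]powRr1 ?(ltW l0)// -!powRD ?(gt_eqF l0) ?implybT//.
  by rewrite (_ : - b + _ = 0) ?powRr0//; ring.
pose f (u : R) := u `^ (b - 1) * expR (- (u * l)) * \1_pos u.
have -> : (fun t : R => (0 + l * t) `^ (b - 1) * expR (- (0 + l * t)) * \1_pos (0 + l * t)) =
    fun t => l `^ (b - 1) * f t.
  apply/funext => t; rewrite /f add0r !indicE !mem_setE !in_itv/= !andbT pmulr_rgt0//.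
  have [t0|t0] := ltP 0 t; last by rewrite !mulr0.
  by rewrite powRM ?(ltW l0) ?(ltW t0)// (mulrC t l) !mulrA.
rewrite ge0_RintZl ?powR_gt0//; last 2 first.
- by apply: measurable_funM; [meas|exact: measurable_indic].
- by move=> t; rewrite /f !mulr_ge0 ?powR_ge0 ?expR_ge0.
by rewrite !mulrA -(mulrA _ l) e mul1r.
Qed.

Lemma powRN_lam_le1 b xi : 0 <= b -> lam xi `^ (- b) <= 1.
Proof.
move=> b0; rewrite powRN invf_le1 ?powR_gt0 ?lam_gt0//.
rewrite -[leLHS](_ : 1 `^ b = 1); last by rewrite powR1.
apply: ge0_ler_powR; rewrite ?nnegrE//; first exact: ltW (lam_gt0 xi).
exact: lam_ge1.
Qed.

Lemma bes_multiplier_dom b s xi x : 0 <= b ->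
  `|expR (- (s * lam xi)) * lam xi `^ (- b) * cos (dotp xi x)| <= expR (- (s * lam xi)).
Proof.
move=> b0; rewrite 2!normrM (ger0_norm (expR_ge0 _)) (ger0_norm (powR_ge0 _ _)) -mulrA.
by rewrite ler_piMr ?expR_ge0// mulr_ile1 ?powR_ge0 ?powRN_lam_le1 ?cos_norm_le1.
Qed.

Lemma integrable_bes_multiplier b s x : 0 <= b -> 0 < s ->
  (lebesgue_rV n).-integrable setT
    (EFin \o (fun xi => expR (- (s * lam xi)) * lam xi `^ (- b) * cos (dotp xi x))).
Proof.
move=> b0 s0; apply: (integrable_dom measurableT (g := fun xi => expR (- (s * lam xi)))) => //.
- by meas; apply: measurable_lam; meas.
- exact: integrable_exp_lam.
- by move=> xi _; exact: bes_multiplier_dom.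
Qed.

(** Exchange the integral defining the kernel with the Gaussian transform and
    evaluate the inner Gamma integral. *)
Lemma besE b s x : 0 < b -> 0 < s -> bes b s x =
  \int[lebesgue_rV n]_xi (expR (- (s * lam xi)) * lam xi `^ (- b) * cos (dotp xi x)).
Proof.
move=> b0 s0.
pose w u : R := u `^ (b - 1) * \1_pos u.
pose F u xi := w u * (expR (- ((u + s) * lam xi)) * cos (dotp xi x)).
have w0 u : 0 <= w u by rewrite mulr_ge0 ?powR_ge0.
have wP u : u <= 0 -> w u = 0.
  by move=> u0; rewrite /w indicE mem_setE in_itv/= andbT ltNge u0 mulr0.
have mw : measurable_fun setT (w : measurableTypeR R -> R).
  by apply: measurable_funM; [meas|exact: measurable_indic].
have iw : mu.-integrable setT (EFin \o (fun u => w u * expR (- u))).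
  have := (integrable_indicP _ mpos).1 (integrable_Gamma b0).
  by apply: eq_integrable => // u _ /=; rewrite /w mulrAC.
have mF : measurable_fun setT (fun p : measurableTypeR R * 'rV[R]_n => F p.1 p.2).
  apply: measurable_funM; first exact: (measurableT_comp mw).
  by meas; apply: measurable_lam; meas.
have Fdom u xi : `|F u xi| <= (w u * expR (- u)) * expR (- (s * lam xi)).
  have [u0|u0] := leP u 0; first by rewrite /F wP// !mul0r normr0.
  have -> : `|F u xi| = w u * `|expR (- ((u + s) * lam xi)) * cos (dotp xi x)|.
    by rewrite /F normrM (ger0_norm (w0 u)).
  rewrite -[leRHS]mulrA ler_wpM2l// normrM (ger0_norm (expR_ge0 _)).
  rewrite -[leRHS]mulr1 ler_pM ?expR_ge0 ?cos_norm_le1//.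
  rewrite -expRD ler_expR mulrDl opprD lerD2r lerN2 ler_peMr ?lam_ge1//.
  exact: ltW.
have E : \int[mu]_(u in `]0, +oo[) (u `^ (b - 1) * gs (u + s) x) = \int[mu]_u \int[lebesgue_rV n]_xi F u xi.
  rewrite Rint_indic; apply: eq_Rintegral => u _; rewrite mulrAC -/(w u).
  have [u0|u0] := leP u 0.
    rewrite wP// mul0r; under eq_Rintegral do rewrite /F wP// mul0r.
    by rewrite Rintegral_cst// mul0r.
  have us : 0 < u + s by rewrite addr_gt0.
  rewrite -Rint_gs// -RintegralZl//.
  apply: (integrable_dom measurableT (g := fun xi => expR (- ((u + s) * lam xi)))) => //.
  - by meas; apply: measurable_lam; meas.
  - exact: integrable_exp_lam.
  - move=> xi _; rewrite normrM (ger0_norm (expR_ge0 _)) ler_piMr ?expR_ge0//.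
    exact: cos_norm_le1.
rewrite /bes E (swap_Rint mF iw (integrable_exp_lam s0) Fdom).
have G0 := Gamma_gt0 b0.
have -> : \int[lebesgue_rV n]_xi \int[mu]_u F u xi = \int[lebesgue_rV n]_xi (Gamma b *
    (expR (- (s * lam xi)) * lam xi `^ (- b) * cos (dotp xi x))).
  apply: eq_Rintegral => xi _.
  transitivity (\int[mu]_u ((expR (- (s * lam xi)) * cos (dotp xi x)) *
      (u `^ (b - 1) * expR (- (u * lam xi)) * \1_pos u))).
    apply: eq_Rintegral => u _; rewrite /F /w mulrDl opprD expRD.
    by ring.
  rewrite RintegralZl//; last first.
    apply: (@integrable_dom R _ _ mu setT _ _ (fun u => w u * expR (- u))) => //.
      by apply: measurable_funM; [meas|exact: measurable_indic].
    move=> u _; rewrite mulrAC -/(w u) (ger0_norm (mulr_ge0 (w0 u) (expR_ge0 _))).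
    have [u0|u0] := leP u 0; first by rewrite wP// !mul0r.
    rewrite ler_wpM2l// ler_expR lerN2 ler_peMr ?lam_ge1//.
    exact: ltW.
  rewrite -Rint_indic Rint_Gamma_scale ?lam_gt0//.
  by ring.
rewrite RintegralZl//; last exact: integrable_bes_multiplier (ltW b0) s0.
by rewrite mulrA mulVf ?mul1r// gt_eqF.
Qed.

End bessel.

(** * The resolvent identity *)
Lemma lebesgue_rV_set0 (R : realType) n : (0 < n)%N ->
  lebesgue_rV n [set (0 : 'rV[R]_n)] = 0%E.
Proof.
move=> n0; have -> : [set (0 : 'rV[R]_n)] = [set v | forall i, [set (0 : R)] (v 0 i)].
  apply/seteqP; split=> [v /= -> i|v /= h]; first by rewrite mxE.
  by apply/rowP => i; rewrite mxE; exact: h.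
rewrite (@lebesgue_rV_setX R n (fun=> [set 0])); last by move=> i; exact: measurable_set1.
case: n n0 => // m _; rewrite big_ord_recl [X in (X * _)%E](@lebesgue_measure_set1 R).
by rewrite mul0e.
Qed.

(** The potential is singular at the origin. Kernels carry this indicator of the
    punctured space, so that they never see the value of a function there. *)
Definition nz (R : realType) n (z : 'rV[R]_n) : R := (z != 0)%:R.

Lemma nz_ge0 (R : realType) n (z : 'rV[R]_n) : 0 <= nz z.
Proof. by rewrite /nz ler0n. Qed.

Lemma nz_le1 (R : realType) n (z : 'rV[R]_n) : nz z <= 1.
Proof. by rewrite /nz; case: (_ != _). Qed.

Lemma measurable_nz_set (R : realType) n : measurable [set z : 'rV[R]_n | z != 0].
Proof.
have -> : [set z : 'rV[R]_n | z != 0] = (fun z => dotp z z) @^-1` `]0, +oo[.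
  apply/seteqP; split=> z /=; rewrite in_itv/= andbT; first exact: dotp_gt0.
  by move=> h; rewrite -dotp_eq0 gt_eqF.
rewrite -[X in measurable X]setTI.
have h : measurable_fun setT (fun z : 'rV[R]_n => dotp z z) by meas.
by apply: h => //; exact: measurable_itv.
Qed.

Lemma nzE (R : realType) n (z : 'rV[R]_n) : nz z = \1_[set z : 'rV[R]_n | z != 0] z.
Proof. by rewrite /nz indicE; case E: (z != 0); [rewrite mem_set|rewrite memNset//= E]. Qed.

Lemma measurable_nz (R : realType) n d (T : measurableType d) (f : T -> 'rV[R]_n) :
  measurable_fun setT f -> measurable_fun setT (fun t => nz (f t)).
Proof.
move=> mf; under [X in measurable_fun _ X]eq_fun do rewrite nzE.
apply: (measurableT_comp _ mf); apply: measurable_indic; exact: measurable_nz_set.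
Qed.

Lemma ge0_integral_nz (R : realType) n (f : 'rV[R]_n -> R) : (0 < n)%N ->
  measurable_fun setT f -> (forall z, 0 <= f z) ->
  (\int[lebesgue_rV n]_z (f z * nz z)%:E = \int[lebesgue_rV n]_z (f z)%:E)%E.
Proof.
move=> n0 mf f0; apply: ae_eq_integral => //.
- by apply/measurable_EFinP; apply: measurable_funM => //; apply: measurable_nz; meas.
- exact/measurable_EFinP.
exists [set 0]; split; first 2 last.
- move=> z /= h; apply/eqP/negPn/negP => z0; apply: h => _.
  by rewrite /nz z0 mulr1.
- by have := measurableC (@measurable_nz_set R n); congr measurable; apply/seteqP; split => z /=;
    [move=> /negP; rewrite negbK => /eqP|move=> ->; rewrite eqxx].
- exact: lebesgue_rV_set0.
Qed.

Section resolvent.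
Context {R : realType} {n : nat}.
Local Notation mu := (@lebesgue_measure R).
Local Notation pos := (`]0, +oo[%classic : set (measurableTypeR R)).
Implicit Types (x z xi : 'rV[R]_n) (t s : R).
Variables (a b kap : R).
Hypotheses (a_gt0 : 0 < a) (a_lt1 : a < 1) (b_gt0 : 0 < b) (kap_gt0 : 0 < kap).
Local Notation pker := (@pker R n a).
Local Notation hb := (@bes R n (b + a)).
Local Notation hb' := (@bes R n b).

Let ba_gt0 : 0 < b + a. Proof. exact: addr_gt0. Qed.

Let posP t : pos t -> 0 < t. Proof. by rewrite /= in_itv/= andbT. Qed.

Let mpos : measurable pos. Proof. exact: measurable_itv. Qed.

Lemma bes_mix_multiplier s z : 0 < s -> hb' s z + kap * hb s z =
  \int[lebesgue_rV n]_xi (expR (- (s * lam xi)) *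
    (lam xi `^ (- b) + kap * lam xi `^ (- (b + a))) * cos (dotp z xi)).
Proof.
move=> s0; rewrite !besE// -RintegralZl//; last first.
  exact: integrable_bes_multiplier (ltW ba_gt0) s0.
rewrite -RintegralD//; last 2 first.
- exact: integrable_bes_multiplier (ltW b_gt0) s0.
- by apply: integrable_scalel => //; exact: integrable_bes_multiplier (ltW ba_gt0) s0.
by apply: eq_Rintegral => xi _; rewrite (dotpC z); ring.
Qed.

(** On the side of the multipliers this is
    [lam ^ (- b) + kap lam ^ (- b - a) = (kap + psi) lam ^ (- b - a)] together
    with [(kap + psi) ^ (- 1)] as the integral of [exp (- (kap + psi) t)]. The
    smoothing [s > 0] makes all the integrals absolutely convergent. *)
Lemma bes_resolvent s x : 0 < s ->
  \int[mu]_(t in `]0, +oo[) (expR (- (kap * t)) *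
     \int[lebesgue_rV n]_z (pker t (z - x) * (hb' s z + kap * hb s z))) = hb s x.
Proof.
move=> s0.
pose w xi := expR (- (s * lam xi)) * (lam xi `^ (- b) + kap * lam xi `^ (- (b + a))).
pose g xi := (1 + kap) * expR (- (s * lam xi)).
have w0 xi : 0 <= w xi.
  by rewrite mulr_ge0 ?expR_ge0// addr_ge0 ?mulr_ge0 ?powR_ge0 ?ltW.
have wg xi : w xi <= g xi.
  rewrite /w /g mulrC ler_wpM2r ?expR_ge0// lerD ?powRN_lam_le1 ?(ltW b_gt0)//.
  by rewrite ler_piMr ?(ltW kap_gt0)// powRN_lam_le1// ltW.
have mw d (T : measurableType d) (f : T -> 'rV[R]_n) : measurable_fun setT f ->
    measurable_fun setT (fun y => w (f y)).
  by move=> mf; rewrite /w; meas; exact: measurable_lam.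
have ig : (lebesgue_rV n).-integrable setT (EFin \o g).
  by apply: integrable_scalel => //; exact: integrable_exp_lam.
have wcos xi z : `|w xi * cos (dotp z xi)| <= g xi.
  by rewrite normrM (ger0_norm (w0 xi)) (le_trans _ (wg xi))// ler_piMr// cos_norm_le1.
have inner t : 0 < t -> \int[lebesgue_rV n]_z (pker t (z - x) * (hb' s z + kap * hb s z)) =
    \int[lebesgue_rV n]_xi (heat a t xi * (w xi * cos (dotp x xi))).
  move=> t0; under eq_Rintegral do rewrite bes_mix_multiplier//.
  have h := @Rint_pker_superposition R n a a_gt0 a_lt1 _ 'rV[R]_n (lebesgue_rV n)
    (fun xi z => w xi * cos (dotp z xi)) (heat a t) g t x t0.
  apply: h; [|exact: ig|exact: wcos|].
    by apply: measurable_funM; [apply: mw; meas|meas].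
  move=> xi; transitivity (w xi * \int[lebesgue_rV n]_z (pker t (z - x) * cos (dotp z xi + 0))).
    rewrite -RintegralZl//; first by apply: eq_Rintegral => z _; rewrite addr0 mulrCA.
    apply: (integrable_dom measurableT (g := fun z => pker t (z - x))) => //.
    + by apply: measurable_funM; [apply: measurable_pker; meas|meas].
    + exact: integrable_pker.
    + move=> z _; have p0 := pker_gt0 a_gt0 a_lt1 (z - x) t0.
      by rewrite normrM (ger0_norm (ltW p0)) ler_piMr ?cos_norm_le1// ltW.
  by rewrite Rint_pker_cos// addr0 mulrCA.
pose G t xi := (expR (- (kap * t)) * \1_pos t) * (heat a t xi * (w xi * cos (dotp x xi))).
have mG : measurable_fun setT (fun p : measurableTypeR R * 'rV[R]_n => G p.1 p.2).
  apply: measurable_funM.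
    apply: measurable_funM; first by meas.
    by apply: (@measurableT_comp _ _ _ _ _ _ (\1_pos : measurableTypeR R -> R)).
  apply: measurable_funM; first by apply: measurable_heat; meas.
  by apply: measurable_funM; [apply: mw; meas|meas].
have i1 := integrable_expR kap_gt0.
have i2 := (integrable_indicP _ mpos).1 i1.
have Gdom t xi : `|G t xi| <= (expR (- (kap * t)) * \1_pos t) * g xi.
  have [t0|t0] := leP t 0.
    by rewrite /G indicE mem_setE in_itv/= andbT ltNge t0 /= mulr0 !mul0r normr0.
  have p0 : 0 <= expR (- (kap * t)) * \1_pos t by rewrite mulr_ge0 ?expR_ge0.
  have -> : `|G t xi| = (expR (- (kap * t)) * \1_pos t) * `|heat a t xi * (w xi * cos (dotp x xi))|.
    by rewrite /G normrM (ger0_norm p0).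
  rewrite ler_wpM2l// normrM (ger0_norm (ltW (heat_gt0 _ _ _))) (le_trans _ (wcos xi x))//.
  by rewrite ler_piMl// heat_le1// ltW.
transitivity (\int[mu]_t \int[lebesgue_rV n]_xi G t xi).
  rewrite Rint_indic; apply: eq_Rintegral => t _.
  have [t0|t0] := leP t 0.
    rewrite indicE mem_setE in_itv/= andbT ltNge t0 /= mulr0.
    under eq_Rintegral do rewrite /G indicE mem_setE in_itv/= andbT ltNge t0 /= mulr0 mul0r.
    by rewrite Rintegral_cst// mul0r.
  rewrite inner// mulrAC -RintegralZl//.
  apply: (integrable_dom measurableT (g := g)) => //.
    by apply: measurable_funM; [apply: measurable_heat; meas|apply: measurable_funM; [apply: mw; meas|meas]].
  move=> xi _; rewrite normrM (ger0_norm (ltW (heat_gt0 _ _ _))) (le_trans _ (wcos xi x))//.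
  by rewrite ler_piMl// heat_le1// ltW.
rewrite (swap_Rint mG i2 ig Gdom) besE//.
apply: eq_Rintegral => xi _.
transitivity ((w xi * cos (dotp x xi)) * \int[mu]_(t in `]0, +oo[) expR (- ((kap + psi a xi) * t))).
  rewrite Rint_indic -RintegralZl//.
    by apply: eq_Rintegral => t _; rewrite /G /heat mulrDl opprD expRD (mulrC t); ring.
  apply: (@integrable_dom R _ _ mu setT measurableT _ _ _ i2).
    by apply: measurable_funM; [meas|exact: measurable_indic].
  move=> t _; rewrite indicE mem_setE in_itv/= andbT.
  have [t0|t0] := ltP 0 t; last by rewrite !mulr0 normr0.
  rewrite !mulr1 ger0_norm ?expR_ge0// ler_expR lerN2 ler_wpM2r ?(ltW t0)//.
  by rewrite lerDl ltW// psi_gt0.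
have l0 := lam_gt0 xi.
have p0 : 0 < kap + psi a xi by rewrite addr_gt0// psi_gt0.
rewrite Rint_expR// /w (_ : lam xi `^ (- b) = lam xi `^ (- (b + a)) * psi a xi); last first.
  by rewrite /psi -powRD ?(gt_eqF l0) ?implybT//; congr (_ `^ _); ring.
by rewrite (dotpC x); field; rewrite gt_eqF.
Qed.

End resolvent.

(** * The resolvent operator *)
Section resolvent_operator.
Context {R : realType} {n : nat}.
Local Notation mu := (@lebesgue_measure R).
Local Notation pos := (`]0, +oo[%classic : set (measurableTypeR R)).
Implicit Types (x z xi : 'rV[R]_n) (t s c b : R) (f : 'rV[R]_n -> R).
Variables (a kap : R).
Hypotheses (a_gt0 : 0 < a) (a_lt1 : a < 1) (kap_gt0 : 0 < kap).
Local Notation pker := (@pker R n a).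

Let posP t : pos t -> 0 < t. Proof. by rewrite /= in_itv/= andbT. Qed.

Let mpos : measurable pos. Proof. exact: measurable_itv. Qed.

(** The resolvent kernel before the integration in time. *)
Definition rker x (w : measurableTypeR R * 'rV[R]_n) : R :=
  expR (- (kap * w.1)) * \1_pos w.1 * (pker w.1 (w.2 - x) * nz w.2).

Lemma rker0 x t z : t <= 0 -> rker x (t, z) = 0.
Proof. by move=> t0; rewrite /rker indicE mem_setE in_itv/= andbT ltNge t0 /= mulr0 mul0r. Qed.

Lemma rkerE x t z : 0 < t -> rker x (t, z) = expR (- (kap * t)) * (pker t (z - x) * nz z).
Proof. by move=> t0; rewrite /rker indicE mem_setE in_itv/= andbT t0 /= mulr1. Qed.

Lemma rker_ge0 x w : 0 <= rker x w.
Proof.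
case: w => t z; have [t0|t0] := leP t 0; first by rewrite rker0.
have p0 := ltW (pker_gt0 a_gt0 a_lt1 (z - x) t0).
by rewrite rkerE//; exact: (mulr_ge0 (expR_ge0 _) (mulr_ge0 p0 (nz_ge0 _))).
Qed.

Lemma measurable_rker d (T : measurableType d) (fx fz : T -> 'rV[R]_n) (ft : T -> R) :
  measurable_fun setT fx -> measurable_fun setT ft -> measurable_fun setT fz ->
  measurable_fun setT (fun p => rker (fx p) (ft p, fz p)).
Proof.
move=> mx mt mz; rewrite /rker/=; apply: measurable_funM; last first.
  by apply: measurable_funM; [apply: measurable_pker; meas|exact: measurable_nz].
apply: measurable_funM; first by meas.
exact: (@measurableT_comp _ _ _ _ _ _ (\1_pos : measurableTypeR R -> R)).
Qed.

Lemma measurable_rker_section x : measurable_fun setT (rker x).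
Proof.
have := @measurable_rker _ (measurableTypeR R * 'rV[R]_n)%type (fun=> x) snd fst.
have -> : (fun p => rker x (p.1, p.2)) = rker x by apply/funext => -[].
by apply; meas.
Qed.

(** The resolvent [U f] of the free semigroup at [kap], for nonnegative [f] and
    with possibly infinite values. *)
Definition rop (f : 'rV[R]_n -> R) x : \bar R :=
  (\int[(mu \x lebesgue_rV n)%E]_w (rker x w * f w.2)%:E)%E.

Lemma measurable_rop_arg f x : measurable_fun setT f ->
  measurable_fun setT (fun w : measurableTypeR R * 'rV[R]_n => (rker x w * f w.2)%:E).
Proof.
move=> mf; apply/measurable_EFinP; apply: measurable_funM.
  exact: measurable_rker_section.
exact: (measurableT_comp mf).
Qed.

Lemma rop_ge0 f x : (forall z, 0 <= f z) -> (0 <= rop f x)%E.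
Proof. by move=> f0; apply: integral_ge0 => w _; rewrite lee_fin (mulr_ge0 (rker_ge0 _ _) (f0 _)). Qed.

Lemma rop_tonelli f x : measurable_fun setT f -> (forall z, 0 <= f z) ->
  rop f x = (\int[mu]_t \int[lebesgue_rV n]_z (rker x (t, z) * f z)%:E)%E.
Proof.
move=> mf f0; rewrite /rop fubini_tonelli1//; first exact: measurable_rop_arg.
by move=> w; rewrite lee_fin (mulr_ge0 (rker_ge0 _ _) (f0 _)).
Qed.

Lemma rop_le_bounded f M x : measurable_fun setT f -> (forall z, 0 <= f z) ->
  (forall z, f z <= M) ->
  (rop f x <= (\int[mu]_(t in `]0, +oo[) (expR (- (kap * t)) *
     \int[lebesgue_rV n]_z (pker t (z - x) * f z)))%:E)%E.
Proof.
move=> mf f0 fM; rewrite rop_tonelli//.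
have M0 : 0 <= M by rewrite (le_trans (f0 0)).
have ifz t : 0 < t -> (lebesgue_rV n).-integrable setT (EFin \o (fun z => pker t (z - x) * f z)).
  move=> t0; apply: (integrable_dom measurableT (g := fun z => M * pker t (z - x))) => //.
  - by apply: measurable_funM => //; apply: measurable_pker; meas.
  - by apply: integrable_scalel => //; exact: integrable_pker.
  - move=> z _; have p0 := ltW (pker_gt0 a_gt0 a_lt1 (z - x) t0).
    rewrite (ger0_norm (mulr_ge0 p0 (f0 z))) (mulrC (pker _ _)).
    by apply: ler_wpM2r.
pose I t := \int[lebesgue_rV n]_z (pker t (z - x) * f z).
have I0 t : 0 < t -> 0 <= I t.
  move=> t0; apply: Rintegral_ge0 => z _; apply: (mulr_ge0 _ (f0 z)).
  exact: ltW (pker_gt0 a_gt0 a_lt1 (z - x) t0).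
have IM t : 0 < t -> I t <= M.
  move=> t0; apply: (@le_trans _ _ (\int[lebesgue_rV n]_z (M * pker t (z - x)))).
    apply: le_Rintegral => //; first exact: ifz.
    - by apply: integrable_scalel => //; exact: integrable_pker.
    - move=> z _; have p0 := ltW (pker_gt0 a_gt0 a_lt1 (z - x) t0).
      by rewrite (mulrC (pker _ _)); apply: ler_wpM2r.
  rewrite RintegralZl//; last exact: integrable_pker.
  by rewrite Rint_pker// ler_piMr// -expR0 ler_expR oppr_le0 ltW.
have mI : measurable_fun setT (fun t : measurableTypeR R => I t).
  apply: (@measurable_Rint R _ _ (measurableTypeR R) 'rV[R]_n (lebesgue_rV n)
    (fun t z => pker t (z - x) * f z)).
  apply: measurable_funM; first by apply: measurable_pker; meas.
  exact: (measurableT_comp mf).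
have i2 : mu.-integrable setT (EFin \o (fun t => expR (- (kap * t)) * \1_pos t * I t)).
  have i1 := (integrable_indicP _ mpos).1 (integrable_expR kap_gt0).
  have i3 : mu.-integrable setT (EFin \o (fun t => M * (expR (- (kap * t)) * \1_pos t))).
    exact: integrable_scalel.
  apply: (@integrable_dom R _ _ mu setT measurableT _ _ _ i3).
    apply: measurable_funM; last exact: mI.
    by apply: measurable_funM; [meas|exact: measurable_indic].
  move=> t _; rewrite indicE mem_setE in_itv/= andbT.
  have [t0|t0] := ltP 0 t; last by rewrite !mulr0 mul0r normr0.
  by rewrite mulr1 ger0_norm ?mulr_ge0 ?expR_ge0 ?I0// mulrC ler_wpM2r ?expR_ge0 ?IM.
rewrite Rint_indic (_ : \int[_]_r _ = \int[mu]_t (expR (- (kap * t)) * \1_pos t * I t)); last first.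
  by apply: eq_Rintegral => t _; rewrite mulrAC.
rewrite -Rint_EFin//.
apply: ge0_le_integral => //.
- by move=> t _; apply: integral_ge0 => z _; rewrite lee_fin (mulr_ge0 (rker_ge0 _ _) (f0 _)).
- apply: (@measurable_fun_fubini_tonelli_F _ _ (measurableTypeR R) _ R (lebesgue_rV n)
    (fun w => (rker x w * f w.2)%:E)); first exact: measurable_rop_arg.
  by move=> w; rewrite lee_fin (mulr_ge0 (rker_ge0 _ _) (f0 _)).
- exact: measurable_int i2.
move=> t _; have [t0|t0] := leP t 0.
  rewrite (_ : integral _ _ _ = 0%E).
    by rewrite lee_fin indicE mem_setE in_itv/= andbT ltNge t0 /= mulr0 mul0r.
  by apply: integral0_eq => z _; rewrite rker0// mul0r.
rewrite indicE mem_setE in_itv/= andbT t0 mulr1 EFinM /I -Rint_EFin//; last exact: ifz.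
rewrite -ge0_integralZl//; last 2 first.
- exact: measurable_int (ifz t t0).
- by move=> z _; rewrite lee_fin (mulr_ge0 (ltW (pker_gt0 a_gt0 a_lt1 (z - x) t0)) (f0 z)).
apply: ge0_le_integral => //.
- by move=> z _; rewrite lee_fin (mulr_ge0 (rker_ge0 _ _) (f0 _)).
- apply/measurable_EFinP; apply: measurable_funM => //.
  by apply: measurable_rker; meas.
- apply: emeasurable_funM => //; exact: measurable_int (ifz t t0).
move=> z _; rewrite rkerE// -EFinM lee_fin.
have p0 := ltW (pker_gt0 a_gt0 a_lt1 (z - x) t0).
move: (pker t (z - x)) p0 => p p0; rewrite -!mulrA ler_wpM2l ?expR_ge0// ler_wpM2l//.
by rewrite ler_piMl// nz_le1.
Qed.

Lemma rop_cst c x : 0 <= c -> (rop (fun=> c) x <= (c / (kap + 1))%:E)%E.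
Proof.
move=> c0; apply: le_trans (rop_le_bounded (M := c) _ _ _ _) _ => //.
have k1 : 0 < kap + 1 by rewrite addr_gt0.
rewrite lee_fin -(Rint_expR k1) -RintegralZl//; last exact: integrable_expR.
rewrite le_eqVlt; apply/orP; left; apply/eqP; apply: eq_Rintegral => t.
rewrite inE => /posP t0; rewrite RintegralZr//; last exact: integrable_pker.
by rewrite Rint_pker// mulrA -expRD mulrC; congr (_ * expR _); ring.
Qed.

(** The smoothed identity passes to the limit [s -> 0] as an inequality, by
    Fatou's lemma: [h = bes (b + a) 0] is a supersolution for the right-hand side
    [h' + kap h], with [h' = bes b 0]. *)
Lemma rop_bes b x : 0 < b -> x != 0 ->
  (rop (fun z => bes b 0 z + kap * bes (b + a) 0 z)%R x <= (bes (b + a) 0 x)%:E)%E.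
Proof.
move=> b0 x0; have ba0 : 0 < b + a by exact: addr_gt0.
have s0 (k : nat) : (0 : R) < k.+1%:R^-1 by rewrite invr_gt0.
pose f s z := bes b s z + kap * bes (b + a) s z.
have f0 s z : 0 <= f s z.
  exact: (addr_ge0 (bes_ge0 _ _ b0) (mulr_ge0 (ltW kap_gt0) (bes_ge0 _ _ ba0))).
have mf s : 0 <= s -> measurable_fun setT (f s).
  move=> hs; apply: measurable_funD; first exact: measurable_bes.
  by apply: measurable_funM => //; exact: measurable_bes.
apply: (@fatou_le R _ _ (mu \x lebesgue_rV n)%E (fun k w => (rker x w * f k.+1%:R^-1 w.2)%:E)
  _ (fun k => bes (b + a) k.+1%:R^-1 x)).
- by move=> k; apply: measurable_rop_arg; apply: mf; rewrite invr_ge0.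
- by move=> k w; rewrite lee_fin (mulr_ge0 (rker_ge0 _ _) (f0 _ _)).
- move=> [t z] /=; apply: cvg_EFin; first exact: nearW.
  have [->|z0] := eqVneq z 0.
    by rewrite /rker /nz /= eqxx !mulr0 !mul0r; under eq_fun do rewrite mul0r; exact: cvg_cst.
  apply: cvgMr; apply: cvgD; first exact: bes_cvg.
  by apply: cvgMr; exact: bes_cvg.
- move=> k; rewrite -(bes_resolvent a_gt0 a_lt1 b0 kap_gt0 x (s0 k)).
  have bd b' z : 0 < b' -> bes b' k.+1%:R^-1 z <=
      \int[lebesgue_rV n]_xi expR (- ((k.+1%:R)^-1 * lam xi)).
    move=> b'0; rewrite besE//; apply: le_Rintegral => //.
    + exact: integrable_bes_multiplier (ltW b'0) (s0 k).
    + exact: integrable_exp_lam.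
    + move=> xi _; apply: le_trans (ler_norm _) _.
      exact: bes_multiplier_dom (ltW b'0).
  apply: (@rop_le_bounded (f k.+1%:R^-1) ((1 + kap) *
    \int[lebesgue_rV n]_xi expR (- ((k.+1%:R)^-1 * lam xi)))) => //.
  + by apply: mf; rewrite invr_ge0.
  + by move=> z; rewrite mulrDl mul1r lerD ?bd// ler_wpM2l ?bd// ltW.
- exact: bes_cvg.
Qed.

End resolvent_operator.

(** * The potential and the supersolution *)
Section bessel_bounds.
Context {R : realType} {n : nat}.
Local Notation mu := (@lebesgue_measure R).
Local Notation pos := (`]0, +oo[%classic : set (measurableTypeR R)).
Implicit Types (x z : 'rV[R]_n) (t s u b : R).

Let mpos : measurable pos. Proof. exact: measurable_itv. Qed.

Let posP u : pos u -> 0 < u. Proof. by rewrite /= in_itv/= andbT. Qed.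

(** Restrict the integral to [u] in [(1, 2]]. *)
Lemma bes_lb b : 0 < b -> exists2 c : R, 0 < c &
  forall x, x != 0 -> c * expR (- (dotp x x / 4)) <= bes b 0 x.
Proof.
move=> b0; have G0 := Gamma_gt0 b0.
exists ((Gamma b)^-1 * (2^-1 * expR (- 2))).
  by rewrite mulr_gt0 ?invr_gt0// mulr_gt0 ?invr_gt0 ?expR_gt0.
move=> x x0; rewrite /bes -mulrA ler_wpM2l ?invr_ge0 ?(ltW G0)//.
apply: Rint_ge_on12 => //; first exact: subset12_pos.
- exact: integrable_bes.
- by move=> u _; rewrite mulr_ge0 ?powR_ge0 ?gs_ge0.
move=> u u1 u2; have u0 : 0 < u by rewrite (lt_trans ltr01).
rewrite addr0 /gs.
have h2 : 1 <= Num.sqrt (pi / u) ^+ n.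
  rewrite exprn_ege1// -sqrtr1 ler_sqrt; last by rewrite divr_ge0 ?pi_ge0 ?ltW.
  by rewrite ler_pdivlMr// mul1r (le_trans u2)// pi_ge2.
rewrite -[leLHS]mulrA ler_pM ?invr_ge0 ?mulr_ge0 ?expR_ge0 ?half_le_powR// ler_pM ?expR_ge0//.
  by rewrite -[leLHS]mul1r ler_pM ?expR_ge0// ler_expR lerN2.
rewrite ler_expR lerN2 ler_wpM2l ?dotp_ge0// lef_pV2 ?posrE ?mulr_gt0//.
by rewrite ler_peMr// ltW.
Qed.

Lemma bes_gt0 b x : 0 < b -> x != 0 -> 0 < bes b 0 x.
Proof.
move=> b0 x0; have [c c0 /(_ x x0)] := bes_lb b0.
by apply: lt_le_trans; rewrite mulr_gt0 ?expR_gt0.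
Qed.

(** In the integral for [bes b], the part over [u >= 1 / 4] gains a factor
    [u ^ a <= 4 ^ a] in that for [bes (b + a)]; for smaller [u] the Gaussian is
    much smaller than [exp (- |x| ^ 2 / 4)], a lower bound of [bes (b + a)]. *)
Lemma bes_ratio b a : 0 < b -> 0 < a -> exists2 v : R, 0 <= v &
  forall x, 1 <= dotp x x -> bes b 0 x <= v * bes (b + a) 0 x.
Proof.
move=> b0 a0; have ba0 : 0 < b + a by exact: addr_gt0.
have G0 := Gamma_gt0 b0; have Ga0 := Gamma_gt0 ba0.
have [c c0 hc] := bes_lb ba0.
have [C [C0 hC]] := @gauss_kernel_bound R n 8^-1 ltac:(by rewrite invr_gt0).
exists ((Gamma b)^-1 * (4 `^ a * Gamma (b + a)) + C / c).
  move: (Gamma b) (Gamma (b + a)) G0 Ga0 => g g' g0 g'0.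
  by rewrite addr_ge0 ?divr_ge0 ?mulr_ge0 ?invr_ge0 ?powR_ge0// ltW.
move=> x x1; have x0 : x != 0 by rewrite -dotp_eq0 gt_eqF// (lt_le_trans ltr01).
have r0 := dotp_ge0 x.
have ib := integrable_bes b0 (lexx 0) x0.
have iba := integrable_bes ba0 (lexx 0) x0.
pose E := expR (- (dotp x x / 4)).
have pt u : 0 < u -> u `^ (b - 1) * gs (u + 0) x <=
    4 `^ a * (u `^ (b + a - 1) * gs (u + 0) x) + C * E * (u `^ (b - 1) * expR (- u)).
  move=> u0; rewrite addr0.
  have [u4|u4] := leP 4^-1 u.
    apply: (@le_trans _ _ (4 `^ a * (u `^ (b + a - 1) * gs u x))); last first.
      by rewrite lerDl !mulr_ge0 ?expR_ge0 ?powR_ge0.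
    rewrite mulrA ler_wpM2r ?gs_ge0//.
    rewrite (_ : b + a - 1 = a + (b - 1)); last by ring.
    rewrite [X in _ <= _ * X]powRD ?(gt_eqF u0) ?implybT// mulrA ler_peMl ?powR_ge0//.
    rewrite -powRM ?(ltW u0)//.
    have e1 : (1 : R) `^ a = 1 by rewrite powR1.
    rewrite -[leLHS]e1 ge0_ler_powR ?nnegrE ?(ltW a0)//; last by rewrite mulrC -ler_pdivrMr// mul1r.
    by rewrite mulr_ge0// ltW.
  apply: (@le_trans _ _ (C * E * (u `^ (b - 1) * expR (- u)))); last first.
    by rewrite lerDr mulr_ge0 ?powR_ge0// mulr_ge0 ?powR_ge0 ?gs_ge0.
  rewrite /gs [leRHS]mulrCA ler_wpM2l ?powR_ge0// mulrAC ler_wpM2r ?expR_ge0//.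
  apply: (@le_trans _ _ (Num.sqrt (pi / u) ^+ n * expR (- (8^-1 / u)) * E)).
    rewrite -mulrA ler_wpM2l ?exprn_ge0 ?sqrtr_ge0// /E -expRD ler_expR -opprD lerN2.
    (* The remainder is nonnegative because [|x| >= 1] and [u <= 1 / 4]. *)
    have -> : dotp x x / (4 * u) = 8^-1 / u + dotp x x / 4 +
        ((dotp x x - 1) * (1 - u) * 2 + (1 - 2 * u)) / (8 * u).
      by field; rewrite gt_eqF.
    rewrite lerDl divr_ge0 ?mulr_ge0 ?(ltW u0)//.
    have d1 : 0 <= dotp x x - 1 by rewrite subr_ge0.
    have u1 : 0 <= 1 - u by rewrite subr_ge0 (le_trans (ltW u4))// invf_le1 ?ler1n.
    by rewrite addr_ge0 ?mulr_ge0//; lra.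
  by rewrite ler_wpM2r ?expR_ge0// hC.
have i1 : mu.-integrable pos (EFin \o (fun u => 4 `^ a * (u `^ (b + a - 1) * gs (u + 0) x))).
  exact: integrable_scalel.
have i2 : mu.-integrable pos (EFin \o (fun u => C * E * (u `^ (b - 1) * expR (- u)))).
  by apply: integrable_scalel => //; exact: integrable_Gamma.
have i12 : mu.-integrable pos (EFin \o (fun u => 4 `^ a * (u `^ (b + a - 1) * gs (u + 0) x) +
    C * E * (u `^ (b - 1) * expR (- u)))).
  exact: integrable_add.
have := le_Rintegral mpos ib i12 (fun u pu => pt u (posP pu)).
rewrite RintegralD// RintegralZl// RintegralZl//; last exact: integrable_Gamma.
rewrite !Rint_bes// -/(Gamma b) {pt}.
move: (bes b 0 x) (bes (b + a) 0 x) (Gamma b) (Gamma (b + a)) G0 Ga0 (hc x x0).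
rewrite -/E => p p' g g' g0 g'0 hp' h; rewrite -(ler_pM2l g0); apply: (le_trans h).
have -> : g * ((g^-1 * (4 `^ a * g') + C / c) * p') =
    4 `^ a * (g' * p') + g * (C / c * p') by field; rewrite !gt_eqF.
rewrite lerD2l mulrC ler_pM2l// -mulrA ler_wpM2l// ler_pdivlMl//.
Qed.

(** The integral defining the Bessel function of order [n / 2 - b]: it is the
    integral in [bes b 0] up to the constant in the Gauss kernel. *)
Lemma Rint_besselK b x : 0 < b -> x != 0 ->
  \int[mu]_(u in `]0, +oo[) (u `^ (- (n%:R / 2 - b) - 1) *
      expR (- u - enorm x ^+ 2 / (4 * u))) =
  (Num.sqrt pi ^+ n)^-1 * (Gamma b * bes b 0 x).
Proof.
move=> b0 x0; have S0 : 0 < Num.sqrt pi ^+ n :> R by rewrite exprn_gt0// sqrtr_gt0 pi_gt0.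
rewrite /bes [Gamma b * _]mulrA divff ?mul1r ?gt_eqF ?Gamma_gt0// -RintegralZl//; last first.
  exact: integrable_bes.
apply: eq_Rintegral => u; rewrite inE => /posP u0; rewrite addr0 /gs enormX.
have -> : Num.sqrt (pi / u) ^+ n = Num.sqrt pi ^+ n * u `^ (- (n%:R / 2)).
  rewrite sqrtrM ?pi_ge0// exprMn; congr (_ * _).
  rewrite -powR12_sqrt ?invr_ge0 ?(ltW u0)// -powR_mulrn ?powR_ge0//.
  rewrite -powRrM -powR_inv1 ?(ltW u0)// -powRrM; congr (_ `^ _); by field.
rewrite (_ : - (n%:R / 2 - b) - 1 = (b - 1) + - (n%:R / 2)); last by ring.
rewrite powRD ?(gt_eqF u0) ?implybT// expRD.
by field; rewrite gt_eqF.
Qed.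

(** The order of the numerator corresponds to [b], that of the denominator to
    [b + alpha / 2]; the Gamma factors and the powers of [|x|] in the potential
    are exactly the normalisations of the two kernels. *)
Lemma potential_bes (alpha delta : R) x : 0 < alpha -> 0 < n%:R - delta - alpha -> x != 0 ->
  potential alpha delta x =
  bes ((n%:R - delta - alpha) / 2) 0 x / bes ((n%:R - delta - alpha) / 2 + alpha / 2) 0 x.
Proof.
move=> a0 d0 x0; set b := (n%:R - delta - alpha) / 2.
have b0 : 0 < b by rewrite divr_gt0.
have ba0 : 0 < b + alpha / 2 by rewrite addr_gt0// divr_gt0.
have S0 : 0 < Num.sqrt pi ^+ n :> R by rewrite exprn_gt0// sqrtr_gt0 pi_gt0.
have r0 := enorm_gt0 x0.
rewrite /potential /besselK.
have -> : (delta + alpha) / 2 = n%:R / 2 - b by rewrite /b; field.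
have -> : delta / 2 = n%:R / 2 - (b + alpha / 2) by rewrite /b; field.
have -> : (n%:R - delta) / 2 = b + alpha / 2 by rewrite /b; field.
rewrite -/b !Rint_besselK//.
have -> : n%:R / 2 - b = (n%:R / 2 - (b + alpha / 2)) + alpha / 2 by ring.
have r2 : 0 < enorm x / 2 by rewrite divr_gt0.
rewrite [X in (2^-1 * X * _) / _]powRD ?(gt_eqF r2) ?implybT//.
have e : enorm x `^ (alpha / 2) = (enorm x / 2) `^ (alpha / 2) * 2 `^ (alpha / 2).
  by rewrite -powRM ?divr_ge0 ?enorm_ge0 ?(ltW r0)// divfK.
rewrite powRN e.
have h0 := bes_gt0 ba0 x0; have G0 := Gamma_gt0 b0; have Ga0 := Gamma_gt0 ba0.
have p0 : 0 < (enorm x / 2) `^ (n%:R / 2 - (b + alpha / 2)) by rewrite powR_gt0.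
have p1 : 0 < (enorm x / 2) `^ (alpha / 2) by rewrite powR_gt0.
have p2 : 0 < (2 : R) `^ (alpha / 2) by rewrite powR_gt0.
move: (bes (b + _) 0 x) (Gamma b) (Gamma (b + _)) ((enorm x / 2) `^ (n%:R / 2 - (b + alpha / 2)))
  ((enorm x / 2) `^ (alpha / 2)) ((2 : R) `^ (alpha / 2))
  (Num.sqrt pi ^+ n) h0 G0 Ga0 p0 p1 p2 S0 => h g1 g2 q0 q1 q2 S *.
by field; rewrite !gt_eqF.
Qed.

End bessel_bounds.

Section resolvent_inequalities.
Context {R : realType} {n : nat}.
Local Notation mu := (@lebesgue_measure R).
Implicit Types (x z : 'rV[R]_n) (f : 'rV[R]_n -> R).
Variables (a kap : R).
Hypotheses (a_gt0 : 0 < a) (a_lt1 : a < 1) (kap_gt0 : 0 < kap).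
Local Notation Urop := (@rop R n a kap).
Local Notation Uker := (@rker R n a kap).

Lemma ropD f (g : 'rV[R]_n -> R) x : measurable_fun setT f -> measurable_fun setT g ->
  (forall z, 0 <= f z) -> (forall z, 0 <= g z) ->
  (Urop (fun z => f z + g z)%R x = Urop f x + Urop g x)%E.
Proof.
move=> mf mg f0 g0; rewrite /rop -ge0_integralD//; last 4 first.
- by move=> w _; rewrite lee_fin (mulr_ge0 (rker_ge0 kap a_gt0 a_lt1 _ _) (f0 _)).
- exact: measurable_rop_arg.
- by move=> w _; rewrite lee_fin (mulr_ge0 (rker_ge0 kap a_gt0 a_lt1 _ _) (g0 _)).
- exact: measurable_rop_arg.
by apply: eq_integral => w _; rewrite -EFinD mulrDr.
Qed.

Lemma ropZ c f x : 0 <= c -> measurable_fun setT f -> (forall z, 0 <= f z) ->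
  (Urop (fun z => c * f z)%R x = c%:E * Urop f x)%E.
Proof.
move=> c0 mf f0; rewrite /rop -ge0_integralZl//; last 2 first.
- exact: measurable_rop_arg.
- by move=> w _; rewrite lee_fin (mulr_ge0 (rker_ge0 kap a_gt0 a_lt1 _ _) (f0 _)).
by apply: eq_integral => w _; rewrite -EFinM mulrCA.
Qed.

Lemma le_rop f (g : 'rV[R]_n -> R) x : measurable_fun setT f -> measurable_fun setT g ->
  (forall z, 0 <= f z) -> (forall z, z != 0 -> f z <= g z) -> (Urop f x <= Urop g x)%E.
Proof.
move=> mf mg f0 fg; apply: ge0_le_integral => //.
- by move=> w _; rewrite lee_fin (mulr_ge0 (rker_ge0 kap a_gt0 a_lt1 _ _) (f0 _)).
- exact: measurable_rop_arg.
- exact: measurable_rop_arg.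
move=> [t z] _; rewrite lee_fin /=; have [->|z0] := eqVneq z 0.
  by rewrite /rker /nz /= eqxx !mulr0 !mul0r.
by rewrite ler_wpM2l ?rker_ge0// fg.
Qed.

Lemma measurable_rop f : measurable_fun setT f -> (forall z, 0 <= f z) ->
  measurable_fun setT (Urop f).
Proof.
move=> mf f0; have -> : Urop f = (fun x =>
    \int[mu]_t \int[lebesgue_rV n]_z (Uker x (t, z) * f z)%:E)%E.
  by apply/funext => x; rewrite rop_tonelli.
apply: (@measurable_fun_fubini_tonelli_F _ _ 'rV[R]_n (measurableTypeR R) R mu
  (fun w => \int[lebesgue_rV n]_z (Uker w.1 (w.2, z) * f z)%:E)%E); last first.
  by move=> w; apply: integral_ge0 => z _; rewrite lee_fin (mulr_ge0 (rker_ge0 kap a_gt0 a_lt1 _ _) (f0 _)).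
apply: (@measurable_fun_fubini_tonelli_F _ _ ('rV[R]_n * measurableTypeR R)%type 'rV[R]_n R (lebesgue_rV n)
  (fun w => (Uker w.1.1 (w.1.2, w.2) * f w.2)%:E)%E); last first.
  by move=> w; rewrite lee_fin (mulr_ge0 (rker_ge0 kap a_gt0 a_lt1 _ _) (f0 _)).
apply/measurable_EFinP; apply: measurable_funM; last exact: (measurableT_comp mf).
apply: measurable_rker.
- exact: measurableT_comp measurable_fst measurable_fst.
- exact: measurableT_comp measurable_snd measurable_fst.
- exact: measurable_snd.
Qed.

(** Times between 1 and 2 suffice: for these the free kernel dominates a
    Gaussian, and so does [bes b 0]. *)
Lemma rop_bes_lb b : (0 < n)%N -> 0 < b -> exists2 c : R, 0 < c &
  forall x, dotp x x <= 1 -> (c%:E <= Urop (bes b 0) x)%E.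
Proof.
move=> n0 b0.
have [c1 c10 hc1] := @bes_lb R n b b0.
have [c2 c20 hc2] := @pker_ge R n a a_gt0 a_lt1 1 2 ltr01.
have q0 : (0 : R) < 3 / 4 by rewrite divr_gt0.
pose C0 : R := expR (- (kap * 2)) * (c2 * expR (- 2^-1) * c1).
have C00 : 0 < C0 by rewrite !mulr_gt0 ?expR_gt0.
pose E z := expR (- (3 / 4 * dotp z z)).
pose I := \int[lebesgue_rV n]_z E z.
have iE := @integrable_gauss_scaled0 R n _ q0.
have I0 : 0 < I.
  have := Rint_gauss_scaled (0 : 'rV[R]_n) 0 q0.
  rewrite cos0 mulr1 dotp0r mul0r oppr0 expR0 mulr1 => h.
  rewrite (_ : I = Num.sqrt (pi / (3 / 4)) ^+ n).
    by rewrite exprn_gt0// sqrtr_gt0 divr_gt0// pi_gt0.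
  rewrite -h; apply: eq_Rintegral => z _.
  by rewrite dotp0r addr0 cos0 mulr1.
exists (C0 * I); first by rewrite mulr_gt0.
move=> x x1; rewrite rop_tonelli//; last 2 first.
- exact: measurable_bes.
- by move=> z; exact: bes_ge0.
have mD : measurable (`[1, 2]%classic : set (measurableTypeR R)) by exact: measurable_itv.
have -> : (C0 * I)%:E = (\int[mu]_(t in `[1%R, 2%R]) (C0 * I)%:E)%E.
  rewrite integral_cst//= lebesgue_measure_itv/= lte_fin ltr1n/= -EFinD.
  by rewrite (_ : 2 - 1 = 1 :> R) ?mule1//; lra.
rewrite integral_mkcond; apply: ge0_le_integral => //.
- by move=> t _; rewrite patchE; case: ifP => // _; rewrite lee_fin ltW// mulr_gt0.
- rewrite (_ : _ \_ _ = (fun t => (C0 * I * \1_(`[1, 2]%classic : set (measurableTypeR R)) t)%:E)).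
    by apply/measurable_EFinP; apply: measurable_funM => //; exact: measurable_indic.
  by apply/funext => t; rewrite patchE indicE; case: ifP; rewrite ?mulr1 ?mulr0.
- apply: (@measurable_fun_fubini_tonelli_F _ _ (measurableTypeR R) 'rV[R]_n R (lebesgue_rV n)
    (fun w => (Uker x (w.1, w.2) * bes b 0 w.2)%:E)); last first.
    by move=> w; rewrite lee_fin (mulr_ge0 (rker_ge0 kap a_gt0 a_lt1 _ _) (bes_ge0 _ _ b0)).
  apply/measurable_EFinP; apply: measurable_funM.
    by apply: measurable_rker; meas.
  by apply: (measurableT_comp (@measurable_bes R n b 0 (lexx 0))); meas.
move=> t _; rewrite patchE mem_setE in_itv/=.
case: ifP => [/andP[t1 t2]|_]; last first.
  by apply: integral_ge0 => z _; rewrite lee_fin (mulr_ge0 (rker_ge0 kap a_gt0 a_lt1 _ _) (bes_ge0 _ _ b0)).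
rewrite EFinM /I -Rint_EFin//.
have mE : measurable_fun setT E by rewrite /E; meas.
rewrite -ge0_integral_nz//; last by move=> z; exact: expR_ge0.
rewrite -ge0_integralZl//; last 3 first.
- by apply/measurable_EFinP; apply: measurable_funM => //; apply: measurable_nz; meas.
- by move=> z _; rewrite lee_fin mulr_ge0 ?expR_ge0 ?nz_ge0.
- by rewrite lee_fin ltW.
have t0 : 0 < t by rewrite (lt_le_trans _ t1).
apply: ge0_le_integral => //.
- by move=> z _; rewrite -EFinM lee_fin !mulr_ge0 ?expR_ge0 ?nz_ge0// ltW.
- apply/measurable_EFinP; apply: measurable_funM => //.
  by apply: measurable_funM => //; apply: measurable_nz; meas.
- apply/measurable_EFinP; apply: measurable_funM; first by apply: measurable_rker; meas.
  exact: measurable_bes.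
move=> z _; rewrite rkerE// -EFinM lee_fin.
have [->|z0] := eqVneq z 0; first by rewrite /nz eqxx /= !mulr0 mul0r.
rewrite /nz z0 !mulr1 /C0.
have p1 := hc2 t (z - x) t1 t2; have p2 := hc1 z z0.
move: (pker a t (z - x)) (bes b 0 z) p1 p2 => p q p1 p2; rewrite -!mulrA.
rewrite ler_pM ?expR_ge0//.
- by rewrite !mulr_ge0 ?expR_ge0// ltW.
- by rewrite ler_expR lerN2 ler_wpM2l// ltW.
apply: (@le_trans _ _ ((c2 * expR (- (dotp (z - x) (z - x) / 4))) * (c1 * expR (- (dotp z z / 4))))).
  rewrite -!mulrA ler_wpM2l ?(ltW c20)// [leLHS]mulrCA [leRHS]mulrCA ler_wpM2l ?(ltW c10)//.
  rewrite /E -!expRD ler_expR dotpBr !dotpDl !dotpNl (dotpC x z).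
  have h : 0 <= dotp (z + x) (z + x) by exact: dotp_ge0.
  by move: h; rewrite dotpDr !dotpDl (dotpC x z); lra.
by apply: ler_pM => //; rewrite mulr_ge0 ?expR_ge0 ?ltW.
Qed.

End resolvent_inequalities.

(** With [kap = v + 1] and [U] the resolvent at [kap], the hypothesis says that
    [h] is a supersolution for the right-hand side [h' + kap h]; put
    [g = kap U h], so that [U h' <= h - g]. Off the unit ball [V <= v]; on it [g]
    is bounded below by [kap c], whence [V <= v + A V g] everywhere with
    [A = (kap c) ^ (- 1)]. Let [f = 1 + V g] and [H = 1 + B (2 h - g)] with
    [B = A + 1]. The term [- B V g] in [V H] absorbs both the [V g] of [f] and
    the unbounded part of [V], so that [f + V H <= 1 + v + 2 B h']. Finally
    [U (1 + v) <= 1] and [U (2 B h') <= 2 B (h - g)] add up to at most [H]. *)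
Lemma supersolution_of_resolvent (R : realType) n (a v c : R) (h h' : 'rV[R]_n -> R) :
  0 < a -> a < 1 -> 0 <= v -> 0 < c ->
  measurable_fun setT h -> measurable_fun setT h' ->
  (forall z, 0 <= h z) -> (forall z, 0 <= h' z) -> (forall z, z != 0 -> 0 < h z) ->
  (forall z, 1 <= dotp z z -> h' z <= v * h z) ->
  (forall x, dotp x x <= 1 -> (c%:E <= rop a (v + 1) h x)%E) ->
  (forall x, x != 0 ->
    (rop a (v + 1) (fun z => h' z + (v + 1) * h z)%R x <= (h x)%:E)%E) ->
  let V z := h' z / h z in
  exists C (f H : 'rV[R]_n -> R), [/\
    [/\ measurable_fun setT f, forall z, 0 <= f z, measurable_fun setT H & forall z, 0 <= H z],
    (0 <= C /\ forall z, z != 0 -> 1 + V z <= C * f z) &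
    forall x, x != 0 -> (rop a (v + 1) (fun z => f z + V z * H z)%R x <= (H x)%:E)%E].
Proof.
move=> a0 a1 v0 c0 mh mh' h0 h'0 hp hv hc hU0 V.
pose kap := v + 1; have k0 : 0 < kap by rewrite ltr_wpDl.
rewrite -/kap in hc hU0 *.
have rD := @ropD R n a kap a0 a1; have rZ := @ropZ R n a kap a0 a1.
have V0 z : 0 <= V z by rewrite divr_ge0.
have mV : measurable_fun setT V.
  by apply: measurable_funM => //; exact: measurable_invf.
pose g x := kap * fine (rop a kap h x).
have rh0 x : (0 <= rop a kap h x)%E by exact: rop_ge0.
have g0 x : 0 <= g x by rewrite mulr_ge0 ?(ltW k0)// fine_ge0.
have mg : measurable_fun setT g.
  apply: measurable_funM => //; apply: measurableT_comp => //.
  exact: measurable_rop.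
have hU x : x != 0 -> (rop a kap h' x + kap%:E * rop a kap h x <= (h x)%:E)%E.
  move=> x0; have := hU0 x x0.
  rewrite (rD _ _ _ mh' (measurable_funM (measurable_cst kap) mh))//; last first.
    by move=> z; rewrite mulr_ge0// ltW.
  by rewrite (rZ _ _ _ (ltW k0) mh h0).
have gE x : x != 0 -> (kap%:E * rop a kap h x = (g x)%:E)%E.
  move=> x0; rewrite /g EFinM fineK// ge0_fin_numE//.
  have : (kap%:E * rop a kap h x <= (h x)%:E)%E.
    apply: le_trans (hU x x0); apply: leeDr; exact: rop_ge0.
  case: (rop a kap h x) (rh0 x) => [r| |] //= _; first by rewrite ltry.
  by rewrite mulry gtr0_sg// mul1e.
have hU' x : x != 0 -> (rop a kap h' x <= (h x - g x)%:E)%E.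
  by move=> x0; rewrite EFinB leeBrDr// -gE// hU.
have gh x : x != 0 -> g x <= h x.
  move=> x0; rewrite -subr_ge0 -lee_fin; apply: le_trans (hU' x x0).
  exact: rop_ge0.
have kc0 : 0 < kap * c by rewrite mulr_gt0.
pose A := (kap * c)^-1.
have A0 : 0 < A by rewrite invr_gt0.
have VA z : z != 0 -> V z <= v + A * (V z * g z).
  move=> z0; have [z1|z1] := leP 1 (dotp z z).
    apply: (@le_trans _ _ v); last by rewrite lerDl mulr_ge0 ?(ltW A0)// mulr_ge0.
    by rewrite ler_pdivrMr ?hp// hv.
  apply: (@le_trans _ _ (A * (V z * g z))); last by rewrite lerDr.
  rewrite mulrCA ler_peMr// /A ler_pdivlMl// mulr1 -lee_fin -gE// EFinM.
  by rewrite lee_wpmul2l ?lee_fin ?(ltW k0)// hc// ltW.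
pose B := A + 1; have B0 : 0 <= B by rewrite addr_ge0// ltW.
pose f z := 1 + V z * g z.
pose H z := (1 + B * (2 * h z - g z)) * nz z.
have f0 z : 0 <= f z by rewrite addr_ge0// mulr_ge0.
have mf : measurable_fun setT f by rewrite /f; meas.
have H0 z : 0 <= H z.
  have [->|z0] := eqVneq z 0; first by rewrite /H /nz eqxx mulr0.
  rewrite mulr_ge0 ?nz_ge0// addr_ge0// mulr_ge0// subr_ge0 (le_trans (gh z z0))//.
  by rewrite mulr_natl mulr2n lerDl.
have mH : measurable_fun setT H.
  by apply: measurable_funM; [meas|apply: measurable_nz; meas].
exists (1 + v + A), f, H; split=> //.
  split; first by rewrite !addr_ge0// ltW.
  move=> z z0; have hV := VA z z0.
  have Vg0 : 0 <= V z * g z by rewrite mulr_ge0.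
  have vV : 0 <= v * (V z * g z) by rewrite mulr_ge0.
  rewrite /f; move: (V z * g z) hV Vg0 vV (ltW A0) => p hV p0 vp A0'.
  apply: (le_trans (lerD (lexx 1) hV)).
  by rewrite !mulrDr !mulrDl !mulr1 !mul1r; lra.
move=> x x0.
have cst0 : 0 <= 1 + v by rewrite addr_ge0.
have B20 : 0 <= 2 * B by rewrite mulr_ge0.
apply: (@le_trans _ _ (rop a kap (fun z => (1 + v) + 2 * B * h' z)%R x)).
  apply: le_rop => //.
  - by apply: measurable_funD => //; apply: measurable_funM.
  - by apply: measurable_funD => //; apply: measurable_funM.
  - by move=> z; rewrite addr_ge0// mulr_ge0.
  move=> z z0; rewrite /f /H /nz z0 mulr1.
  have Vh : V z * h z = h' z by rewrite /V divfK// gt_eqF// hp.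
  have -> : 1 + V z * g z + V z * (1 + B * (2 * h z - g z)) =
      1 + V z + 2 * B * (V z * h z) - A * (V z * g z) by rewrite /B; ring.
  by rewrite Vh; have := VA z z0; lra.
rewrite (rD (fun=> 1 + v))//; last 2 first.
- by apply: measurable_funM.
- by move=> z; rewrite mulr_ge0.
rewrite rZ//.
apply: (@le_trans _ _ (1%:E + (2 * B)%:E * (h x - g x)%:E)%E).
  apply: leeD.
    apply: le_trans (rop_cst a0 a1 k0 x cst0) _.
    have k1 : 0 < kap + 1 by rewrite addr_gt0.
    by rewrite lee_fin -(ler_pM2r k1) -mulrA mulVf ?gt_eqF// mulr1 mul1r /kap; lra.
  by apply: lee_wpmul2l; [rewrite lee_fin|exact: hU'].
rewrite -EFinM -EFinD lee_fin /H /nz x0 mulr1.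
have : 0 <= B * g x by rewrite mulr_ge0.
by move: (g x) (h x) => p q hp'; lra.
Qed.

Lemma supersolution (R : realType) n (a b : R) : (0 < n)%N -> 0 < a -> a < 1 -> 0 < b ->
  let V (z : 'rV[R]_n) := bes b 0 z / bes (b + a) 0 z in
  exists kap C (f H : 'rV[R]_n -> R), [/\
    [/\ measurable_fun setT f, forall z, 0 <= f z, measurable_fun setT H & forall z, 0 <= H z],
    (0 <= C /\ forall z, z != 0 -> 1 + V z <= C * f z) &
    forall x, x != 0 -> (rop a kap (fun z => f z + V z * H z)%R x <= (H x)%:E)%E].
Proof.
move=> n0 a0 a1 b0 V; have ba0 : 0 < b + a by exact: addr_gt0.
have [v v0 hv] := @bes_ratio R n b a b0 a0.
have k0 : 0 < v + 1 by rewrite ltr_wpDl.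
have [c c0 hc] := @rop_bes_lb R n a (v + 1) a0 a1 k0 (b + a) n0 ba0.
exists (v + 1); apply: (supersolution_of_resolvent a0 a1 v0 c0 _ _ _ _ _ hv hc).
- exact: measurable_bes.
- exact: measurable_bes.
- by move=> z; exact: bes_ge0.
- by move=> z; exact: bes_ge0.
- by move=> z; exact: bes_gt0.
- by move=> x; exact: rop_bes.
Qed.

(** * Test functions *)
Section smooth_functions.
Context {R : realType} {V : normedModType R}.
Implicit Types (f : V -> R) (x v : V).

Lemma smooth_differentiable f x : smooth f -> differentiable f x.
Proof. by move=> /(_ [::] x). Qed.

Lemma smooth_continuous f : smooth f -> continuous f.
Proof. by move=> sf x; exact: differentiable_continuous (smooth_differentiable x sf). Qed.

Lemma smooth_derive f v : smooth f -> smooth (fun x => 'D_v f x).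
Proof. by move=> sf vs x; have := sf (rcons vs v) x; rewrite foldr_rcons. Qed.

Lemma Cc_smooth_derive f v : Cc_smooth f -> Cc_smooth (fun x => 'D_v f x).
Proof.
move=> [sf cf]; split; first exact: smooth_derive.
apply: subclosed_compact cf _; first exact: closed_closure.
rewrite [X in _ `<=` X](iffLR (closure_id _) (@closed_closure _ _)).
apply: closureS => x /= fx.
apply: contrapT => nx; move/eqP: fx; apply.
have : nbhs x (~` closure [set x | f x != 0]).
  by apply: open_nbhs_nbhs; split => //; rewrite openC; exact: closed_closure.
move=> nbx; rewrite (@near_eq_derive _ _ _ f (cst 0)) ?derive_cst//.
apply: filterS nbx => y ny; apply/eqP; apply/negPn/negP => fy.
by apply: ny; exact: subset_closure.
Qed.

Lemma Cc_smooth_bounded f : Cc_smooth f -> exists M : R, forall x, `|f x| <= M.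
Proof.
move=> [sf cf]; have /(@continuous_compact _ _ f) := cf.
have cs : {within closure [set x | f x != 0], continuous f}.
  by apply: continuous_subspaceT; exact: smooth_continuous.
move=> /(_ cs)/compact_bounded [M [Mr HM]].
pose M1 := Num.max M 0 + 1.
exists M1 => x; have [->|fx] := eqVneq (f x) 0.
  by rewrite normr0 addr_ge0// le_max lexx orbT.
apply: (HM M1); first by rewrite ltr_pwDr// le_max lexx.
by exists x => //; exact: subset_closure.
Qed.

Lemma is_derive_line f x v (h : R) : differentiable f (x + h *: v) ->
  is_derive h 1 (fun t : R => f (x + t *: v)) ('D_v f (x + h *: v)).
Proof.
move=> df; have dv := diff_derivable (v := v) df.
have E : (fun k : R => k^-1 *: (((fun t : R => f (x + t *: v)) \o shift h) (k *: (1 : R)) -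
    f (x + h *: v))) =
  (fun k : R => k^-1 *: ((f \o shift (x + h *: v)) (k *: v) - f (x + h *: v))).
  apply/funext => k /=; congr (_ *: (f _ - _)).
  by rewrite /shift /= [k *: (1 : R)]mulr1 scalerDl addrCA.
split; first by rewrite /derivable E; exact: dv.
by rewrite /derive E.
Qed.

End smooth_functions.

Section integral_of_derivative.
Context {R : realType} {n : nat}.
Implicit Types (y : 'rV[R]_n) (h : R).
Variables (G G' : 'rV[R]_n -> R) (e : 'rV[R]_n) (M r : R).
Hypothesis dG : forall y h, is_derive h 1 (fun t : R => G (y + t *: e)) (G' (y + h *: e)).
Hypotheses (mG : measurable_fun setT G) (mG' : measurable_fun setT G').
Hypotheses (GM : forall y, `|G y| <= M) (GM' : forall y, `|G' y| <= M).
Hypotheses (Gr : forall y, ~ box r y -> G y = 0) (Gr' : forall y, ~ box r y -> G' y = 0).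
Hypothesis e1 : forall i, `|e 0 i| <= 1.

Lemma box_line y h : 0 <= h <= 1 -> ~ box (r + 1) y -> ~ box r (y + h *: e).
Proof.
move=> /andP[h0 h1] nb hb; apply: nb => i.
have -> : y 0 i = (y + h *: e) 0 i - h * e 0 i by rewrite !mxE addrK.
rewrite (le_trans (ler_normB _ _))// lerD ?hb//.
by rewrite normrM ger0_norm// mulr_ile1.
Qed.

(** Translation invariance makes the integral of every difference quotient
    vanish; the quotients converge dominatedly. *)
Lemma Rint_dir_derivative_eq0 : \int[lebesgue_rV n]_y G' y = 0.
Proof.
pose h_ k : R := k.+1%:R^-1.
have h0 k : 0 < h_ k by rewrite invr_gt0.
have h1 k : h_ k <= 1 by rewrite invf_le1// ler1n.
have M0 : 0 <= M by rewrite (le_trans _ (GM 0)).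
have iG := integrable_box mG GM Gr.
have mGh (h : R) : measurable_fun setT (fun y => G (y + h *: e)).
  by apply: (measurableT_comp mG); meas.
pose q k y := (h_ k)^-1 * (G (y + h_ k *: e) - G y).
have qE k y : exists2 c : R, 0 <= c <= h_ k & q k y = G' (y + c *: e).
  have [|c ci E] := @MVT_segment R (fun t => G (y + t *: e)) (fun t => G' (y + t *: e)) 0 (h_ k) (ltW (h0 k)).
    apply: continuous_subspaceT; apply: (@is_derive_continuous _ _ (fun t => G' (y + t *: e))).
  exists c; first by move: ci; rewrite in_itv.
  by move: E; rewrite scale0r addr0 subr0 /q => ->; rewrite mulrCA mulVf ?mulr1// gt_eqF.
have cv : \int[lebesgue_rV n]_y q k y @[k --> \oo] --> \int[lebesgue_rV n]_y G' y.
  apply: (@Rint_dct R _ _ (lebesgue_rV n) setT _ _ _ (fun y => M * \1_(box (r + 1)) y)) => //.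
  - by move=> k; apply: measurable_funM => //; apply: measurable_funB.
  - move=> y _; have D0 := dG y 0.
    have hl : (h^-1 *: (G (y + (h *: (1 : R) + 0) *: e) - G (y + (0 : R) *: e))) @[h --> (0:R)^'] -->
        'D_1 (fun t : R => G (y + t *: e)) 0 by exact: (@ex_derive _ _ _ _ _ _ _ D0).
    rewrite (@derive_val _ _ _ _ _ _ _ D0) scale0r addr0 in hl.
    have hl' : (h^-1 *: (G (y + (h *: (1 : R) + 0) *: e) - G y)) @[h --> (0:R)^'+] --> G' y.
      exact: cvg_dnbhs_at_right.
    have /cvg_at_rightP/(_ h_) := hl'.
    have h_cv : h_ k @[k --> \oo] --> (0 : R) by exact: (@cvg_harmonic R).
    move=> /(_ (conj h0 h_cv)).
    have -> : (fun k => (h_ k)^-1 *: (G (y + (h_ k *: (1 : R) + 0) *: e) - G y)) = q ^~ y.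
      by apply/funext => k; rewrite /q addr0 [h_ k *: (1 : R)]mulr1.
    by [].
  - apply: integrable_scalel => //; apply: (@integrable_box _ _ _ 1 (r + 1)).
    + by apply: measurable_indic; exact: measurable_box.
    + by move=> y; rewrite indicE; case: (_ \in _); rewrite ?normr1 ?normr0.
    + by move=> y nb; rewrite indicE memNset.
  - move=> k y _; have [c /andP[c0 ch] ->] := qE k y.
    have [yb|nb] := pselect (box (r + 1) y); first by rewrite indicE mem_set// mulr1.
    rewrite Gr' ?normr0 ?mulr_ge0//; apply: box_line => //.
    by rewrite c0 (le_trans ch).
have q0 k : \int[lebesgue_rV n]_y q k y = 0.
  have iGh : (lebesgue_rV n).-integrable setT (EFin \o (fun y => G (y + h_ k *: e))).
    apply: (@integrable_box _ _ _ M (r + 1)) => // y nb.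
    by apply: Gr; apply: box_line => //; rewrite (ltW (h0 k)) h1.
  rewrite RintegralZl//; last first.
    by exact: integrable_sub.
  rewrite RintegralB// -(Rint_shift_rV (h_ k *: e) iG) subrr mulr0 //.
have cv0 : \int[lebesgue_rV n]_y q k y @[k --> \oo] --> (0 : R).
  by under eq_fun do rewrite q0; exact: cvg_cst.
by exact: (cvg_unique _ cv cv0).
Qed.

End integral_of_derivative.

Section space_time.
Context {R : realType} {d : nat}.
Local Notation W := (R * 'rV[R]_d)%type.
Implicit Types (f : W -> R) (u : R) (y z xi : 'rV[R]_d).

(** The function factors through the Euclidean space with one more coordinate,
    where continuity gives Borel measurability. *)
Lemma measurable_continuous_prod f : continuous f ->
  measurable_fun setT (fun w : measurableTypeR R * 'rV[R]_d => f (w.1, w.2)).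
Proof.
move=> cf; pose g (v : 'rV[R]_d.+1) := f (v 0 ord0, rsubmx (v : 'rV_(1 + d))).
have cg : continuous g.
  move=> v; apply: (@continuous_comp _ _ _ (fun v : 'rV[R]_d.+1 =>
    (v 0 ord0, rsubmx (v : 'rV_(1 + d)))) f v); last exact: cf.
  have h1 : (fun v : 'rV[R]_d.+1 => v 0 ord0) @ v --> v 0 ord0 by exact: coord_continuous.
  have h2 : (fun v : 'rV[R]_d.+1 => rsubmx (v : 'rV_(1 + d))) @ v --> rsubmx (v : 'rV_(1 + d)).
    exact: continuous_rsubmx.
  exact: (cvg_pair h1 h2).
have -> : (fun w : measurableTypeR R * 'rV[R]_d => f (w.1, w.2)) = g \o (@cons_rV R d).
  apply/funext => -[u z]; rewrite /g /= cons_rV0; congr (f (_, _)).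
  by apply/rowP => i; rewrite mxE -(cons_rVS (u, z)); congr (cons_rV _ _ _); exact/val_inj.
apply: measurableT_comp; last exact: measurable_cons_rV.
exact: measurable_fun_continuous_rV.
Qed.

Lemma Cc_smooth_box f : Cc_smooth f -> exists2 T : R, 0 < T & forall u z,
  (T < `|u| -> f (u, z) = 0) /\ (~ box T z -> f (u, z) = 0).
Proof.
move=> [sf cf]; have [M [Mr HM]] := compact_bounded cf.
pose T := Num.max M 0 + 1.
have T0 : 0 < T by rewrite ltr_wpDl// le_max lexx orbT.
exists T => // u z.
have fT : f (u, z) != 0 -> `|u| <= T /\ `|z| <= T.
  move=> fx; have : `|(u, z)| <= T.
    apply: (HM T); first by rewrite ltr_pwDr// le_max lexx.
    exact: subset_closure.
  by rewrite prod_normE ge_max => /andP.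
split.
  by move=> uT; apply/eqP/negPn/negP => /fT [uT' _]; move: (lt_le_trans uT uT'); rewrite ltxx.
move=> nb; apply/eqP/negPn/negP => /fT [_ zT]; apply: nb => i.
apply: le_trans zT; rewrite -[leRHS]/(mx_norm z) mx_normrE.
exact: (le_bigmax _ (fun ij => `|z ij.1 ij.2|) (0, i)).
Qed.

Lemma derive1_time f u z : smooth f ->
  derive1 (fun t => f (t, z)) u = 'D_((1, 0) : W) f (u, z).
Proof.
move=> sf; pose v : W := (1, 0).
have pt (t : R) : (0, z) + t *: v = (t, z) :> W.
  by congr pair; rewrite /= ?scaler0 ?addr0 ?add0r//; exact: mulr1.
rewrite derive1E (_ : (fun t => f (t, z)) = (fun t : R => f ((0, z) + t *: v))); last first.
  by apply/funext => t; rewrite pt.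
have h := is_derive_line (smooth_differentiable ((0, z) + u *: v) sf).
by rewrite derive_val pt.
Qed.

End space_time.

(** * The operator on test functions *)
Section fourier_cosine.
Context {R : realType} {n : nat}.
Local Notation mu := (@lebesgue_measure R).
Local Notation W := (R * 'rV[R]_n)%type.
Implicit Types (f : W -> R) (u th : R) (x y z xi : 'rV[R]_n).

(** The cosine transform of a time slice, with a phase: shifting the phase by
    [pi / 2] gives the sine transform, so that one real transform carries the
    whole Fourier transform. *)
Definition Fc f u xi th : R := \int[lebesgue_rV n]_y (f (u, y) * cos (dotp y xi + th)).

Definition space_dir (i : 'I_n) : W := (0, delta_mx 0 i).

Lemma Cc_measurable f : Cc_smooth f ->
  measurable_fun setT (fun w : measurableTypeR R * 'rV[R]_n => f (w.1, w.2)).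
Proof. by move=> [sf _]; apply: measurable_continuous_prod; exact: smooth_continuous. Qed.

Lemma Cc_measurable_slice f u : Cc_smooth f -> measurable_fun setT (fun y => f (u, y)).
Proof.
move=> cf; apply: (@measurable_comp2 _ _ _ _ (measurableTypeR R) 'rV[R]_n _ _
  (fun u y => f (u, y)) (fun=> u) id); [exact: Cc_measurable|by []|exact: measurable_id].
Qed.

Lemma Cc_bounds f : Cc_smooth f -> exists M T, [/\ 0 <= M, 0 < T, forall w, `|f w| <= M,
  forall u z, T < `|u| -> f (u, z) = 0 & forall u z, ~ box T z -> f (u, z) = 0].
Proof.
move=> cf; have [M hM] := Cc_smooth_bounded cf; have [T T0 hT] := Cc_smooth_box cf.
exists M, T; split=> //.
- by rewrite (le_trans _ (hM 0)).
- by move=> u z; case: (hT u z).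
- by move=> u z; case: (hT u z).
Qed.

Lemma integrable_Cc f u : Cc_smooth f -> (lebesgue_rV n).-integrable setT (EFin \o (fun y => f (u, y))).
Proof.
move=> cf; have [M [T [M0 T0 fM fT fB]]] := Cc_bounds cf.
apply: (@integrable_box _ _ _ M T) => //; first exact: Cc_measurable_slice.
by move=> v; exact: fB.
Qed.

Lemma integrable_Cc_cos f u xi th : Cc_smooth f ->
  (lebesgue_rV n).-integrable setT (EFin \o (fun y => f (u, y) * cos (dotp y xi + th))).
Proof.
move=> cf; have [M [T [M0 T0 fM fT fB]]] := Cc_bounds cf.
apply: (@integrable_box _ _ _ M T) => //.
- by apply: measurable_funM; [exact: Cc_measurable_slice|meas].
- by move=> v; rewrite normrM -[M]mulr1 ler_pM ?cos_norm_le1.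
- by move=> v vb; rewrite fB// mul0r.
Qed.

(** Integration by parts; the derivative of the cosine is a shift of phase. *)
Lemma Fc_parts f u xi th i : Cc_smooth f ->
  xi 0 i * Fc f u xi th = Fc (fun w => 'D_(space_dir i) f w) u xi (th + pi / 2).
Proof.
move=> cf; pose e : 'rV[R]_n := delta_mx 0 i.
pose Df w := 'D_(space_dir i) f w.
have cDf : Cc_smooth Df by exact: Cc_smooth_derive.
have [M [T [M0 T0 fM _ fB]]] := Cc_bounds cf.
have [M' [T' [M'0 T'0 fM' _ fB']]] := Cc_bounds cDf.
pose th' := th + pi / 2.
pose G y := f (u, y) * cos (dotp y xi + th').
pose G' y := Df (u, y) * cos (dotp y xi + th') - xi 0 i * (f (u, y) * sin (dotp y xi + th')).
have ei : dotp e xi = xi 0 i.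
  rewrite /dotp (bigD1 i)//= big1 ?addr0; first by rewrite /e mxE !eqxx mul1r.
  by move=> j ji; rewrite /e mxE eqxx (negbTE ji) mul0r.
have sinE t : sin (t + th') = cos (t + th) by rewrite /th' addrA sinDpihalf.
have mG' : measurable_fun setT G'.
  apply: measurable_funB.
    by apply: measurable_funM; [exact: (Cc_measurable_slice u cDf)|meas].
  apply: measurable_funM => //; apply: measurable_funM; first exact: Cc_measurable_slice.
  by under [X in measurable_fun _ X]eq_fun do rewrite sinE; meas.
have dG y (h : R) : is_derive h 1 (fun t : R => G (y + t *: e)) (G' (y + h *: e)).
  have pt (t : R) : (u, y) + t *: space_dir i = (u, y + t *: e).
    by congr pair; rewrite /= ?scaler0 ?addr0.
  have -> : (fun t : R => G (y + t *: e)) =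
      (fun t : R => f ((u, y) + t *: space_dir i) * cos (dotp y xi + t * xi 0 i + th')).
    by apply/funext => t; rewrite pt /G dotpDl dotpZl ei.
  have d1 : is_derive h 1 (fun t : R => f ((u, y) + t *: space_dir i)) (Df ((u, y) + h *: space_dir i)).
    by apply: is_derive_line; exact: smooth_differentiable (proj1 cf).
  apply: is_derive_eq.
  rewrite /G' pt dotpDl dotpZl ei /GRing.scale /=; ring.
have h := @Rint_dir_derivative_eq0 R n G G' e (Num.max M (M' + `|xi 0 i| * M)) (Num.max T T') dG.
have E : \int[lebesgue_rV n]_y G' y = 0.
  apply: h => //.
  - by apply: measurable_funM; [exact: Cc_measurable_slice|meas].
  - move=> y; rewrite le_max /G normrM; apply/orP; left.
    by rewrite -[M]mulr1 ler_pM ?cos_norm_le1.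
  - move=> y; rewrite le_max; apply/orP; right.
    rewrite (le_trans (ler_normB _ _))// lerD//.
      by rewrite normrM -[M']mulr1 ler_pM ?cos_norm_le1.
    by rewrite normrM ler_wpM2l// normrM -[M]mulr1 ler_pM ?sin_norm_le1.
  - move=> y nb; rewrite /G fB ?mul0r// => hb; apply: nb => j.
    by rewrite (le_trans (hb j))// le_max lexx.
  - move=> y nb; rewrite /G' fB' ?fB ?mul0r ?mulr0 ?subr0// => hb; apply: nb => j.
      by rewrite (le_trans (hb j))// le_max lexx.
    by rewrite (le_trans (hb j))// le_max lexx orbT.
  - by move=> j; rewrite /e mxE eqxx /=; case: (j == i); rewrite ?normr1 ?normr0.
move: E; rewrite /G' RintegralB//; last 2 first.
- exact: integrable_Cc_cos.
- under [X in _.-integrable _ X]eq_fun do rewrite /= sinE EFinM.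
  by apply: integrableZl => //; exact: integrable_Cc_cos.
under [X in _ - X = _]eq_Rintegral do rewrite sinE.
rewrite RintegralZl//; last exact: integrable_Cc_cos.
by move/eqP; rewrite subr_eq0 => /eqP E; exact: esym E.
Qed.

Lemma Fc_bound f : Cc_smooth f -> exists C : R, forall u xi th, `|Fc f u xi th| <= C.
Proof.
move=> cf; have [M [T [M0 T0 fM fT fB]]] := Cc_bounds cf.
have mb : measurable_fun setT (\1_(box T) : 'rV[R]_n -> R).
  by apply: measurable_indic; exact: measurable_box.
have ib : (lebesgue_rV n).-integrable setT (EFin \o (fun y => M * \1_(box T) y)).
  apply: (@integrable_box _ _ _ M T); first by apply: measurable_funM.
  - move=> y; rewrite indicE normrM ger0_norm//.
    by case: (_ \in _); rewrite ?normr1 ?normr0 ?mulr1 ?mulr0.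
  - by move=> y nb; rewrite indicE memNset// mulr0.
exists (\int[lebesgue_rV n]_y (M * \1_(box T) y)) => u xi th.
apply: normr_Rint_le => //.
  by apply: measurable_funM; [exact: Cc_measurable_slice|meas].
move=> y _; have [yb|nb] := pselect (box T y).
  by rewrite indicE mem_set// mulr1 normrM -[M]mulr1 ler_pM ?cos_norm_le1.
by rewrite fB// mul0r normr0 indicE memNset// mulr0.
Qed.

(** Each factor [lam = 1 + sum_i xi_i ^ 2] costs two derivatives. *)
Lemma Fc_decay m f : Cc_smooth f ->
  exists C : R, forall u xi th, lam xi ^+ m * `|Fc f u xi th| <= C.
Proof.
elim: m f => [|m IH] f cf.
  by have [C hC] := Fc_bound cf; exists C => u xi th; rewrite expr0 mul1r.
have [C0 hC0] := IH f cf.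
pose D2 i w := 'D_(space_dir i) (fun w => 'D_(space_dir i) f w) w.
have cD2 i : Cc_smooth (D2 i) by do 2 apply: Cc_smooth_derive.
have /fin_all_exists[C_ hC_] i : exists C : R, forall u xi th,
    lam xi ^+ m * `|Fc (D2 i) u xi th| <= C by exact: IH.
exists (C0 + \sum_i C_ i) => u xi th.
have -> : lam xi ^+ m.+1 * `|Fc f u xi th| = lam xi ^+ m * `|Fc f u xi th| +
    \sum_i lam xi ^+ m * `|Fc (D2 i) u xi (th + pi / 2 + pi / 2)|.
  rewrite exprSr -mulrA [X in _ * X]mulrDl mul1r mulrDr; congr (_ + _).
  rewrite /dotp mulr_suml mulr_sumr; apply: eq_bigr => i _; congr (_ * _).
  rewrite /D2 -Fc_parts; last exact: Cc_smooth_derive.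
  by rewrite -Fc_parts// !normrM mulrA -normrM ger0_norm// -expr2 sqr_ge0.
by rewrite lerD// ler_sum.
Qed.

Lemma Fc_decay_inv m f : Cc_smooth f ->
  exists2 C : R, 0 <= C & forall u xi th, `|Fc f u xi th| <= C * lam xi ^- m.
Proof.
move=> cf; have [C hC] := Fc_decay m cf; exists C.
  by rewrite (le_trans _ (hC 0 0 0))// mulr_ge0// exprn_ge0// ltW// lam_gt0.
by move=> u xi th; rewrite ler_pdivlMr ?exprn_gt0 ?lam_gt0// mulrC hC.
Qed.

Lemma measurable_Fc f d (T : measurableType d) (fu fth : T -> R) (fxi : T -> 'rV[R]_n) :
  Cc_smooth f ->
  measurable_fun setT fu -> measurable_fun setT fxi -> measurable_fun setT fth ->
  measurable_fun setT (fun t => Fc f (fu t) (fxi t) (fth t)).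
Proof.
move=> cf m1 m2 m3.
apply: (@measurable_Rint _ _ _ _ _ (lebesgue_rV n)
  (fun t y => f (fu t, y) * cos (dotp y (fxi t) + fth t))).
have p1 : measurable_fun setT (fun w : T * 'rV[R]_n => w.1) by exact: measurable_fst.
have p2 : measurable_fun setT (fun w : T * 'rV[R]_n => w.2) by exact: measurable_snd.
have q1 := measurableT_comp m1 p1.
have q2 := measurableT_comp m2 p1.
have q3 := measurableT_comp m3 p1.
apply: measurable_funM.
  exact: (@measurable_comp2 _ _ _ _ (measurableTypeR R) 'rV[R]_n _ _
    (fun u y => f (u, y)) (fun w => fu w.1) snd (Cc_measurable cf) q1 p2).
apply: measurable_cosf; apply: measurable_funD => //.
exact: measurable_dotp.
Qed.

Lemma Fc_inversion f u x : Cc_smooth f ->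
  \int[lebesgue_rV n]_xi Fc f u xi (- dotp xi x) = (2 * pi) ^+ n * f (u, x).
Proof.
move=> cf; have [M [T [M0 T0 fM fT fB]]] := Cc_bounds cf.
have [C C0 hC] := Fc_decay_inv n cf.
have mF : measurable_fun setT (fun xi => Fc f u xi (- dotp xi x)).
  by apply: measurable_Fc => //; meas.
have h1 : \int[lebesgue_rV n]_xi (gauss_cut k xi * Fc f u xi (- dotp xi x)) @[k --> \oo] -->
    (2 * pi) ^+ n * f (u, x).
  have cfx : f (u, y) @[y --> x] --> f (u, x).
    apply: (@continuous_comp _ _ _ (fun y : 'rV[R]_n => (u, y)) f x); last first.
      exact: smooth_continuous (proj1 cf) _.
    have p1 : {for x, continuous (fun _ : 'rV[R]_n => u)} by exact: cst_continuous.
    have p2 : {for x, continuous (fun y : 'rV[R]_n => y)} by exact: cvg_id.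
    exact: (cvg_pair p1 p2).
  have hh := @inversion_cut R n (fun y => f (u, y)) M x 0 (Cc_measurable_slice u cf)
    (fun y => fM (u, y)) (integrable_Cc u cf) cfx.
  rewrite [X in _ * (_ * X)]cos0 [X in _ * X]mulr1 in hh.
  have -> : (fun k => \int[lebesgue_rV n]_xi (gauss_cut k xi * Fc f u xi (- dotp xi x))) =
      (fun k => \int[lebesgue_rV n]_xi (gauss_cut k xi *
        \int[lebesgue_rV n]_y (f (u, y) * cos (dotp xi (x - y) + 0)))).
    apply/funext => k; apply: eq_Rintegral => xi _; congr (_ * _).
    apply: eq_Rintegral => y _; congr (_ * _).
    by rewrite addr0 dotpBr -cosN; congr cos; rewrite (dotpC y) opprB addrC.
  exact: hh.
have h2 : \int[lebesgue_rV n]_xi (gauss_cut k xi * Fc f u xi (- dotp xi x)) @[k --> \oo] -->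
    \int[lebesgue_rV n]_xi Fc f u xi (- dotp xi x).
  apply: (@Rint_dct R _ _ (lebesgue_rV n) setT _ _ _ (fun xi => C * lam xi ^- n)) => //.
  - by move=> k; apply: measurable_funM => //; exact: measurable_gauss_cut.
  - move=> xi _; rewrite -[X in _ --> X]mul1r; apply: cvgMl; exact: gauss_cut_cvg.
  - exact: integrable_scale_lam_inv.
  - move=> k xi _; rewrite normrM (ger0_norm (gauss_cut_ge0 _ _)).
    by rewrite (le_trans _ (hC u xi (- dotp xi x)))// ler_piMl// gauss_cut_le1.
by exact: (cvg_unique _ h2 h1).
Qed.

(** For a real function the complex inversion integral reduces to the cosine
    transform with phase [- dotp xi x]. *)
Lemma relativistic_opE alpha f u x : Cc_smooth f ->
  relativistic_op alpha (fun y => f (u, y)) x =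
  (2 * pi) ^- n * \int[lebesgue_rV n]_xi (psi (alpha / 2) xi * Fc f u xi (- dotp xi x)).
Proof.
move=> cf.
have E xi : fourier (fun y => real_complex R (f (u, y))) xi =
    Complex (Fc f u xi 0) (- Fc f u xi (- (pi / 2))).
  rewrite /fourier /cintegral; congr Complex.
    apply: eq_Rintegral => y _; rewrite /= addr0 mul0r subr0 cosN.
    by rewrite (dotpC xi).
  rewrite /Fc -mulN1r -RintegralZl//; last exact: integrable_Cc_cos.
  apply: eq_Rintegral => y _; rewrite /= mul0r addr0 mulrCA mulN1r sinN.
  by rewrite -sinDpihalf subrK (dotpC xi).
have E2 xi : Fc f u xi (- dotp xi x) = Fc f u xi 0 * cos (dotp xi x) +
    Fc f u xi (- (pi / 2)) * sin (dotp xi x).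
  rewrite /Fc -RintegralZr//; last exact: integrable_Cc_cos.
  rewrite -RintegralZr//; last exact: integrable_Cc_cos.
  rewrite -RintegralD//; last 2 first.
  - under [X in _.-integrable _ X]eq_fun do rewrite /= EFinM.
    by apply: integrableZr => //; exact: integrable_Cc_cos.
  - under [X in _.-integrable _ X]eq_fun do rewrite /= EFinM.
    by apply: integrableZr => //; exact: integrable_Cc_cos.
  apply: eq_Rintegral => y _; rewrite addr0 cosB.
  have -> : cos (dotp y xi - pi / 2) = sin (dotp y xi) by rewrite -sinDpihalf subrK.
  by ring.
rewrite /relativistic_op (_ : fourier (fun y => real_complex R (f (u, y))) =
  fun xi => Complex (Fc f u xi 0) (- Fc f u xi (- (pi / 2)))); last exact/funext.
rewrite /inverse_fourier /cintegral /= mul0r subr0; congr (_ * _).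
apply: eq_Rintegral => xi _; rewrite E2 /psi /lam enormX (addrC 1).
by rewrite !mul0r; ring.
Qed.

End fourier_cosine.

(** * The free equation *)

(** The integrand is the derivative of [exp (- (u - s) c) * f u]. *)
Lemma Rint_duhamel (R : realType) (f f' : R -> R) (c s T : R) :
  (forall u : R, is_derive u 1 f (f' u)) -> continuous f' ->
  (forall u, T < u -> f u = 0) -> (forall u, T < u -> f' u = 0) ->
  \int[lebesgue_measure]_(u in `]s, +oo[) (expR (- ((u - s) * c)) * (f' u - c * f u)) = - f s.
Proof.
move=> df cf' f0 f'0; set mu := lebesgue_measure.
pose g u := expR (- ((u - s) * c)) * (f' u - c * f u).
pose F u := expR (- ((u - s) * c)) * f u.
have dF (u : R) : is_derive u 1 F (g u).
  have d1 := df u; apply: is_derive_eq; rewrite /g /GRing.scale /=; ring.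
have cf : continuous f by exact: is_derive_continuous df.
have cg : continuous g.
  have ce : continuous (fun u : R => expR (- ((u - s) * c))).
    apply: (@is_derive_continuous _ _ (fun u => expR (- ((u - s) * c)) * - c)) => u.
    by apply: is_derive_eq; rewrite /GRing.scale /=; ring.
  move=> u; apply: cvgM; first exact: ce.
  by apply: cvgB; [exact: cf'|apply: cvgMr; exact: cf].
pose T' := Num.max s T + 1.
have sT : s < T' by rewrite ltr_pwDr// le_max lexx.
have TT : T < T' by rewrite ltr_pwDr// le_max lexx orbT.
have g0 u : T' < u -> g u = 0.
  by move=> uT; rewrite /g f'0 ?f0 ?(lt_trans TT)// mulr0 subr0 mulr0.
have ig : mu.-integrable `[s, T'] (EFin \o g).
  apply: continuous_compact_integrable; first exact: segment_compact.
  exact: continuous_subspaceT.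
have ig' : mu.-integrable `]s, T'] (EFin \o g).
  apply: integrableS ig => //.
  by move=> u /=; rewrite !in_itv/= => /andP[su ->]; rewrite ltW.
transitivity (\int[mu]_(u in `]s, T']) g u).
  rewrite [LHS]Rint_indic [RHS]Rint_indic; apply: eq_Rintegral => u _.
  rewrite -/(g u) !indicE !mem_setE !in_itv/= andbT.
  by have [uT|uT] := leP u T'; [rewrite andbT|rewrite g0 ?mul0r].
rewrite (Rintegral_itv_obnd_cbnd ig') (Rint_FTC sT dF cg).
by rewrite /F f0// mulr0 subrr mul0r oppr0 expR0 mul1r sub0r.
Qed.

Lemma integrable_Fc (R : realType) n (f : R * 'rV[R]_n -> R) u z : Cc_smooth f ->
  (lebesgue_rV n).-integrable setT (EFin \o (fun xi => Fc f u xi (- dotp xi z))).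
Proof.
move=> cf; have [C C0 hC] := Fc_decay_inv n cf.
apply: (integrable_dom measurableT (g := fun xi => C * lam xi ^- n)) => //.
- by apply: measurable_Fc => //; meas.
- exact: integrable_scale_lam_inv.
Qed.

Section free_equation.
Context {R : realType} {n : nat}.
Local Notation mu := (@lebesgue_measure R).
Local Notation W := (R * 'rV[R]_n)%type.
Implicit Types (u s : R) (x y z xi : 'rV[R]_n).
Variables (alpha : R) (phi : W -> R).
Local Notation a := (alpha / 2).
Hypotheses (a_gt0 : 0 < a) (a_lt1 : a < 1) (cphi : Cc_smooth phi).
Local Notation pker := (@pker R n a).
Local Notation psi := (@psi R n a).
Local Notation heat := (@heat R n a).

Definition free_op u z : R :=
  derive1 (fun t => phi (t, z)) u - relativistic_op alpha (fun y => phi (u, y)) z.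

Let dphi w := 'D_((1, 0) : W) phi w.

Let cdphi : Cc_smooth dphi. Proof. exact: Cc_smooth_derive. Qed.

(* The integrand of the inversion formula for [free_op u z]. *)
Let S u xi z := Fc dphi u xi (- dotp xi z) - psi xi * Fc phi u xi (- dotp xi z).

Let psi_le xi : psi xi <= lam xi.
Proof.
have l0 := lam_gt0 xi.
by rewrite -[leRHS]powRr1 ?(ltW l0)//; apply: ler_powR; [exact: lam_ge1|exact: ltW].
Qed.

Let S_dom : exists C T : R, [/\ 0 <= C, 0 < T, forall u xi z, `|S u xi z| <= C * lam xi ^- n &
  forall u xi z, T < `|u| -> S u xi z = 0].
Proof.
have [C1 C10 h1] := Fc_decay_inv n cdphi.
(* The extra power of [lam] pays for the factor [psi <= lam]. *)
have [C2 C20 h2] := Fc_decay_inv n.+1 cphi.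
have [M1 [T1 [_ T10 _ f1 _]]] := Cc_bounds cdphi.
have [M2 [T2 [_ T20 _ f2 _]]] := Cc_bounds cphi.
exists (C1 + C2), (T1 + T2); split; [exact: addr_ge0|exact: addr_gt0| |].
  move=> u xi z; rewrite (le_trans (ler_normB _ _))// mulrDl lerD// normrM.
  have p0 := ltW (@psi_gt0 R n a a_gt0 xi); have l0 := lam_gt0 xi.
  rewrite (ger0_norm p0) (le_trans (ler_wpM2l p0 (h2 _ _ _)))//.
  rewrite mulrCA ler_wpM2l// exprS invfM mulrA ler_piMl ?invr_ge0 ?exprn_ge0 ?(ltW l0)//.
  by rewrite ler_pdivrMr// mul1r.
move=> u xi z uT.
have Fc0 f : (forall y, f (u, y) = 0) -> Fc f u xi (- dotp xi z) = 0.
  by move=> f0; rewrite /Fc; under eq_Rintegral do rewrite f0 mul0r; rewrite Rintegral_cst// mul0r.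
rewrite /S !Fc0 ?mulr0 ?subr0// => y.
- by apply: f2; apply: le_lt_trans uT; rewrite lerDr ltW.
- by apply: f1; apply: le_lt_trans uT; rewrite lerDl ltW.
Qed.

Let measurable_S d (T : measurableType d) (fu : T -> R) (fxi fz : T -> 'rV[R]_n) :
  measurable_fun setT fu -> measurable_fun setT fxi -> measurable_fun setT fz ->
  measurable_fun setT (fun t => S (fu t) (fxi t) (fz t)).
Proof.
move=> m1 m2 m3; apply: measurable_funB; first by apply: measurable_Fc => //; meas.
by apply: measurable_funM; [exact: measurable_psi|apply: measurable_Fc => //; meas].
Qed.

Let integrable_S u z : (lebesgue_rV n).-integrable setT (EFin \o (fun xi => S u xi z)).
Proof.
have [C [T [C0 T0 SC _]]] := S_dom.
apply: (integrable_dom measurableT (g := fun xi => C * lam xi ^- n)) => //.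
- by apply: measurable_S; meas.
- exact: integrable_scale_lam_inv.
Qed.

Let free_opE u z : free_op u z = (2 * pi) ^- n * \int[lebesgue_rV n]_xi S u xi z.
Proof.
rewrite /free_op derive1_time; last exact: proj1 cphi.
rewrite relativistic_opE// -/(dphi (u, z)).
have i1 := integrable_Fc u z cdphi.
have i2 : (lebesgue_rV n).-integrable setT (EFin \o (fun xi => psi xi * Fc phi u xi (- dotp xi z))).
  have -> : (fun xi => psi xi * Fc phi u xi (- dotp xi z)) =
      (fun xi => Fc dphi u xi (- dotp xi z) - S u xi z).
    by apply/funext => xi; rewrite /S opprB addrC subrK.
  by apply: integrable_sub => //; exact: integrable_S.
rewrite RintegralB// Fc_inversion// mulrBr mulrA mulVf ?mul1r//.
by rewrite gt_eqF// twopi_gt0.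
Qed.

Lemma measurable_free_op :
  measurable_fun setT (fun w : measurableTypeR R * 'rV[R]_n => free_op w.1 w.2).
Proof.
have -> : (fun w : measurableTypeR R * 'rV[R]_n => free_op w.1 w.2) =
    (fun w => (2 * pi) ^- n * \int[lebesgue_rV n]_xi S w.1 xi w.2).
  by apply/funext => w; rewrite free_opE.
apply: measurable_funM; first exact: measurable_cst.
apply: (@measurable_Rint _ _ _ _ _ (lebesgue_rV n)
  (fun (w : measurableTypeR R * 'rV[R]_n) xi => S w.1 xi w.2)).
apply: measurable_S.
- exact: measurableT_comp measurable_fst measurable_fst.
- exact: measurable_snd.
- exact: measurableT_comp measurable_snd measurable_fst.
Qed.

Lemma free_op_bounds : exists M T : R, [/\ 0 <= M, 0 < T, forall u z, `|free_op u z| <= M &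
  forall u z, T < `|u| -> free_op u z = 0].
Proof.
have [C [T [C0 T0 SC ST]]] := S_dom.
have ig := integrable_scale_lam_inv (R := R) n C.
have p0 := twopi_gt0 (R := R) (n := n).
exists ((2 * pi) ^- n * \int[lebesgue_rV n]_xi (C * lam xi ^- n)), T; split=> //.
- rewrite mulr_ge0 ?invr_ge0 ?(ltW p0)//; apply: Rintegral_ge0 => xi _.
  by rewrite mulr_ge0// invr_ge0 exprn_ge0// ltW// lam_gt0.
- move=> u z; rewrite free_opE normrM ger0_norm ?invr_ge0 ?(ltW p0)//.
  rewrite ler_wpM2l ?invr_ge0 ?(ltW p0)//.
  by apply: normr_Rint_le => //; apply: measurable_S; meas.
- move=> u z uT; rewrite free_opE; under eq_Rintegral do rewrite ST//.
  by rewrite Rintegral_cst// mul0r mulr0.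
Qed.

Let SE u xi z : S u xi z = \int[lebesgue_rV n]_y
  ((dphi (u, y) - psi xi * phi (u, y)) * cos (dotp y xi - dotp xi z)).
Proof.
rewrite /S /Fc -RintegralZl//; last exact: integrable_Cc_cos.
rewrite -RintegralB//; last 2 first.
- exact: integrable_Cc_cos.
- by apply: integrable_scalel => //; exact: integrable_Cc_cos.
by apply: eq_Rintegral => y _; ring.
Qed.

(* As a function of [z], [S u xi z] is a superposition of plane waves of
   frequency [xi]. *)
Let pker_S t u xi x : 0 < t ->
  \int[lebesgue_rV n]_z (pker t (z - x) * S u xi z) = heat t xi * S u xi x.
Proof.
move=> t0; under eq_Rintegral do rewrite SE.
have [M1 [T1 [M10 T10 b1 _ f1]]] := Cc_bounds cdphi.
have [M2 [T2 [M20 T20 b2 _ f2]]] := Cc_bounds cphi.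
pose w y := dphi (u, y) - psi xi * phi (u, y).
have mw : measurable_fun setT w.
  apply: measurable_funB; first exact: Cc_measurable_slice.
  by apply: measurable_funM => //; exact: Cc_measurable_slice.
have iw : (lebesgue_rV n).-integrable setT (EFin \o w).
  apply: integrable_sub => //; first exact: integrable_Cc.
  by apply: integrable_scalel => //; exact: integrable_Cc.
have iw' := integrable_normr measurableT iw.
have h := @Rint_pker_superposition R n a a_gt0 a_lt1 _ 'rV[R]_n (lebesgue_rV n)
  (fun y z => w y * cos (dotp y xi - dotp xi z)) (fun=> heat t xi) (fun y => `|w y|) t x t0.
rewrite h//.
- rewrite SE -RintegralZl//.
  apply: (integrable_dom measurableT (g := fun y => `|w y|)) => //; first by meas.
  by move=> y _; rewrite normrM ler_piMr// cos_norm_le1.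
- by apply: measurable_funM; [exact: (measurableT_comp mw)|meas].
- by move=> y z; rewrite normrM ler_piMr// cos_norm_le1.
move=> y.
have E z : cos (dotp y xi - dotp xi z) = cos (dotp z xi + - dotp y xi).
  by rewrite -cosN opprB (dotpC z).
have ip : (lebesgue_rV n).-integrable setT
    (EFin \o (fun z => pker t (z - x) * cos (dotp z xi + - dotp y xi))).
  apply: (integrable_dom measurableT (g := fun z => pker t (z - x))) => //.
  - by apply: measurable_funM; [apply: measurable_pker; meas|meas].
  - exact: integrable_pker.
  - move=> z _; have p0 := ltW (pker_gt0 a_gt0 a_lt1 (z - x) t0).
    by rewrite normrM (ger0_norm p0) ler_piMr// cos_norm_le1.
transitivity (w y * \int[lebesgue_rV n]_z (pker t (z - x) * cos (dotp z xi + - dotp y xi))).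
  by rewrite -RintegralZl//; apply: eq_Rintegral => z _; rewrite E mulrCA.
by rewrite Rint_pker_cos// E mulrCA.
Qed.

Let pker_free_op t u x : 0 < t ->
  \int[lebesgue_rV n]_z (pker t (z - x) * free_op u z) =
  (2 * pi) ^- n * \int[lebesgue_rV n]_xi (heat t xi * S u xi x).
Proof.
move=> t0; have [C [T [C0 T0 SC ST]]] := S_dom.
have ig := integrable_scale_lam_inv (R := R) n C.
have [M [T' [M0 _ fM _]]] := free_op_bounds.
have h := @Rint_pker_superposition R n a a_gt0 a_lt1 _ 'rV[R]_n (lebesgue_rV n)
  (fun xi z => S u xi z) (heat t) (fun xi => C * lam xi ^- n) t x t0.
rewrite -h//; last 2 first.
- by apply: measurable_S; meas.
- by move=> xi; exact: pker_S.
have mS : measurable_fun setT (fun z => \int[lebesgue_rV n]_xi S u xi z).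
  apply: (@measurable_Rint _ _ _ _ _ (lebesgue_rV n) (fun z xi => S u xi z)).
  by apply: measurable_S; meas.
rewrite -RintegralZl//.
  by apply: eq_Rintegral => z _; rewrite free_opE mulrCA.
apply: (integrable_dom measurableT (g := fun z => ((2 * pi) ^+ n * M) * pker t (z - x))) => //.
- by apply: measurable_funM => //; apply: measurable_pker; meas.
- by apply: integrable_scalel => //; exact: integrable_pker.
- move=> z _; have p0 := ltW (pker_gt0 a_gt0 a_lt1 (z - x) t0).
  rewrite normrM (ger0_norm p0) mulrC; apply: ler_wpM2r => //.
  have q0 := twopi_gt0 (R := R) (n := n).
  have := fM u z; rewrite free_opE normrM ger0_norm ?invr_ge0 ?(ltW q0)//.
  by rewrite ler_pdivrMl.
Qed.

(** After the inversion formula the space integral multiplies the frequency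
    [xi] by [heat (u - s) xi], and the time integral becomes the scalar variation
    of constants with rate [psi xi]. *)
Lemma pker_free_identity s x :
  \int[mu]_(u in `]s, +oo[) \int[lebesgue_rV n]_z (pker (u - s) (z - x) * free_op u z) =
  - phi (s, x).
Proof.
have [C [T [C0 T0 SC ST]]] := S_dom.
have ig := integrable_scale_lam_inv (R := R) n C.
have [M1 [T1 [M10 T10 b1 t1 f1]]] := Cc_bounds cdphi.
have [M2 [T2 [M20 T20 b2 t2 f2]]] := Cc_bounds cphi.
pose D : set (measurableTypeR R) := `]s, +oo[%classic.
have mD : measurable D by exact: measurable_itv.
have DP u : u \in D -> 0 < u - s by rewrite inE /D/= in_itv/= andbT subr_gt0.
have q0 := twopi_gt0 (R := R) (n := n).
pose K := Num.max T (T1 + T2).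
have iI : mu.-integrable setT (EFin \o (\1_(`[- K, K]%classic : set (measurableTypeR R)))).
  exact: integrable_indic_itv.
have IK (u : R) : \1_(`[- K, K]%classic : set (measurableTypeR R)) (u : measurableTypeR R) = (`|u| <= K)%R%:R :> R.
  by rewrite indicE mem_setE in_itv/= -ler_norml.
pose G u xi := heat (u - s) xi * S u xi x * \1_D u.
have mind : measurable_fun setT (\1_D : measurableTypeR R -> R).
  exact: measurable_indic.
have mG : measurable_fun setT (fun p : measurableTypeR R * 'rV[R]_n => G p.1 p.2).
  apply: measurable_funM; last exact: (measurableT_comp mind).
  by apply: measurable_funM; [apply: measurable_heat; meas|apply: measurable_S; meas].
have Gdom u xi : `|G u xi| <= \1_(`[- K, K]%classic : set (measurableTypeR R)) u * (C * lam xi ^- n).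
  have Cl : 0 <= C * lam xi ^- n by rewrite mulr_ge0// invr_ge0 exprn_ge0// ltW// lam_gt0.
  rewrite IK; have [uK|uK] := leP `|u| K; last first.
    by rewrite /G ST ?mulr0 ?mul0r ?normr0//; apply: le_lt_trans uK; rewrite le_max lexx.
  rewrite mul1r /G indicE; case: (boolP (u \in D)) => [/DP us|_]; last by rewrite mulr0 normr0.
  rewrite mulr1 normrM (ger0_norm (ltW (heat_gt0 _ _ _))) (le_trans _ (SC u xi x))//.
  by rewrite ler_piMl// heat_le1// ltW.
transitivity ((2 * pi) ^- n * \int[mu]_u \int[lebesgue_rV n]_xi G u xi).
  rewrite -RintegralZl//; last exact: (tensor_Rint_integrable mG iI ig Gdom).
  rewrite Rint_indic; apply: eq_Rintegral => u _.
  rewrite /G indicE; case: (boolP (u \in D)) => [/DP us|_].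
    by rewrite mulr1 pker_free_op//; congr (_ * _); apply: eq_Rintegral => xi _; rewrite mulr1.
  by rewrite mulr0; under eq_Rintegral do rewrite mulr0; rewrite Rintegral_cst// mul0r mulr0.
rewrite (swap_Rint mG iI ig Gdom).
have inner xi : \int[mu]_u G u xi = - Fc phi s xi (- dotp xi x).
  pose P u y := expR (- ((u - s) * psi xi)) * (dphi (u, y) - psi xi * phi (u, y)) * \1_D u.
  pose H u y := cos (dotp y xi - dotp xi x) * P u y.
  have mP : measurable_fun setT (fun p : measurableTypeR R * 'rV[R]_n => P p.1 p.2).
    apply: measurable_funM; last exact: (measurableT_comp mind).
    apply: measurable_funM; first by meas.
    have m1 : measurable_fun setT (fun p : measurableTypeR R * 'rV[R]_n => dphi (p.1, p.2)).
      exact: Cc_measurable.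
    have m2 : measurable_fun setT (fun p : measurableTypeR R * 'rV[R]_n => phi (p.1, p.2)).
      exact: Cc_measurable.
    by apply: measurable_funB => //; apply: measurable_funM.
  have mH : measurable_fun setT (fun p : measurableTypeR R * 'rV[R]_n => H p.1 p.2).
    by apply: measurable_funM; first by meas.
  have p0 := @psi_gt0 R n a a_gt0 xi.
  pose B y := (M1 + psi xi * M2) * \1_(box (T1 + T2)) y.
  have iB : (lebesgue_rV n).-integrable setT (EFin \o B).
    apply: integrable_scalel => //; apply: (@integrable_box _ _ _ 1 (T1 + T2)) => //.
    - by apply: measurable_indic; exact: measurable_box.
    - by move=> y; rewrite indicE; case: (_ \in _); rewrite ?normr1 ?normr0.
    - by move=> y nb; rewrite indicE memNset.
  have B0 y : 0 <= B y by rewrite mulr_ge0// addr_ge0// mulr_ge0// ltW.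
  have Pdom u y : `|P u y| <= \1_(`[- K, K]%classic : set (measurableTypeR R)) u * B y.
    rewrite IK; have [uK|uK] := leP `|u| K; last first.
      rewrite /P t1 ?t2 ?mulr0 ?subr0 ?mulr0 ?mul0r ?mulr0 ?normr0//.
        by apply: le_lt_trans uK; rewrite !le_max lerDr (ltW T10) !orbT.
      by apply: le_lt_trans uK; rewrite !le_max lerDl (ltW T20) !orbT.
    rewrite mul1r; have [yb|nb] := pselect (box (T1 + T2) y); last first.
      rewrite /P f1 ?f2 ?mulr0 ?subr0 ?mulr0 ?mul0r ?mulr0 ?normr0 ?B0//.
        by move=> hb; apply: nb => i; rewrite (le_trans (hb i))// lerDr ltW.
      by move=> hb; apply: nb => i; rewrite (le_trans (hb i))// lerDl ltW.
    have -> : B y = M1 + psi xi * M2 by rewrite /B indicE mem_set// mulr1.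
    rewrite /P indicE.
    case: (boolP (u \in D)) => [/DP us|_]; last first.
      by rewrite mulr0 normr0 addr_ge0// mulr_ge0// ltW.
    rewrite mulr1 normrM (ger0_norm (expR_ge0 _)).
    apply: (@le_trans _ _ `|dphi (u, y) - psi xi * phi (u, y)|).
      apply: ler_piMl => //; rewrite -[leRHS]expR0 ler_expR oppr_le0.
      by apply: mulr_ge0; exact: ltW.
    rewrite (le_trans (ler_normB _ _))// lerD// normrM (ger0_norm (ltW p0)).
    by rewrite ler_wpM2l// ltW.
  have Hdom u y : `|H u y| <= \1_(`[- K, K]%classic : set (measurableTypeR R)) u * B y.
    by apply: le_trans (Pdom u y); rewrite normrM ler_piMl// cos_norm_le1.
  transitivity (\int[mu]_u \int[lebesgue_rV n]_y H u y).
    apply: eq_Rintegral => u _; rewrite /G SE.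
    have i1 : (lebesgue_rV n).-integrable setT (EFin \o (fun y =>
        (dphi (u, y) - psi xi * phi (u, y)) * cos (dotp y xi - dotp xi x))).
      have -> : (fun y => (dphi (u, y) - psi xi * phi (u, y)) * cos (dotp y xi - dotp xi x)) =
         (fun y => dphi (u, y) * cos (dotp y xi - dotp xi x) -
            psi xi * (phi (u, y) * cos (dotp y xi - dotp xi x))).
        by apply/funext => y; ring.
      apply: integrable_sub => //; first exact: integrable_Cc_cos.
      by apply: integrable_scalel => //; exact: integrable_Cc_cos.
    rewrite mulrAC -RintegralZl//; apply: eq_Rintegral => y _.
    by rewrite /H /P /heat; ring.
  rewrite (swap_Rint mH iI iB Hdom) /Fc -mulN1r -RintegralZl//; last exact: integrable_Cc_cos.
  apply: eq_Rintegral => y _.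
  have df (u : R) : is_derive u 1 (fun t : R => phi (t, y)) (dphi (u, y)).
    have pt (t : R) : (0, y) + t *: ((1, 0) : W) = (t, y) :> W.
      by congr pair; rewrite /= ?scaler0 ?addr0 ?add0r//; exact: mulr1.
    rewrite (_ : (fun t => phi (t, y)) = (fun t : R => phi ((0, y) + t *: ((1, 0) : W)))); last first.
      by apply/funext => t; rewrite pt.
    rewrite -pt; apply: is_derive_line; exact: smooth_differentiable (proj1 cphi).
  have cdf : continuous (fun u : R => dphi (u, y)).
    move=> u; have g1 : {for u, continuous (fun t : R => t)} by exact: cvg_id.
    have g2 : {for u, continuous (fun _ : R => y)} by exact: cst_continuous.
    have g3 : {for u, continuous (fun t : R => (t, y))} by exact: (cvg_pair g1 g2).
    apply: (@continuous_comp _ _ _ (fun t : R => (t, y)) dphi u) => //.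
    exact: smooth_continuous (proj1 cdphi) _.
  have z1 u : T1 + T2 < u -> dphi (u, y) = 0.
    move=> uT; apply: t1; apply: lt_le_trans (ler_norm u); apply: le_lt_trans uT.
    by rewrite lerDl ltW.
  have z2 u : T1 + T2 < u -> phi (u, y) = 0.
    move=> uT; apply: t2; apply: lt_le_trans (ler_norm u); apply: le_lt_trans uT.
    by rewrite lerDr ltW.
  have E := @Rint_duhamel R (fun t => phi (t, y)) (fun t => dphi (t, y)) (psi xi) s _ df cdf z2 z1.
  have iP : mu.-integrable setT (EFin \o (fun u => P u y)).
    apply: (@integrable_dom R _ _ mu setT measurableT _ (fun u =>
      B y * \1_(`[- K, K]%classic : set (measurableTypeR R)) u)).
    - exact: (measurableT_comp mP (measurable_pair2 y)).
    - exact: integrable_scalel.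
    - by move=> u _; rewrite mulrC; exact: Pdom.
  rewrite /H RintegralZl// -Rint_indic E.
  by rewrite mulN1r mulrN mulrC.
under eq_Rintegral do rewrite inner.
under eq_Rintegral do rewrite -mulN1r.
rewrite RintegralZl//; last exact: integrable_Fc.
by rewrite Fc_inversion// mulN1r mulrN mulrA mulVf ?mul1r// gt_eqF.
Qed.

End free_equation.

(** * Space-time kernels *)
Section space_time_measure.
Context {R : realType} {n : nat}.
Local Notation E := (measurableTypeR R * 'rV[R]_n)%type.

(** The product measure under a name of its own, to which sigma-finiteness is
    attached. *)
Definition stm : set E -> \bar R := (@lebesgue_measure R \x lebesgue_rV n)%E.

HB.instance Definition _ := Measure.copy stm (@lebesgue_measure R \x lebesgue_rV n)%E.

Let stm_sigma_finite : sigma_finite setT stm.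
Proof.
have /sigma_finiteP[F [TF ndF Foo]] := sigma_finiteT (@lebesgue_measure R).
have /sigma_finiteP[G [TG ndG Goo]] := sigma_finiteT (lebesgue_rV (R := R) n).
exists (fun k => F k `*` G k).
  rewrite -setXTT TF TG; apply/seteqP; split=> [[x y]|[x y] [k _ [/= ? ?]]].
    move=> [/= [k _ Fkx] [m _ Gmy]]; exists (maxn k m) => //; split.
      by move: x Fkx; exact/subsetPset/ndF/leq_maxl.
    by move: y Gmy; exact/subsetPset/ndG/leq_maxr.
  by split; exists k.
move=> k; have [? ?] := Foo k; have [? ?] := Goo k.
split; first exact: measurableX.
by rewrite /stm product_measure1E// lte_mul_pinfty// ge0_fin_numE.
Qed.

HB.instance Definition _ := @Measure_isSigmaFinite.Build _ _ _ stm stm_sigma_finite.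

Lemma stm_tonelli (f : E -> \bar R) : measurable_fun setT f -> (forall w, 0 <= f w)%E ->
  (\int[stm]_w f w = \int[lebesgue_measure]_u \int[lebesgue_rV n]_z f (u, z))%E.
Proof. by move=> mf f0; exact: (@fubini_tonelli1 _ _ _ _ R lebesgue_measure (lebesgue_rV n) f mf f0). Qed.

Lemma stm_shift (s : R) (f : E -> \bar R) : measurable_fun setT f -> (forall w, 0 <= f w)%E ->
  (\int[stm]_w f w = \int[stm]_w f ((s + w.1)%R, w.2))%E.
Proof.
move=> mf f0.
have mfs : measurable_fun setT (fun w : E => f ((s + w.1)%R, w.2)).
  apply: (measurableT_comp mf); apply: measurable_fun_pair; by meas.
rewrite (stm_tonelli mf f0) (stm_tonelli mfs (fun w => f0 _)).
rewrite (@ge0_integral_affine R s 1)//; last 2 first.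
- apply: (@measurable_fun_fubini_tonelli_F _ _ (measurableTypeR R) 'rV[R]_n R (lebesgue_rV n) f) => //.
- by move=> t; exact: integral_ge0.
by rewrite mul1e; apply: eq_integral => t _; rewrite mul1r.
Qed.

End space_time_measure.

Section space_time_kernel.
Context {R : realType} {n : nat}.
Local Notation mu := (@lebesgue_measure R).
Local Notation E := (measurableTypeR R * 'rV[R]_n)%type.
Local Notation pos := (`]0, +oo[%classic : set (measurableTypeR R)).
Implicit Types (x z xi : 'rV[R]_n) (t s u : R) (w : E).
Variable a : R.
Hypotheses (a_gt0 : 0 < a) (a_lt1 : a < 1).
Local Notation pker := (@pker R n a).

(** The free kernel from the space-time point [w] to the later point [w']. *)
Definition tker w w' : \bar R :=
  (\1_pos (w'.1 - w.1) * (pker (w'.1 - w.1) (w'.2 - w.2) * nz w'.2))%:E.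

Lemma tker_real_ge0 w w' : 0 <= \1_pos (w'.1 - w.1) * (pker (w'.1 - w.1) (w'.2 - w.2) * nz w'.2) :> R.
Proof.
rewrite indicE mem_setE in_itv/= andbT.
have [h|h] := ltP 0 (w'.1 - w.1); last by rewrite mul0r.
rewrite mul1r; exact: (mulr_ge0 (ltW (pker_gt0 a_gt0 a_lt1 _ h)) (nz_ge0 _)).
Qed.

Lemma tker_ge0 w w' : (0 <= tker w w')%E.
Proof. by rewrite lee_fin tker_real_ge0. Qed.

Lemma tker_off w w' : w'.2 = 0 -> tker w w' = 0%E.
Proof. by move=> h; rewrite /tker /nz h eqxx !mulr0. Qed.

Lemma tkerE s u x z : s < u -> z != 0 -> tker (s, x) (u, z) = (pker (u - s) (z - x))%:E.
Proof.
move=> su z0; rewrite /tker/= indicE mem_setE in_itv/= andbT subr_gt0 su /nz z0.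
by rewrite mul1r mulr1.
Qed.

Lemma measurable_tker : measurable_fun setT (fun p : E * E => tker p.1 p.2).
Proof.
have m11 : measurable_fun setT (fun p : E * E => p.1.1).
  exact: measurableT_comp measurable_fst measurable_fst.
have m12 : measurable_fun setT (fun p : E * E => p.1.2).
  exact: measurableT_comp measurable_snd measurable_fst.
have m21 : measurable_fun setT (fun p : E * E => p.2.1).
  exact: measurableT_comp measurable_fst measurable_snd.
have m22 : measurable_fun setT (fun p : E * E => p.2.2).
  exact: measurableT_comp measurable_snd measurable_snd.
have md : measurable_fun setT (fun p : E * E => p.2.1 - p.1.1 : measurableTypeR R).
  exact: measurable_funB.
apply/measurable_EFinP; apply: measurable_funM.
  apply: (@measurableT_comp _ _ _ _ _ _ (\1_pos : measurableTypeR R -> R)) md.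
  by apply: measurable_indic; exact: measurable_itv.
apply: measurable_funM; last exact: measurable_nz.
by apply: measurable_pker => //; meas.
Qed.

Lemma tker_shift s w w' : tker (s + w.1, w.2) (s + w'.1, w'.2) = tker w w'.
Proof. by rewrite /tker /= opprD addrACA subrr add0r. Qed.

Variables (b kap : R).
Hypotheses (b_gt0 : 0 < b) (kap_gt0 : 0 < kap).

(** An exponential weight in time turns the space-time kernel into the
    resolvent; this transfers the supersolution to space-time. *)
Lemma kop_tker_resolvent (f : 'rV[R]_n -> R) s x :
  measurable_fun setT f -> (forall z, 0 <= f z) ->
  kop stm tker (fun w => (expR (- (kap * w.1)) * f w.2)%:E) (s, x) =
  ((expR (- (kap * s)))%:E * rop a kap f x)%E.
Proof.
move=> mf f0; rewrite /kop.
have mk : measurable_fun setT (tker (s, x)).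
  exact: measurable_section (s, x) measurable_tker.
have mF : measurable_fun setT (fun w : E => (tker (s, x) w * (expR (- (kap * w.1)) * f w.2)%:E)%E).
  apply: emeasurable_funM => //; apply/measurable_EFinP; apply: measurable_funM; first by meas.
  exact: (measurableT_comp mf).
rewrite (stm_shift s) //; last first.
  by move=> w; rewrite mule_ge0 ?tker_ge0// lee_fin mulr_ge0 ?expR_ge0.
rewrite stm_tonelli; last 2 first.
- apply: (measurableT_comp mF); apply: measurable_fun_pair; by meas.
- by move=> w; rewrite mule_ge0 ?tker_ge0// lee_fin mulr_ge0 ?expR_ge0.
rewrite (rop_tonelli kap a_gt0 a_lt1)//.
have mI : measurable_fun setT (fun w : E => (rker a kap x (w.1, w.2) * f w.2)%:E).
  apply/measurable_EFinP; apply: measurable_funM; last exact: (measurableT_comp mf).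
  by apply: measurable_rker; meas.
have I0 w : (0 <= (rker a kap x (w.1, w.2) * f w.2)%:E)%E.
  by rewrite lee_fin (mulr_ge0 (rker_ge0 kap a_gt0 a_lt1 _ _) (f0 _)).
rewrite -ge0_integralZl//=; last 2 first.
- exact: (@measurable_fun_fubini_tonelli_F _ _ (measurableTypeR R) 'rV[R]_n R (lebesgue_rV n)
    (fun w => (rker a kap x (w.1, w.2) * f w.2)%:E) mI I0).
- by move=> t _; apply: integral_ge0 => z _; exact: (I0 (t, z)).
apply: eq_integral => t _.
rewrite -ge0_integralZl//=; last 2 first.
- exact: measurableT_comp mI (measurable_pair1 t).
- by move=> z _; exact: (I0 (t, z)).
apply: eq_integral => z _.
rewrite /tker /rker /= (_ : s + t - s = t); last by ring.
rewrite -!EFinM mulrDr opprD expRD; congr EFin.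
by move: (pker t (z - x)) => p; ring.
Qed.

End space_time_kernel.

(** * The perturbed kernel *)
Section perturbed_kernel.
Context {R : realType} {n : nat}.
Local Notation mu := (@lebesgue_measure R).
Local Notation E := (measurableTypeR R * 'rV[R]_n)%type.
Local Notation pos := (`]0, +oo[%classic : set (measurableTypeR R)).
Implicit Types (x z : 'rV[R]_n) (t s u T M : R) (w : E) (G : E -> R).
Variables (a b : R).
Hypotheses (n_gt0 : (0 < n)%N) (a_gt0 : 0 < a) (a_lt1 : a < 1) (b_gt0 : 0 < b).
Local Notation pker := (@pker R n a).
Local Notation tk := (@tker R n a).

Definition hpot z : R := bes b 0 z / bes (b + a) 0 z.

Lemma hpot_ge0 z : 0 <= hpot z.
Proof. by rewrite divr_ge0 ?bes_ge0 ?addr_gt0. Qed.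

Lemma measurable_hpot : measurable_fun setT hpot.
Proof.
apply: measurable_funM; first exact: measurable_bes.
by apply: measurable_invf; [move=> z; apply: bes_ge0; exact: addr_gt0|exact: measurable_bes].
Qed.

Definition hq w : \bar R := (hpot w.2)%:E.

Let hq_ge0 w : (0 <= hq w)%E. Proof. by rewrite lee_fin hpot_ge0. Qed.

Lemma measurable_hq : measurable_fun setT hq.
Proof. by apply/measurable_EFinP; apply: (measurableT_comp measurable_hpot); meas. Qed.

Let mk := @measurable_tker R n a.
Let k0 := @tker_ge0 R n a a_gt0 a_lt1.

Definition hker : E -> E -> \bar R := kpert stm tk hq.

Lemma hker_ge0 w w' : (0 <= hker w w')%E.
Proof. exact: kpert_ge0. Qed.

Lemma measurable_hker : measurable_fun setT (fun p : E * E => hker p.1 p.2).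
Proof.
by apply: measurable_kpert; [exact: mk|exact: k0|exact: measurable_hq|exact: hq_ge0].
Qed.

Lemma hker_off w w' : w'.1 <= w.1 \/ w'.2 = 0 -> hker w w' = 0%E.
Proof.
move=> ww'; apply: eseries0 => m _ _.
elim: m w ww' => [|m IH] w ww' /=.
  case: ww' => [ww'|]; last exact: tker_off.
  by rewrite /tker indicE mem_setE in_itv/= andbT subr_gt0 ltNge ww' /= mul0r.
apply: integral0_eq => v _.
have [wv|wv] := leP v.1 w.1.
  by rewrite /tker indicE mem_setE in_itv/= andbT subr_gt0 ltNge wv /= mul0r mul0e.
rewrite IH ?mule0//; case: ww' => [ww'|]; [left|by right].
exact: le_trans ww' (ltW wv).
Qed.

Lemma hker_shift s w w' : hker (s + w.1, w.2) (s + w'.1, w'.2) = hker w w'.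
Proof.
apply: (@kpert_invariant _ _ _ stm tk hq mk k0 measurable_hq hq_ge0 (fun w => (s + w.1, w.2))).
- by move=> g mg g0; exact: stm_shift.
- by move=> x y; exact: tker_shift.
- by [].
Qed.

Lemma hker_gt0 s x u z : s < u -> z != 0 -> (0 < hker (s, x) (u, z))%E.
Proof.
move=> su z0; apply: lt_le_trans (kpert_ge stm k0 hq_ge0 _ _).
by rewrite tkerE// lte_fin pker_gt0// subr_gt0.
Qed.

(** The supersolution gives a finite bound for the perturbed potential of
    functions bounded by 1 + hpot. *)
Lemma kop_hker_fin : exists (kap : R) (f : 'rV[R]_n -> R),
  [/\ measurable_fun setT f, forall z, 0 <= f z,
      exists2 C : R, 0 <= C & forall z, z != 0 -> 1 + hpot z <= C * f z &
      forall s x, x != 0 ->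
        (kop stm hker (fun w => (expR (- (kap * w.1)) * f w.2)%:E) (s, x) < +oo)%E].
Proof.
have [kap [C [f [H [[mf f0 mH H0] [C0 fC] hU]]]]] := supersolution n_gt0 a_gt0 a_lt1 b_gt0.
exists kap, f; split=> //; first by exists C.
move=> s x x0.
pose F (g : 'rV[R]_n -> R) (w : E) := (expR (- (kap * w.1)) * g w.2)%:E.
have mF (g : 'rV[R]_n -> R) : measurable_fun setT g -> measurable_fun setT (F g).
  move=> mg; apply/measurable_EFinP; apply: measurable_funM; first by meas.
  by apply: (measurableT_comp mg); meas.
have F0 (g : 'rV[R]_n -> R) : (forall z, 0 <= g z) -> forall w, (0 <= F g w)%E.
  by move=> g0 w; rewrite lee_fin mulr_ge0 ?expR_ge0.
apply: (@le_lt_trans _ _ (F H (s, x))); last by rewrite ltry.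
apply: (@kop_kpert_le _ _ _ stm tk hq mk k0 measurable_hq hq_ge0 [set w | w.2 != 0]) => //.
- exact: mF.
- exact: F0.
- exact: mF.
- exact: F0.
- by move=> v w /negP; rewrite negbK => /eqP; exact: tker_off.
move=> [s' x'] /= x'0.
have -> : (fun y => F f y + hq y * F H y)%E = F (fun z => f z + hpot z * H z).
  by apply/funext => w; rewrite /F /hq -EFinM -EFinD; congr EFin; ring.
rewrite (kop_tker_resolvent a_gt0 a_lt1)//; last 2 first.
- by apply: measurable_funD => //; apply: measurable_funM => //; exact: measurable_hpot.
- by move=> z; rewrite addr_ge0// mulr_ge0// hpot_ge0.
rewrite /F /= EFinM; apply: lee_wpmul2l; first by rewrite lee_fin expR_ge0.
exact: hU.
Qed.

(** On the bounded time interval that carries [G] the weight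
    [exp (- kap u)] is bounded below. *)
Lemma kop_hker_lty G M T s x : measurable_fun setT G -> (forall w, 0 <= G w) ->
  (forall w, G w <= M * (1 + hpot w.2)) -> (forall w, T < `|w.1| -> G w = 0) -> x != 0 ->
  (kop stm hker (EFin \o G) (s, x) < +oo)%E.
Proof.
move=> mG G0 GM GT x0; have [kap [f [mf f0 [C C0 fC] hf]]] := kop_hker_fin.
have h1 z : 1 <= 1 + hpot z by rewrite lerDl hpot_ge0.
have M0 : 0 <= M.
  have := le_trans (G0 (0, 0)) (GM (0, 0)); rewrite pmulr_lge0//.
  exact: lt_le_trans (h1 _).
pose F w := (expR (- (kap * w.1)) * f w.2)%:E.
have mF : measurable_fun setT F.
  apply/measurable_EFinP; apply: measurable_funM; first by meas.
  by apply: (measurableT_comp mf); meas.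
have F0 w : (0 <= F w)%E by rewrite lee_fin mulr_ge0 ?expR_ge0.
pose c := expR (`|kap| * `|T|) * (M * C).
have c0 : 0 <= c by rewrite !mulr_ge0 ?expR_ge0.
apply: (@le_lt_trans _ _ (kop stm hker (fun w => c%:E * F w)%E (s, x))).
  apply: le_kop.
  - exact: measurable_hker.
  - exact: hker_ge0.
  - exact/measurable_EFinP.
  - by move=> w; rewrite lee_fin.
  - by apply: emeasurable_funM.
  move=> w kw; have w0 : w.2 != 0.
    by apply: contra kw => /eqP h; apply/eqP; apply: hker_off; right.
  rewrite /F -EFinM lee_fin.
  have [wT|wT] := leP `|w.1| T; last by rewrite GT// !mulr_ge0 ?expR_ge0.
  apply: le_trans (GM w) _; apply: (@le_trans _ _ (M * (C * f w.2))); first by rewrite ler_wpM2l// fC.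
  rewrite mulrA (_ : c * _ = (expR (`|kap| * `|T|) * expR (- (kap * w.1))) * (M * C * f w.2)); last first.
    by rewrite /c; ring.
  rewrite ler_peMl ?mulr_ge0// -expRD -[leLHS]expR0 ler_expR.
  have : kap * w.1 <= `|kap| * `|T|.
    apply: le_trans (ler_norm _) _; rewrite normrM ler_wpM2l//.
    by apply: le_trans wT _; exact: ler_norm.
  by rewrite subr_ge0.
rewrite /kop (_ : integral _ _ _ = c%:E * kop stm hker F (s, x))%E; last first.
  rewrite /kop -ge0_integralZl//=; last 2 first.
  - apply: emeasurable_funM => //; exact: measurable_section (s, x) measurable_hker.
  - by move=> w _; apply: mule_ge0 => //; exact: hker_ge0.
  by apply: eq_integral => w _; rewrite muleCA.
rewrite lte_mul_pinfty ?lee_fin//; last exact: hf.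
Qed.

(** The kernel has a finite integral against a function that is strictly
    positive off the origin, and it vanishes at the origin. *)
Lemma hker_ae_fin s x : x != 0 -> {ae stm, forall w, hker (s, x) w \is a fin_num}.
Proof.
move=> x0; have [kap [f [mf f0 [C C0 fC] hf]]] := kop_hker_fin.
pose F w := (expR (- (kap * w.1)) * f w.2)%:E.
have mF : measurable_fun setT F.
  apply/measurable_EFinP; apply: measurable_funM; first by meas.
  by apply: (measurableT_comp mf); meas.
have F0 w : (0 <= F w)%E by rewrite lee_fin mulr_ge0 ?expR_ge0.
have mh : measurable_fun setT (hker (s, x)) by exact: measurable_section (s, x) measurable_hker.
have i : stm.-integrable setT (fun w => hker (s, x) w * F w)%E.
  apply/integrableP; split; first exact: emeasurable_funM.
  under eq_integral do rewrite gee0_abs ?mule_ge0 ?hker_ge0//.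
  exact: hf.
have := integrable_ae measurableT i; apply: filterS => w /(_ I).
have [w0|w0] := eqVneq w.2 0; first by rewrite hker_off//; right.
have Fw : 0 < expR (- (kap * w.1)) * f w.2.
  rewrite mulr_gt0 ?expR_gt0//.
  have : 0 < C * f w.2 by rewrite (lt_le_trans _ (fC _ w0))// ltr_pwDl// hpot_ge0.
  by move=> h; rewrite lt_neqAle f0 andbT eq_sym; apply: contraTneq h => ->; rewrite mulr0 ltxx.
rewrite (ge0_fin_numE (mule_ge0 (hker_ge0 _ _) (F0 w))) (ge0_fin_numE (hker_ge0 _ _)).
case: (hker (s, x) w) (hker_ge0 (s, x) w) => [r| |] //= _.
  by move=> _; exact: ltry.
by rewrite /F mulyr gtr0_sg// mul1e.
Qed.

End perturbed_kernel.

(** * The equation for the perturbed kernel *)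
Section free_potential.
Context {R : realType} {n : nat}.
Local Notation mu := (@lebesgue_measure R).
Local Notation E := (measurableTypeR R * 'rV[R]_n)%type.
Local Notation pos := (`]0, +oo[%classic : set (measurableTypeR R)).
Implicit Types (x z : 'rV[R]_n) (t s u T M : R) (w : E) (g : E -> R).
Variable a : R.
Hypotheses (n_gt0 : (0 < n)%N) (a_gt0 : 0 < a) (a_lt1 : a < 1).
Local Notation pker := (@pker R n a).
Local Notation tk := (@tker R n a).

Definition free_pot g s x : R :=
  \int[mu]_(u in `]s, +oo[) \int[lebesgue_rV n]_z (pker (u - s) (z - x) * g (u, z)).

Section bounded.
Variables (g : E -> R) (M T s : R) (x : 'rV[R]_n).
Hypotheses (mg : measurable_fun setT g) (gM : forall w, `|g w| <= M).
Hypothesis gT : forall w, T < `|w.1| -> g w = 0.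

Let D : set (measurableTypeR R) := `]s, +oo[%classic.

Let mD : measurable D. Proof. exact: measurable_itv. Qed.

Let DE u : \1_D u = (s < u)%R%:R :> R.
Proof. by rewrite indicE mem_setE in_itv/= andbT. Qed.

Let J u := \int[lebesgue_rV n]_z (pker (u - s) (z - x) * g (u, z)).

Let M0 : 0 <= M. Proof. by rewrite (le_trans _ (gM (0, 0))). Qed.

Lemma integrable_pker_bounded u : s < u ->
  (lebesgue_rV n).-integrable setT (EFin \o (fun z => pker (u - s) (z - x) * g (u, z))).
Proof.
rewrite -subr_gt0 => t0.
apply: (integrable_dom measurableT (g := fun z => M * pker (u - s) (z - x))) => //.
- apply: measurable_funM; first by apply: measurable_pker; meas.
  exact: measurableT_comp mg (measurable_pair1 u).
- by apply: integrable_scalel => //; exact: integrable_pker.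
- move=> z _; have p0 := ltW (pker_gt0 a_gt0 a_lt1 (z - x) t0).
  by rewrite normrM (ger0_norm p0) mulrC; apply: ler_wpM2r.
Qed.

Let J_le u : s < u -> `|J u| <= M.
Proof.
move=> su; have t0 : 0 < u - s by rewrite subr_gt0.
apply: (@le_trans _ _ (\int[lebesgue_rV n]_z (M * pker (u - s) (z - x)))).
  apply: normr_Rint_le => //.
  - exact: integrable_measurable (integrable_pker_bounded su).
  - by apply: integrable_scalel => //; exact: integrable_pker.
  - move=> z _; have p0 := ltW (pker_gt0 a_gt0 a_lt1 (z - x) t0).
    by rewrite normrM (ger0_norm p0) mulrC; apply: ler_wpM2r.
rewrite RintegralZl//; last exact: integrable_pker.
by rewrite Rint_pker// ler_piMr// -expR0 ler_expR oppr_le0 ltW.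
Qed.

Lemma integrable_free_pot : mu.-integrable setT (EFin \o (fun u => J u * \1_D u)).
Proof.
apply: (@integrable_dom R _ _ mu setT measurableT _ (fun u =>
  M * \1_(`[- T, T]%classic : set (measurableTypeR R)) u)).
- apply: measurable_funM; last exact: measurable_indic.
  apply: (@measurable_Rint R _ _ (measurableTypeR R) 'rV[R]_n (lebesgue_rV n)
    (fun u z => pker (u - s) (z - x) * g (u, z))).
  apply: measurable_funM; first by apply: measurable_pker; meas.
  by apply: (measurableT_comp mg); apply: measurable_fun_pair; meas.
- by apply: integrable_scalel => //; exact: integrable_indic_itv.
- move=> u _; rewrite DE indicE mem_setE in_itv/= -ler_norml.
  have [uT|uT] := leP `|u| T; last first.
    by rewrite /J; under eq_Rintegral do rewrite gT// mulr0; rewrite Rintegral_cst// !mul0r normr0 mulr0.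
  have [su|su] := ltP s u; last by rewrite mulr0 normr0 mulr_ge0.
  by rewrite !mulr1 J_le.
Qed.

Lemma kop_tker_free : (forall w, 0 <= g w) ->
  kop stm tk (EFin \o g) (s, x) = (free_pot g s x)%:E.
Proof.
move=> g0; rewrite /kop stm_tonelli; last 2 first.
- apply: emeasurable_funM; last exact/measurable_EFinP.
  exact: measurable_section (s, x) (@measurable_tker R n a).
- by move=> w; rewrite mule_ge0 ?lee_fin// tker_real_ge0.
rewrite /free_pot Rint_indic -Rint_EFin//; last exact: integrable_free_pot.
apply: eq_integral => u _; rewrite DE.
have [su|su] := ltP s u; last first.
  rewrite mulr0; apply: integral0_eq => z _.
  by rewrite /tker /= indicE mem_setE in_itv/= andbT subr_gt0 ltNge su /= mul0r mul0e.
rewrite mulr1 -Rint_EFin//; last exact: integrable_pker_bounded.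
have t0 : 0 < u - s by rewrite subr_gt0.
rewrite -[RHS](ge0_integral_nz n_gt0); last 2 first.
- apply: measurable_funM; first by apply: measurable_pker; meas.
  exact: measurableT_comp mg (measurable_pair1 u).
- move=> z; exact: (mulr_ge0 (ltW (pker_gt0 a_gt0 a_lt1 (z - x) t0)) (g0 _)).
apply: eq_integral => z _.
rewrite /tker /= indicE mem_setE in_itv/= andbT subr_gt0 su mul1r -EFinM.
by rewrite mulrAC.
Qed.

End bounded.

Lemma free_potB g (g' : E -> R) M T s x : measurable_fun setT g -> measurable_fun setT g' ->
  (forall w, `|g w| <= M) -> (forall w, `|g' w| <= M) ->
  (forall w, T < `|w.1| -> g w = 0) -> (forall w, T < `|w.1| -> g' w = 0) ->
  free_pot g s x - free_pot g' s x = free_pot (fun w => g w - g' w) s x.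
Proof.
move=> mg mg' gM gM' gT gT'; rewrite /free_pot.
rewrite [X in X - _]Rint_indic [X in _ - X]Rint_indic [RHS]Rint_indic.
rewrite -RintegralB//; last 2 first.
- exact: integrable_free_pot gM gT.
- exact: integrable_free_pot gM' gT'.
apply: eq_Rintegral => u _; rewrite -mulrBl indicE mem_setE in_itv/= andbT.
have [su|su] := ltP s u; last by rewrite !mulr0.
rewrite !mulr1 -RintegralB//; last 2 first.
- exact: integrable_pker_bounded gM _ su.
- exact: integrable_pker_bounded gM' _ su.
by apply: eq_Rintegral => z _; rewrite mulrBr.
Qed.

End free_potential.

Section posneg.
Context {R : realType}.
Implicit Types r : R.

Definition rpos r := Num.max r 0.

Definition rneg r := Num.max (- r) 0.

(** What the estimates of the source use of the positive and of the negative
    part. *)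
Definition sign_part (P : R -> R) : Prop :=
  [/\ measurable_fun setT P, forall r, 0 <= P r, forall r M, `|r| <= M -> P r <= M & P 0 = 0].

Lemma sign_part_rpos : sign_part rpos.
Proof.
split=> [|r|r M rM|]; last by rewrite /rpos maxxx.
- by apply: measurable_maxr.
- by rewrite le_max lexx orbT.
- by rewrite /rpos ge_max (le_trans (ler_norm _) rM) (le_trans _ rM).
Qed.

Lemma sign_part_rneg : sign_part rneg.
Proof.
have [mp p0 pM pz] := sign_part_rpos; split=> [|r|r M rM|].
- exact: measurableT_comp mp (@oppr_measurable R setT).
- exact: p0.
- by apply: pM; rewrite normrN.
- by rewrite /rneg oppr0 maxxx.
Qed.

Lemma rposBneg r : rpos r - rneg r = r.
Proof.
rewrite /rpos /rneg; have [r0|r0] := leP 0 r.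
  have h : - r <= 0 by rewrite oppr_le0.
  by rewrite (max_idPr h) subr0.
have h : 0 <= - r by rewrite oppr_ge0 ltW.
by rewrite (max_idPl h) sub0r opprK.
Qed.

Lemma balance_of_sub (p q p' q' r : R) :
  p - q = - r -> p' - q' = r -> (p%:E + p'%:E = q%:E + q'%:E)%E.
Proof. by move=> h h'; rewrite -!EFinD; congr EFin; move: h h'; lra. Qed.

End posneg.

Section equation.
Context {R : realType} {n : nat}.
Local Notation E := (measurableTypeR R * 'rV[R]_n)%type.
Implicit Types (x z : 'rV[R]_n) (t s u T M : R) (w : E).
Variables (alpha b : R) (phi : R * 'rV[R]_n -> R).
Local Notation a := (alpha / 2).
Hypotheses (n_gt0 : (0 < n)%N) (a_gt0 : 0 < a) (a_lt1 : a < 1) (b_gt0 : 0 < b).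
Hypothesis cphi : Cc_smooth phi.
Local Notation tk := (@tker R n a).
Local Notation hker := (@hker R n a b).
Local Notation hpot := (@hpot R n a b).

(** The source [(d/du - (1 - Laplacian) ^ a + V) phi], with [P] applied to its
    free part and to [phi] separately. *)
Definition source (P : R -> R) w : R :=
  P (free_op alpha phi w.1 w.2) + hpot w.2 * P (phi w).

Let th w := free_op alpha phi w.1 w.2.

Let mth : measurable_fun setT th. Proof. exact: measurable_free_op. Qed.

Let mphi : measurable_fun setT (phi : E -> R).
Proof.
have -> : (phi : E -> R) = fun w => phi (w.1, w.2) by apply/funext => -[].
exact: Cc_measurable.
Qed.

Let V0 := @hpot_ge0 R n a b a_gt0 b_gt0.

Let bounds : exists M T, [/\ 0 <= M, (forall w, `|th w| <= M), (forall w, `|phi w| <= M) &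
  forall w, T < `|w.1| -> th w = 0 /\ phi w = 0].
Proof.
have [M1 [T1 [M10 T10 h1 h2]]] := free_op_bounds a_gt0 a_lt1 cphi.
have [M2 [T2 [M20 T20 h3 h4 _]]] := Cc_bounds cphi.
exists (M1 + M2), (T1 + T2); split.
- exact: addr_ge0.
- by move=> w; rewrite (le_trans (h1 _ _))// lerDl.
- by move=> w; rewrite (le_trans (h3 _))// lerDr.
- move=> [u z] /= uT; split.
    by apply: h2; apply: le_lt_trans uT; rewrite lerDl ltW.
  by apply: h4; apply: le_lt_trans uT; rewrite lerDr ltW.
Qed.

Section part.
Variable P : R -> R.
Hypothesis sP : sign_part P.

Let mP d (T : measurableType d) (f : T -> R) : measurable_fun setT f ->
  measurable_fun setT (fun y => P (f y)).
Proof. by move=> mf; have [mP _ _ _] := sP; exact: measurableT_comp. Qed.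

Lemma measurable_source : measurable_fun setT (source P).
Proof.
apply: measurable_funD; first exact: mP.
apply: measurable_funM; last exact: mP.
by apply: (measurableT_comp (@measurable_hpot R n a b a_gt0 b_gt0)); meas.
Qed.

Lemma source_ge0 w : 0 <= source P w.
Proof. by have [_ P0 _ _] := sP; rewrite addr_ge0// mulr_ge0. Qed.

Lemma kop_source_lty s x : x != 0 -> (kop stm hker (EFin \o source P) (s, x) < +oo)%E.
Proof.
move=> x0; have [M [T [M0 thM phM zT]]] := bounds; have [_ P0 PM Pz] := sP.
apply: (@kop_hker_lty _ _ _ _ n_gt0 a_gt0 a_lt1 b_gt0 _ M T) => //.
- exact: measurable_source.
- exact: source_ge0.
- move=> w; rewrite /source mulrDr mulr1; apply: lerD; first exact: PM (thM w).
  by rewrite mulrC; apply: ler_wpM2r; [exact: V0|exact: PM].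
- by move=> w /zT[e1 e2]; rewrite /source -/(th w) e1 e2 Pz mulr0 addr0.
Qed.

End part.

(** The free equation for the test function, with its positive and negative
    parts moved to opposite sides. *)
Lemma free_balance w :
  (kop stm tk (fun v => (rpos (th v))%:E) w + (rpos (phi w))%:E =
   kop stm tk (fun v => (rneg (th v))%:E) w + (rneg (phi w))%:E)%E.
Proof.
have [M [T [M0 thM phM zT]]] := bounds; case: w => s x.
have [mpos p0 pM pz] := @sign_part_rpos R; have [mneg n0 nM nz] := @sign_part_rneg R.
have mp := measurableT_comp mpos mth; have mn := measurableT_comp mneg mth.
have thpM v : `|rpos (th v)| <= M by rewrite ger0_norm ?pM.
have thnM v : `|rneg (th v)| <= M by rewrite ger0_norm ?nM.
have pT v : T < `|v.1| -> rpos (th v) = 0 by move=> /zT[-> _].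
have nT v : T < `|v.1| -> rneg (th v) = 0 by move=> /zT[-> _].
rewrite (kop_tker_free n_gt0 a_gt0 a_lt1 s x mp thpM pT (fun v => p0 (th v))).
rewrite (kop_tker_free n_gt0 a_gt0 a_lt1 s x mn thnM nT (fun v => n0 (th v))).
have := @free_potB R n a a_gt0 a_lt1 _ _ M T s x mp mn thpM thnM pT nT.
have -> : (fun v => rpos (th v) - rneg (th v)) = th by apply/funext => v; exact: rposBneg.
rewrite [X in _ = X]pker_free_identity// => h.
exact: balance_of_sub h (rposBneg _).
Qed.

(** Duhamel's formula turns the balance for the free kernel into the balance
    for the perturbed one; positive and negative parts are kept apart so that
    every term is a well-defined integral. *)
Lemma hker_balance w :
  (kop stm hker (EFin \o source rpos) w + (rpos (phi w))%:E =
   kop stm hker (EFin \o source rneg) w + (rneg (phi w))%:E)%E.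
Proof.
have mk := @measurable_tker R n a; have k0 := @tker_ge0 R n a a_gt0 a_lt1.
have mq := @measurable_hq R n a b a_gt0 b_gt0.
have q0 v : (0 <= @hq R n a b v)%E by rewrite lee_fin.
have mK := @measurable_hker R n a b a_gt0 a_lt1 b_gt0.
have K0 := @hker_ge0 R n a b a_gt0 a_lt1 b_gt0.
pose q := @hq R n a b.
have split_kop (f g : E -> R) : measurable_fun setT f -> measurable_fun setT g ->
    (forall v, 0 <= f v) -> (forall v, 0 <= g v) ->
    (kop stm hker (fun v => (f v + hpot v.2 * g v)%:E) w + (g w)%:E =
     (kop stm tk (EFin \o f) w + (g w)%:E) +
     kop stm hker (fun v => q v * (kop stm tk (EFin \o f) v + (g v)%:E)) w)%E.
  move=> mf mg f0 g0.
  have mfE : measurable_fun setT (EFin \o f) by exact/measurable_EFinP.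
  have mgE : measurable_fun setT (EFin \o g) by exact/measurable_EFinP.
  have f0E v : (0 <= (EFin \o f) v)%E by rewrite lee_fin.
  have g0E v : (0 <= (EFin \o g) v)%E by rewrite lee_fin.
  have mkf : measurable_fun setT (kop stm tk (EFin \o f)) by exact: measurable_kop.
  have kf0 v : (0 <= kop stm tk (EFin \o f) v)%E by exact: kop_ge0.
  have mqg : measurable_fun setT (fun v => q v * (EFin \o g) v)%E by exact: emeasurable_funM.
  have qg0 v : (0 <= q v * (EFin \o g) v)%E by exact: mule_ge0.
  have mqk : measurable_fun setT (fun v => q v * kop stm tk (EFin \o f) v)%E by exact: emeasurable_funM.
  have qk0 v : (0 <= q v * kop stm tk (EFin \o f) v)%E by exact: mule_ge0.
  have -> : (fun v => (f v + hpot v.2 * g v)%:E) = (fun v => (EFin \o f) v + q v * (EFin \o g) v)%E.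
    by apply/funext => v; rewrite /q /hq /= -EFinM -EFinD.
  rewrite (@kopD _ _ _ stm hker _ _ w mK K0 mfE f0E mqg qg0).
  rewrite (@kop_kpert_duhamel _ _ _ stm tk q mk k0 mq q0 (EFin \o f) w mfE f0E) -/hker.
  have -> : (fun v => q v * (kop stm tk (EFin \o f) v + (g v)%:E))%E =
      (fun v => q v * kop stm tk (EFin \o f) v + q v * (EFin \o g) v)%E.
    by apply/funext => v; exact: (ge0_muleDr _ (kf0 v) (g0E v)).
  rewrite (@kopD _ _ _ stm hker _ _ w mK K0 mqk qk0 mqg qg0).
  have reorder (A B C D : \bar R) : (A + B + C + D = A + D + (B + C))%E.
    by rewrite -!addeA; congr (_ + _)%E; rewrite addeA addeC.
  exact: reorder.
have [mpos p0 _ _] := @sign_part_rpos R; have [mneg n0 _ _] := @sign_part_rneg R.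
rewrite [LHS](split_kop _ _ (measurableT_comp mpos mth) (measurableT_comp mpos mphi)
  (fun v => p0 (th v)) (fun v => p0 (phi v))).
rewrite [RHS](split_kop _ _ (measurableT_comp mneg mth) (measurableT_comp mneg mphi)
  (fun v => n0 (th v)) (fun v => n0 (phi v))).
rewrite [X in (X + _ = _)%E](free_balance w); congr (_ + _)%E.
by apply: eq_integral => v _; congr (_ * (_ * _))%E; exact: free_balance.
Qed.

End equation.

(** * The density *)
Section finite_value.
Context {R : realType}.
Implicit Types y : \bar R.

(** The value 1 at infinity, instead of the 0 given by [fine], keeps the density
    strictly positive. *)
Definition fin_val y : R := fine y + \1_[set +oo%E] y.

Lemma measurable_fin_val : measurable_fun setT fin_val.
Proof.
apply: measurable_funD; first by [].
by apply: measurable_indic; exact: emeasurable_set1.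
Qed.

Lemma fin_valE y : y \is a fin_num -> fin_val y = fine y.
Proof. by case: y => [r| |]// _; rewrite /fin_val indicE memNset// addr0. Qed.

Lemma fin_val_gt0 y : (0 < y)%E -> 0 < fin_val y.
Proof.
case: y => [r| |]//; rewrite /fin_val indicE; first by rewrite lte_fin memNset// addr0.
by move=> _; rewrite mem_set//= add0r.
Qed.

End finite_value.

Section density.
Context {R : realType} {n : nat}.
Local Notation E := (measurableTypeR R * 'rV[R]_n)%type.
Local Notation pos := (`]0, +oo[%classic : set (measurableTypeR R)).
Implicit Types (x z : 'rV[R]_n) (t s u T M : R) (w : E) (G : E -> R).
Variables (a b : R).
Hypotheses (n_gt0 : (0 < n)%N) (a_gt0 : 0 < a) (a_lt1 : a < 1) (b_gt0 : 0 < b).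
Local Notation hker := (@hker R n a b).

Definition hdens (w : R * 'rV[R]_n * 'rV[R]_n) : R :=
  fin_val (hker (0, w.1.2) (w.1.1, w.2)).

Lemma measurable_hdens :
  measurable_fun setT (hdens : measurableTypeR R * 'rV[R]_n * 'rV[R]_n -> R).
Proof.
apply: (measurableT_comp measurable_fin_val).
apply: (measurableT_comp (measurable_hker a_gt0 a_lt1 b_gt0)
  (g := fun w : measurableTypeR R * 'rV[R]_n * 'rV[R]_n => ((0, w.1.2), (w.1.1, w.2)) : E * E)).
apply: measurable_fun_pair.
- apply: measurable_fun_pair; first exact: measurable_cst.
  exact: measurableT_comp measurable_snd measurable_fst.
- apply: measurable_fun_pair; last exact: measurable_snd.
  exact: measurableT_comp measurable_fst measurable_fst.
Qed.

Lemma hdens_gt0 (w : R * 'rV[R]_n * 'rV[R]_n) : 0 < w.1.1 -> w.2 != 0 -> 0 < hdens w.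
Proof. by move=> t0 z0; apply: fin_val_gt0; exact: hker_gt0. Qed.

Section integral.
Variables (G : E -> R) (s : R) (x : 'rV[R]_n).
Hypotheses (mG : measurable_fun setT G) (G_ge0 : forall w, 0 <= G w) (x0 : x != 0).
Hypothesis G_fin : (kop stm hker (EFin \o G) (s, x) < +oo)%E.

Definition hdens_fun w : R :=
  hdens (w.1 - s, x, w.2) * G w * (\1_pos (w.1 - s) * nz w.2).

Let mI : measurable_fun setT hdens_fun.
Proof.
apply: measurable_funM.
  apply: measurable_funM => //; apply: (measurableT_comp measurable_hdens).
  apply: measurable_fun_pair; last exact: measurable_snd.
  by apply: measurable_fun_pair; meas.
apply: measurable_funM; last by apply: measurable_nz; meas.
apply: (@measurableT_comp _ _ _ _ _ _ (\1_pos : measurableTypeR R -> R)); last by meas.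
by apply: measurable_indic; exact: measurable_itv.
Qed.

Let I_ge0 w : 0 <= hdens_fun w.
Proof.
rewrite /hdens_fun indicE mem_setE in_itv/= andbT.
have [t0|t0] := ltP 0 (w.1 - s); last by rewrite mul0r mulr0.
have [z0|z0] := eqVneq w.2 0; first by rewrite /nz z0 eqxx !mulr0.
have p0 : 0 < hdens (w.1 - s, x, w.2) by exact: hdens_gt0.
by rewrite mul1r (mulr_ge0 (mulr_ge0 (ltW p0) (G_ge0 w)) (nz_ge0 _)).
Qed.

(** The kernel depends on the times through their difference only, and is
    infinite at most on a null set. *)
Lemma integral_hdens_fun :
  (\int[stm]_w (hdens_fun w)%:E = kop stm hker (EFin \o G) (s, x))%E.
Proof.
apply: ae_eq_integral => //.
- exact/measurable_EFinP.
- apply: emeasurable_funM; last exact/measurable_EFinP.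
  exact: measurable_section (s, x) (measurable_hker a_gt0 a_lt1 b_gt0).
have := hker_ae_fin n_gt0 a_gt0 a_lt1 b_gt0 s x0; apply: filterS => w fw _.
rewrite /hdens_fun indicE mem_setE in_itv/= andbT subr_gt0.
have [su|su] := ltP s w.1; last by rewrite mul0r mulr0 hker_off ?mul0e//; left.
have [z0|z0] := eqVneq w.2 0; first by rewrite /nz z0 eqxx !mulr0 hker_off ?mul0e//; right.
have -> : hdens (w.1 - s, x, w.2) = fine (hker (s, x) w).
  rewrite /hdens /= -(hker_shift a_gt0 a_lt1 b_gt0 s) /= addr0 addrC subrK.
  by rewrite fin_valE//; case: (w) fw.
by rewrite /nz z0 !mulr1 EFinM fineK.
Qed.

Lemma integrable_hdens_fun : stm.-integrable setT (EFin \o hdens_fun).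
Proof.
apply/integrableP; split; first exact/measurable_EFinP.
under eq_integral do rewrite /= ger0_norm//.
by rewrite integral_hdens_fun.
Qed.

End integral.
End density.

Theorem proposition1p1 (R : realType) (d : nat) (alpha delta : R)
    (d_gt0 : (0 < d)%N)
    (alpha_gt0 : 0 < alpha) (alpha_lt : alpha < Num.min 2 d%:R)
    (delta_gt0 : 0 < delta) (delta_lt : delta < d%:R - alpha) :
  exists p : R * 'rV[R]_d * 'rV[R]_d -> R,
    let D := [set w : R * 'rV[R]_d * 'rV[R]_d |
                [/\ 0 < w.1.1, w.1.2 != 0 & w.2 != 0]] in
    [/\ measurable_fun D p,
        (forall w, D w -> 0 < p w) &
        forall (s : R) (x : 'rV[R]_d) (phi : R * 'rV[R]_d -> R),
          x != 0 -> Cc_smooth phi ->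
          let integrand (u : R) (z : 'rV[R]_d) : R :=
            p (u - s, x, z) *
            (derive1 (fun t => phi (t, z)) u
             - relativistic_op alpha (fun y => phi (u, y)) z
             + potential alpha delta z * phi (u, z)) in
          (lebesgue_measure \x lebesgue_rV d)%E.-integrable
            (`]s, +oo[ `*` [set~ 0]) (fun w => (integrand w.1 w.2)%:E) /\
          (\int[lebesgue_measure]_(u in `]s, +oo[)
             \int[lebesgue_rV d]_(z in [set~ 0%R]) (integrand u z)%:E)%E
          = (- phi (s, x))%:E].
Proof.
have a0 : 0 < alpha / 2 by rewrite divr_gt0.
have a1 : alpha / 2 < 1.
  by rewrite ltr_pdivrMr// mul1r (lt_le_trans alpha_lt)// ge_min lexx.
have db0 : 0 < d%:R - delta - alpha by lra.
pose b := (d%:R - delta - alpha) / 2.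
have b0 : 0 < b by rewrite divr_gt0.
exists (hdens (alpha / 2) b) => D; split.
- by apply: measurable_funTS; exact: measurable_hdens.
- by move=> w [t0 _ z0]; exact: hdens_gt0.
move=> s x phi x0 cphi integrand.
have sp := @sign_part_rpos R; have sn := @sign_part_rneg R.
pose Sp := source alpha b phi rpos; pose Sn := source alpha b phi rneg.
have mSp : measurable_fun setT Sp := measurable_source a0 a1 b0 cphi sp.
have mSn : measurable_fun setT Sn := measurable_source a0 a1 b0 cphi sn.
have Sp0 w : 0 <= Sp w := @source_ge0 R d alpha b phi a0 b0 _ sp w.
have Sn0 w : 0 <= Sn w := @source_ge0 R d alpha b phi a0 b0 _ sn w.
have Spf := kop_source_lty d_gt0 a0 a1 b0 cphi sp s x0.
have Snf := kop_source_lty d_gt0 a0 a1 b0 cphi sn s x0.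
pose Ip := hdens_fun (alpha / 2) b Sp s x; pose In := hdens_fun (alpha / 2) b Sn s x.
have iIp : stm.-integrable setT (EFin \o Ip) by exact: integrable_hdens_fun.
have iIn : stm.-integrable setT (EFin \o In) by exact: integrable_hdens_fun.
(* The integrand of the theorem, extended by zero. *)
pose Q w := Ip w - In w.
have iQ : stm.-integrable setT (EFin \o Q).
  by exact: integrable_sub.
have QE u z : Q (u, z) = integrand u z * ((s < u) && (z != 0))%R%:R.
  rewrite /Q /Ip /In /hdens_fun /= indicE mem_setE in_itv/= andbT subr_gt0.
  have [su|su] := ltP s u; last by rewrite !mul0r !mulr0 subrr.
  have [->|z0] := eqVneq z 0; first by rewrite /nz eqxx !mulr0 subrr.
  rewrite /nz z0 !mulr1 -mulrBr /integrand (potential_bes alpha_gt0 db0 z0); congr (_ * _).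
  rewrite /Sp /Sn /source opprD addrACA -mulrBr !rposBneg.
  by [].
have QP : (fun w => (integrand w.1 w.2)%:E) \_ (`]s, +oo[ `*` [set~ 0]) = EFin \o Q.
  apply/funext => -[u z]; rewrite patchE /= QE.
  have -> : ((u, z) \in `]s, +oo[ `*` [set~ 0]) = (s < u) && (z != 0).
    apply/idP/idP; rewrite inE /= in_itv/= andbT.
      by move=> [-> /eqP].
    by move=> /andP[-> /eqP].
  by case: ifP => _; rewrite ?mulr1 ?mulr0.
split.
  apply/integrable_mkcond; last by rewrite QP; exact: iQ.
  apply: measurableX; first exact: measurable_itv.
  have := @measurable_nz_set R d; congr measurable.
  by apply/seteqP; split => z /= /eqP.
have h12 := integral12_prod_meas1 iQ.
transitivity (\int[stm]_w (Q w)%:E)%E; last first.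
  transitivity (\int[stm]_w (Ip w)%:E - \int[stm]_w (In w)%:E)%E.
    by under eq_integral do rewrite EFinB; rewrite integralB.
  rewrite !integral_hdens_fun//.
  have := hker_balance d_gt0 a0 a1 b0 cphi (s, x).
  have kp0 : (0 <= kop stm (hker (alpha / 2) b) (EFin \o Sp) (s, x))%E.
    by apply: kop_ge0 => [v w|w]; [exact: hker_ge0|rewrite lee_fin].
  have kn0 : (0 <= kop stm (hker (alpha / 2) b) (EFin \o Sn) (s, x))%E.
    by apply: kop_ge0 => [v w|w]; [exact: hker_ge0|rewrite lee_fin].
  rewrite -/Sp -/Sn -(fineK (_ : kop _ _ (EFin \o Sp) _ \is a fin_num)) ?ge0_fin_numE//.
  rewrite -(fineK (_ : kop _ _ (EFin \o Sn) _ \is a fin_num)) ?ge0_fin_numE//.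
  rewrite -!EFinD => -[h]; congr EFin.
  have := rposBneg (phi (s, x)); lra.
rewrite -[RHS]h12 integral_mkcond; apply: eq_integral => u _.
rewrite patchE /fubini_F mem_setE in_itv/= andbT.
case: ifPn => su; last first.
  by apply/esym; apply: integral0_eq => z _; rewrite QE (negbTE su) mulr0.
rewrite integral_mkcond; apply: eq_integral => z _.
rewrite patchE QE su /=.
have -> : (z \in [set~ 0]) = (z != 0).
  by apply/idP/idP; rewrite inE => /= /eqP.
by case: ifP => _; rewrite ?mulr1 ?mulr0.
Qed.
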